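(* Let $\mathcal{A}\in\mathbb{C}^{N\times N}$, $\mathcal{B}\in\mathbb{C}^{N\times P}$, $\mathcal{C}\in\mathbb{C}^{Q\times N}$ be matrices, let $\|\cdot\|$ denote the matrix norm induced by the vector $p$-norm for a fixed $p\in[1,\infty]$, and let $\epsilon>0$. Let $L_\epsilon$ be the arc length of the boundary of the input-output $\epsilon$-pseudospectrum $\sigma_\epsilon(\mathcal{A},\mathcal{B},\mathcal{C})$, or of the boundary of its convex hull. Then for all $t\ge 0$ $$\|\mathcal{C}e^{t\mathcal{A}}\mathcal{B}\|\le \frac{L_\epsilon\, e^{t\,\alpha_\epsilon(\mathcal{A},\mathcal{B},\mathcal{C})}}{2\pi\epsilon},$$ where $\alpha_\epsilon(\mathcal{A},\mathcal{B},\mathcal{C})=\sup\{\operatorname{Re} s \mid s\in\sigma_\epsilon(\mathcal{A},\mathcal{B},\mathcal{C})\}$. (The bound holds for either choice of $L_\epsilon$.)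
   Context: The vector $p$-norms are $\|x\|_p=(\sum_k|x_k|^p)^{1/p}$ for $1\le p<\infty$ and $\|x\|_\infty=\max_k|x_k|$; the induced matrix norm is $\|M\|=\sup_{\|x\|_p=1}\|Mx\|_p$ (same $p$ on domain and codomain). The transfer matrix $\mathcal{C}(sI-\mathcal{A})^{-1}\mathcal{B}$ is regarded as a matrix of rational functions of $s\in\mathbb{C}$ (removable singularities removed); at a pole its norm is taken to be $+\infty$. The input-output $\epsilon$-pseudospectrum is $$\sigma_\epsilon(\mathcal{A},\mathcal{B},\mathcal{C})=\{s\in\mathbb{C}\mid \|\mathcal{C}(sI-\mathcal{A})^{-1}\mathcal{B}\|>\epsilon^{-1}\}.$$ The number $\alpha_\epsilon(\mathcal{A},\mathcal{B},\mathcal{C})$ is called the input-output pseudospectral abscissa. *)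

(* Defs.v *)
(* Reals R : realType from mathcomp-analysis, complex numbers R[i] from
   mathcomp-real-closed. *)
From mathcomp Require Export all_boot all_order all_algebra.
From mathcomp Require Export all_classical all_reals all_analysis.
From mathcomp Require Export complex.
Export Order.TTheory GRing.Theory Num.Theory.
Export numFieldNormedType.Exports.

Set Implicit Arguments.
Unset Strict Implicit.
Unset Printing Implicit Defensive.

Local Open Scope classical_set_scope.
Local Open Scope ring_scope.

(* The modulus of a complex number as an element of R (the generic norm `|z|
   of R[i] is the same number seen in R[i]). *)
Notation cmod := ComplexField.Normc.normc.

Section Norms.
Variable R : realType.

(* Meaningful for 1 <= p <= +oo only. *)
Definition pnorm (p : \bar R) n (x : 'cV[R[i]]_n) : R :=
  match p with
  | r%:E => (\sum_k cmod (x k 0) `^ r) `^ r^-1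
  | _ => \big[Num.max/0]_k cmod (x k 0)
  end.

(* sup set0 = 0, so that matrices without columns have norm 0. *)
Definition opnorm (p : \bar R) m n (M : 'M[R[i]]_(m, n)) : R :=
  sup [set pnorm p (M *m x) | x in [set x : 'cV[R[i]]_n | pnorm p x = 1]].

End Norms.

Definition expmx (K : numFieldType) n (M : 'M[K]_n) : 'M[K]_n :=
  lim (series (fun k => (k`!%:R)^-1 *: M ^+ k) @ \oo).

Section Pseudospectrum.
Variable R : realType.
Local Notation ratfun := {fraction {poly R[i]}}.

(* The rational function f is regular at s, with value v there. A removable
   singularity of a given quotient is a point at which another representative
   u / w of the same fraction has a non-vanishing denominator; f has a pole at
   s when no representative has this property. *)
Definition ratval (f : ratfun) (s v : R[i]) : Prop :=
  exists u w : {poly R[i]},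
    [/\ w.[s] != 0, f = tofrac u / tofrac w & v = u.[s] / w.[s]].

Definition ratmx m n (M : 'M[R[i]]_(m, n)) : 'M[ratfun]_(m, n) :=
  map_mx (@tofrac _ \o polyC) M.

Section InputOutput.
Variables (p : \bar R) (eps : R) (N P Q : nat).
Variables (A : 'M[R[i]]_N) (B : 'M[R[i]]_(N, P)) (C : 'M[R[i]]_(Q, N)).

(* C (sI - A)^-1 B, with s the indeterminate of the field of rational
   functions. *)
Definition transfer : 'M[ratfun]_(Q, P) :=
  ratmx C *m invmx ((tofrac 'X)%:M - ratmx A) *m ratmx B.

Definition transfer_norm (s : R[i]) : \bar R :=
  if `[< forall i j, exists v, ratval (transfer i j) s v >] then
    (opnorm p (\matrix_(i, j) xget 0 [set v | ratval (transfer i j) s v]))%:E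
  else +oo%E.

Definition io_pseudospectrum : set R[i] :=
  [set s | (eps^-1%:E < transfer_norm s)%E].

Definition io_abscissa : \bar R :=
  ereal_sup [set (complex.Re s)%:E | s in io_pseudospectrum].

End InputOutput.
End Pseudospectrum.

Definition boundary (K : numFieldType) (S : set K) : set K :=
  closure S `\` interior S.

Section PlaneGeometry.
Variable R : realType.
Implicit Types S U : set R[i].

(* Rcomplex R is the complex plane as a vector space over R. *)
Definition convex_hull S : set R[i] :=
  \bigcap_(K in [set K | convex_set (K : set (convex_lmodType (Rcomplex R)))
                         /\ S `<=` K]) K.

(* The maximum with 0 gives the empty set diameter 0 instead of -oo. *)
Definition diam S : \bar R :=
  maxe 0%E (ereal_sup [set (cmod (z.1 - z.2))%:E | z in S `*` S]).

Definition arc_length_at S (delta : R) : \bar R :=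
  ereal_inf [set (\sum_(0 <= k <oo) diam (U k))%E | U in
    [set U : (set R[i])^nat | (forall k, (diam (U k) <= delta%:E)%E)
                              /\ S `<=` \bigcup_k U k]].

(* One-dimensional Hausdorff measure: the total arc length of a finite union of
   rectifiable arcs that meet in finitely many points, defined for every S
   independently of any parametrization. *)
Definition arc_length S : \bar R :=
  ereal_sup [set arc_length_at S delta | delta in [set delta : R | 0 < delta]].

End PlaneGeometry.

(* Main.v *)
(** Let W be a bounded set containing the pseudospectrum sigma, with Re <= a on
    W, and write q(s) = (1 + t s / m)^m for the approximation of exp(t s). The
    integral of q(s) C (sI - A)^-1 B over a huge square is 2 pi i C q(A) B. Cut
    the square into small cells and replace the integrand by 0 on W. The
    integrals over the cells still add up to the one over the huge square. Cells
    that do not meet the boundary of W contribute almost nothing. On the other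
    cells the integrand is close to f 1_{~W} for a constant vector f of norm at
    most e^(t a) / eps, and the integral of 1_{~W} over the boundary of a cell
    has modulus at most the sum of the diameters of any family of sets covering
    the boundary of W in that cell: a line transversal to the direction of the
    integral crosses the part of the cell boundary outside W with total sign at
    most 1, and with sign 0 if it misses the cover. Sets that are small compared
    with the cells meet only one cell each, up to a small proportion, when the
    grid is suitably shifted, so the total is at most e^(t a) / eps times the
    arc length of the boundary of W.

    All contour integrals are midpoint sums. Off sigma the transfer function is
    holomorphic with a denominator bounded away from 0, thanks to a Bezout
    identity between its reduced numerators and its denominator. The two cases
    of the theorem are W = sigma and W = the convex hull of sigma. *)
Require Import Defs.
From mathcomp Require Import finmap measurable_realfun ring lra zify.

Set Implicit Arguments.
Unset Strict Implicit.
Unset Printing Implicit Defensive.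

Local Open Scope classical_set_scope.
Local Open Scope ring_scope.
Local Open Scope complex_scope.

(** * Midpoint sums around squares *)

(** The boundary of W is known only through covers by sets of small diameter. It need not be made of
    arcs, so there is no contour to deform onto. The sharp constant 1 / (2 pi eps) forbids charging
    a cell its perimeter; projecting the flux on its own direction reduces it to a count of level
    crossings, and one-dimensional Lebesgue measure is the only integration used. Two covers of the
    boundary are taken. A coarse one, fixed before the mesh, shows that the cells meeting the
    boundary have small total area, which absorbs the variation of the integrand. A fine one, taken
    after the mesh and the number of offsets, carries the main term. The number of midpoints is
    chosen last. The polynomial q replaces exp for two reasons: q(s) - q(A) is divisible by s - A by
    pure algebra, and |q(s)| is at most exp(t Re s) up to a factor that tends to 1 on bounded sets.
    The limit in m is taken at the very end. *)

Section Modulus.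
Variable R : realType.
Implicit Types z w : R[i].

Lemma normE z : `|z| = (cmod z)%:C.
Proof. by case: z. Qed.

Lemma cmod_ge0 z : 0 <= cmod z.
Proof. by case: z => a b; rewrite sqrtr_ge0. Qed.

Lemma cmodD z w : cmod (z + w) <= cmod z + cmod w.
Proof. exact: le_normcD. Qed.

Lemma cmodM z w : cmod (z * w) = cmod z * cmod w.
Proof. exact: ComplexField.Normc.normcM. Qed.

Lemma cmodN z : cmod (- z) = cmod z.
Proof. exact: normcN. Qed.

Lemma cmodB z w : cmod (z - w) <= cmod z + cmod w.
Proof. by rewrite -[cmod w]cmodN cmodD. Qed.

Lemma cmodC z w : cmod (z - w) = cmod (w - z).
Proof. by rewrite -cmodN opprB. Qed.

Lemma cmod0 : cmod (0 : R[i]) = 0.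
Proof. exact: ComplexField.Normc.normc0. Qed.

Lemma cmodV z : cmod z^-1 = (cmod z)^-1.
Proof. exact: ComplexField.Normc.normcV. Qed.

Lemma cmodX z n : cmod (z ^+ n) = cmod z ^+ n.
Proof.
elim: n => [|n IH]; first by rewrite !expr0 ComplexField.Normc.normc1.
by rewrite !exprS cmodM IH.
Qed.

Lemma cmodR (x : R) : cmod x%:C = `|x|.
Proof. by rewrite /= expr0n addr0 sqrtr_sqr. Qed.

Lemma cmod_i : cmod ('i%C : R[i]) = 1.
Proof. by rewrite /= expr0n expr1n add0r sqrtr1. Qed.

Lemma cmod_eq0 z : (cmod z == 0) = (z == 0).
Proof.
by apply/eqP/eqP => [/ComplexField.Normc.eq0_normc //|->]; rewrite cmod0.
Qed.

Lemma cmod_gt0 z : (0 < cmod z) = (z != 0).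
Proof. by rewrite lt_def cmod_ge0 andbT cmod_eq0. Qed.

Lemma cmod_sum (I : Type) (r : seq I) (P : pred I) (F : I -> R[i]) :
  cmod (\sum_(i <- r | P i) F i) <= \sum_(i <- r | P i) cmod (F i).
Proof.
elim/big_ind2: _ => [|x a y b xa yb|//]; first by rewrite cmod0.
by apply: le_trans (cmodD _ _) _; rewrite lerD.
Qed.

Lemma cmod_Re z : `|complex.Re z| <= cmod z.
Proof.
case: z => a b /=; rewrite -[leLHS]sqrtr_sqr ler_wsqrtr ?real_normK ?num_real//.
by rewrite lerDl sqr_ge0.
Qed.

Lemma cmod_Im z : `|complex.Im z| <= cmod z.
Proof.
case: z => a b /=; rewrite -[leLHS]sqrtr_sqr ler_wsqrtr//.
by rewrite lerDr sqr_ge0.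
Qed.

Lemma cmod_ReIm z : cmod z <= `|complex.Re z| + `|complex.Im z|.
Proof.
rewrite [in leLHS](complexE z); apply: le_trans (cmodD _ _) _.
by rewrite cmodM cmod_i mul1r !cmodR.
Qed.

Lemma realcD (x y : R) : (x + y)%:C = x%:C + y%:C.
Proof. exact: rmorphD. Qed.

Lemma realcN (x : R) : (- x)%:C = - x%:C.
Proof. exact: rmorphN. Qed.

Lemma realcM (x y : R) : (x * y)%:C = x%:C * y%:C.
Proof. exact: rmorphM. Qed.

Lemma realcV (x : R) : (x^-1)%:C = (x%:C)^-1.
Proof. exact: fmorphV. Qed.

Lemma realc_nat n : (n%:R : R)%:C = n%:R.
Proof. exact: rmorph_nat. Qed.

Lemma realc0 : (0 : R)%:C = 0.
Proof. by []. Qed.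

Lemma realc1 : (1 : R)%:C = 1.
Proof. by []. Qed.

Definition realcE := (realcD, realcN, realcM, realcV, realc_nat).

Lemma natrC n : (n%:R : R[i]) = (n%:R : R)%:C.
Proof. by rewrite rmorph_nat. Qed.

Lemma cmod_nat n : cmod (n%:R : R[i]) = n%:R.
Proof. by rewrite natrC cmodR normr_nat. Qed.

End Modulus.

Section Circulation.
Variable R : realType.
Local Notation C := R[i].
Implicit Types (f : C -> C) (z v : C).

Definition side f z v n : C :=
  \sum_(k < n) f (z + (k%:R + 2^-1) / n%:R * v) * (v / n%:R).

(* Midpoint Riemann sum of f(s) ds over the positively oriented boundary of the
   square with sides v and 'i%C * v at the corner z. *)
Definition circ f z v n : C :=
  side f z v n + side f (z + v) ('i%C * v) n
  - side f (z + 'i%C * v) v n - side f z ('i%C * v) n.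

Lemma side_linear (a b : C) f g z v n :
  side (fun s => a * f s + b * g s) z v n = a * side f z v n + b * side g z v n.
Proof.
rewrite /side !mulr_sumr -big_split/=; apply: eq_bigr => k _; ring.
Qed.

Lemma circ_linear (a b : C) f g z v n :
  circ (fun s => a * f s + b * g s) z v n = a * circ f z v n + b * circ g z v n.
Proof. rewrite /circ !side_linear; ring. Qed.

Lemma eq_side f g z v n :
  (forall k, (k < n)%N -> f (z + (k%:R + 2^-1) / n%:R * v) =
                          g (z + (k%:R + 2^-1) / n%:R * v)) ->
  side f z v n = side g z v n.
Proof. by move=> fg; apply: eq_bigr => k _; rewrite fg. Qed.

Lemma sum_nat_mul (V : nmodType) (F : nat -> V) K n :
  \sum_(k < K * n) F k = \sum_(I < K) \sum_(k < n) F (I * n + k)%N.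
Proof.
elim: K => [|K IH]; first by rewrite mul0n !big_ord0.
by rewrite mulSnr big_split_ord/= IH big_ord_recr.
Qed.

(** An exact identity: the midpoints of [K * n] equal steps on the long side are those of [n] steps
    on each of its [K] pieces. Hence midpoint sums can be cut and glued without error. *)
Lemma side_cat f z v K n :
  side f z (K%:R * v) (K * n) = \sum_(I < K) side f (z + I%:R * v) v n.
Proof.
case: K => [|K]; first by rewrite /side mul0n !big_ord0.
case: n => [|n].
  by rewrite /side muln0 big_ord0 big1// => I _; rewrite big_ord0.
rewrite /side (sum_nat_mul (fun k => f (z + (k%:R + 2^-1) / (K.+1 * n.+1)%:R *
  (K.+1%:R * v)) * (K.+1%:R * v / (K.+1 * n.+1)%:R))).
apply: eq_bigr => I _; apply: eq_bigr => k _.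
have K0 : K.+1%:R != 0 :> C by rewrite pnatr_eq0.
have n0 : n.+1%:R != 0 :> C by rewrite pnatr_eq0.
by congr (f _ * _); rewrite natrM ?natrD ?natrM; field;
  rewrite ?nat1r ?K0 ?n0.
Qed.

(* The contributions of the inner edges cancel. *)
Lemma circ_grid f z v K n :
  circ f z (K%:R * v) (K * n) =
  \sum_(I < K) \sum_(J < K) circ f (z + I%:R * v + 'i%C * (J%:R * v)) v n.
Proof.
rewrite /circ.
have -> : 'i%C * (K%:R * v) = K%:R * ('i%C * v) by ring.
rewrite !side_cat.
(* [h I J] is the lower and [g I J] the left edge of cell [(I, J)]; its upper and right edges belong
   to neighbours, so both double sums telescope. *)
pose h I J := side f (z + I%:R * v + 'i%C * (J%:R * v)) v n.
pose g I J := side f (z + I%:R * v + 'i%C * (J%:R * v)) ('i%C * v) n.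
transitivity (\sum_(I < K) \sum_(J < K) (h I J - h I J.+1) +
              \sum_(I < K) \sum_(J < K) (g I.+1 J - g I J)); last first.
  rewrite -big_split; apply: eq_bigr => I _ /=; rewrite -big_split.
  apply: eq_bigr => J _ /=; rewrite /h /g.
  have -> : z + I.+1%:R * v + 'i%C * (J%:R * v) =
            z + I%:R * v + 'i%C * (J%:R * v) + v by rewrite -natr1; ring.
  have -> : z + I%:R * v + 'i%C * (J.+1%:R * v) =
            z + I%:R * v + 'i%C * (J%:R * v) + 'i%C * v by rewrite -natr1; ring.
  ring.
have H1 (I : nat) : \sum_(J < K) (h I J - h I J.+1) = h I 0%N - h I K.
  rewrite -[RHS]opprB -(telescope_sumr (h I) (leq0n K)) big_mkord -sumrN.
  by apply: eq_bigr => J _; rewrite opprB.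
rewrite [X in _ = X + _](eq_bigr (fun I : 'I_K => h I 0%N - h I K)); last first.
  by move=> I _; exact: H1.
rewrite [X in _ = _ + X]exchange_big/=.
have H2 (J : nat) : \sum_(I < K) (g I.+1 J - g I J) = g K J - g 0%N J.
  by rewrite -(telescope_sumr (g^~ J) (leq0n K)) big_mkord.
rewrite [X in _ = _ + X](eq_bigr (fun J : 'I_K => g K J - g 0%N J)); last first.
  by move=> J _; exact: H2.
rewrite !sumrB.
have -> : \sum_(i < K) h i 0%N = \sum_(I < K) side f (z + I%:R * v) v n.
  by apply: eq_bigr => I _; rewrite /h mul0r mulr0 addr0.
have -> : \sum_(i < K) g 0%N i = \sum_(I < K) side f (z + I%:R * ('i%C * v)) ('i%C * v) n.
  by apply: eq_bigr => I _; rewrite /g mul0r addr0 mulrCA.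
have -> : \sum_(i < K) h i K =
    \sum_(I < K) side f (z + K%:R * ('i%C * v) + I%:R * v) v n.
  by apply: eq_bigr => I _; rewrite /h; congr (side f _ _ _); ring.
have -> : \sum_(i < K) g K i =
    \sum_(I < K) side f (z + K%:R * v + I%:R * ('i%C * v)) ('i%C * v) n.
  by apply: eq_bigr => I _; rewrite /g; congr (side f _ _ _); ring.
ring.
Qed.

Lemma side_bound f z v n (M : R) :
  (forall k, (k < n)%N -> cmod (f (z + (k%:R + 2^-1) / n%:R * v)) <= M) ->
  0 <= M -> cmod (side f z v n) <= M * cmod v.
Proof.
move=> fM M0; apply: le_trans (cmod_sum _ _ _) _.
case: n fM => [|n] fM; first by rewrite big_ord0 mulr_ge0// cmod_ge0.
apply: (@le_trans _ _ (\sum_(k < n.+1) M * (cmod v / n.+1%:R))).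
  apply: ler_sum => k _; rewrite cmodM [cmod (v / _)]cmodM cmodV cmod_nat.
  by rewrite ler_wpM2r ?fM// divr_ge0 ?cmod_ge0.
rewrite sumr_const card_ord -[leLHS]mulr_natr -mulrA divfK//.
Qed.

Definition square z v : set C :=
  [set z + (xy.1 +i* xy.2) * v | xy in
    [set xy : R * R | (0 <= xy.1 <= 1) && (0 <= xy.2 <= 1)]].
End Circulation.

(** * A quantitative Goursat theorem for midpoint sums *)

Section Squares.
Variable R : realType.
Local Notation C := R[i].
Implicit Types (f : C -> C) (z v : C).

Lemma in_square z v (x y : R) : 0 <= x <= 1 -> 0 <= y <= 1 ->
  square z v (z + (x +i* y) * v).
Proof. by move=> x01 y01; exists (x, y) => //=; rewrite x01 y01. Qed.

Lemma square_sub z v K I J : (I < K)%N -> (J < K)%N ->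
  square (z + I%:R * (v / K%:R) + 'i%C * (J%:R * (v / K%:R))) (v / K%:R)
  `<=` square z v.
Proof.
move=> IK JK _ [[x y]] /= /andP[/andP[x0 x1] /andP[y0 y1]] <-.
have K0 : (0 : R) < K%:R by rewrite ltr0n (leq_trans _ IK).
have aux (L : nat) (s : R) : (L < K)%N -> 0 <= s -> s <= 1 ->
    0 <= (L%:R + s) / K%:R <= 1.
  move=> LK s0 s1; rewrite divr_ge0 ?addr_ge0 ?ler0n//= ler_pdivrMr// mul1r.
  have : (L%:R + 1 : R) <= K%:R by rewrite natr1 ler_nat.
  by lra.
suff -> : z + I%:R * (v / K%:R) + 'i%C * (J%:R * (v / K%:R))
    + (x +i* y) * (v / K%:R) =
    z + (((I%:R + x) / K%:R) +i* ((J%:R + y) / K%:R)) * v.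
  by apply: in_square; apply: aux.
have KC : K%:R != 0 :> C by rewrite natrC (inj_eq (@complexI R)) gt_eqF.
rewrite [x +i* y]complexE [_ +i* ((J%:R + y) / K%:R)]complexE /=.
rewrite !realcE; field.
by [].
Qed.

Lemma square_diam z v p q : square z v p -> square z v q ->
  cmod (p - q) <= 2 * cmod v.
Proof.
move=> [[x y]] /= /andP[x01 y01] <- [[x' y']] /= /andP[x01' y01'] <-.
have -> : z + (x +i* y) * v - (z + (x' +i* y') * v) =
  ((x +i* y) - (x' +i* y')) * v by ring.
rewrite cmodM ler_wpM2r ?cmod_ge0//; apply: le_trans (cmod_ReIm _) _ => /=.
have : `|x - x'| <= 1 by rewrite ler_norml; lra.
have : `|y - y'| <= 1 by rewrite ler_norml; lra.
lra.
Qed.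

Lemma square_convex z v p q (s : R) : square z v p -> square z v q ->
  0 <= s <= 1 -> square z v (p + s%:C * (q - p)).
Proof.
move=> [[x y]] /= /andP[x01 y01] <- [[x' y']] /= /andP[x01' y01'] <- s01.
have -> : z + (x +i* y) * v + s%:C * (z + (x' +i* y') * v - (z + (x +i* y) * v))
  = z + ((x + s * (x' - x)) +i* (y + s * (y' - y))) * v.
  have -> : (x + s * (x' - x)) +i* (y + s * (y' - y)) =
    (x +i* y) + s%:C * ((x' +i* y') - (x +i* y)).
    by apply/eqP; rewrite eq_complex /= !mul0r subr0 addr0 !eqxx.
  ring.
apply: in_square; nra.
Qed.

(* A quantitative form of holomorphy: on a bounded D it is stable under the field
   operations, and it makes circulations cubic in the side of the square. *)
Definition has_taylor2 (D : set C) f := exists f' (M : R),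
  [/\ 0 <= M,
      forall z, D z -> cmod (f z) <= M,
      forall z, D z -> cmod (f' z) <= M,
      forall z w, D z -> D w -> cmod (f w - f z) <= M * cmod (w - z) &
      forall z w, D z -> D w ->
        cmod (f w - f z - f' z * (w - z)) <= M * cmod (w - z) ^+ 2].

Lemma has_taylor2_eq D f g : (forall z, D z -> f z = g z) ->
  has_taylor2 D f -> has_taylor2 D g.
Proof.
move=> fg [f' [M [M0 h1 h2 h3 h4]]]; exists f', M; split=> //.
- by move=> z Dz; rewrite -fg// h1.
- by move=> z w Dz Dw; rewrite -!fg// h3.
- by move=> z w Dz Dw; rewrite -!fg// h4.
Qed.

Lemma has_taylor2_cst D (a : C) : has_taylor2 D (fun=> a).
Proof.
exists (fun=> 0), (cmod a); split; rewrite ?cmod_ge0//.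
- by move=> z _; rewrite cmod0 cmod_ge0.
- by move=> z w _ _; rewrite subrr cmod0 mulr_ge0 ?cmod_ge0.
- by move=> z w _ _; rewrite subrr mul0r subr0 cmod0 mulr_ge0 ?exprn_ge0 ?cmod_ge0.
Qed.

Lemma has_taylor2_id (D : set C) (r : R) :
  (forall z, D z -> cmod z <= r) -> has_taylor2 D id.
Proof.
move=> Dr; exists (fun=> 1), (Num.max r 1); have r1 : 1 <= Num.max r 1.
  by rewrite le_max lexx orbT.
have r0 : 0 <= Num.max r 1 by apply: le_trans r1.
split=> //.
- by move=> z /Dr zr; rewrite le_max zr.
- by move=> z _; rewrite ComplexField.Normc.normc1.
- by move=> z w _ _; rewrite -[leLHS]mul1r ler_wpM2r ?cmod_ge0.
- by move=> z w _ _; rewrite mul1r subrr cmod0 mulr_ge0 ?exprn_ge0 ?cmod_ge0.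
Qed.

Lemma has_taylor2D D f g : has_taylor2 D f -> has_taylor2 D g ->
  has_taylor2 D (fun z => f z + g z).
Proof.
move=> [f' [M [M0 h1 h2 h3 h4]]] [g' [N [N0 k1 k2 k3 k4]]].
exists (fun z => f' z + g' z), (M + N); split; first exact: addr_ge0.
- by move=> z Dz; apply: le_trans (cmodD _ _) _; rewrite lerD ?h1 ?k1.
- by move=> z Dz; apply: le_trans (cmodD _ _) _; rewrite lerD ?h2 ?k2.
- move=> z w Dz Dw; rewrite opprD addrACA; apply: le_trans (cmodD _ _) _.
  by rewrite mulrDl lerD ?h3 ?k3.
- move=> z w Dz Dw.
  have -> : f w + g w - (f z + g z) - (f' z + g' z) * (w - z) =
    (f w - f z - f' z * (w - z)) + (g w - g z - g' z * (w - z)) by ring.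
  by apply: le_trans (cmodD _ _) _; rewrite mulrDl lerD ?h4 ?k4.
Qed.

Lemma has_taylor2M D f g : has_taylor2 D f -> has_taylor2 D g ->
  has_taylor2 D (fun z => f z * g z).
Proof.
move=> [f' [M [M0 h1 h2 h3 h4]]] [g' [N [N0 k1 k2 k3 k4]]].
have MN : 0 <= M * N by exact: mulr_ge0.
exists (fun z => f' z * g z + f z * g' z), (3 * (M * N)).
have bnd (a b : C) (x y x' y' : R) : cmod a <= x * y -> cmod b <= x' * y' ->
  cmod (a * b) <= (x * x') * (y * y').
  by move=> ax bx; rewrite cmodM mulrACA ler_pM ?cmod_ge0.
split=> //; first lra.
- move=> z Dz; rewrite cmodM.
  suff : cmod (f z) * cmod (g z) <= M * N by lra.
  by rewrite ler_pM ?cmod_ge0 ?h1 ?k1.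
- move=> z Dz; apply: le_trans (cmodD _ _) _; rewrite !cmodM.
  suff : cmod (f' z) * cmod (g z) <= M * N /\ cmod (f z) * cmod (g' z) <= M * N.
    lra.
  by split; rewrite ler_pM ?cmod_ge0 ?h1 ?k1 ?h2 ?k2.
- move=> z w Dz Dw.
  have -> : f w * g w - f z * g z = (f w - f z) * g w + f z * (g w - g z) by ring.
  apply: le_trans (cmodD _ _) _; rewrite !cmodM.
  have := cmod_ge0 (w - z); set d := cmod (w - z) => d0.
  have : cmod (f w - f z) * cmod (g w) <= (M * d) * N.
    by rewrite ler_pM ?cmod_ge0 ?h3 ?k1.
  have : cmod (f z) * cmod (g w - g z) <= M * (N * d).
    by rewrite ler_pM ?cmod_ge0 ?h1 ?k3.
  have : 0 <= M * N * d by rewrite mulr_ge0.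
  lra.
- move=> z w Dz Dw.
  have -> : f w * g w - f z * g z - (f' z * g z + f z * g' z) * (w - z) =
     (f w - f z - f' z * (w - z)) * g z + f z * (g w - g z - g' z * (w - z)) +
     (f w - f z) * (g w - g z) by ring.
  apply: le_trans (cmodD _ _) _.
  apply: le_trans (lerD (cmodD _ _) (lexx _)) _.
  rewrite !cmodM; set d := cmod (w - z).
  have : cmod (f w - f z - f' z * (w - z)) * cmod (g z) <= (M * d ^+ 2) * N.
    by rewrite ler_pM ?cmod_ge0 ?h4 ?k1.
  have : cmod (f z) * cmod (g w - g z - g' z * (w - z)) <= M * (N * d ^+ 2).
    by rewrite ler_pM ?cmod_ge0 ?h1 ?k4.
  have : cmod (f w - f z) * cmod (g w - g z) <= (M * d) * (N * d).
    by rewrite ler_pM ?cmod_ge0 ?h3 ?k3.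
  lra.
Qed.

Lemma has_taylor2V (D : set C) f (mu : R) : 0 < mu ->
  (forall z, D z -> mu <= cmod (f z)) ->
  has_taylor2 D f -> has_taylor2 D (fun z => (f z)^-1).
Proof.
move=> mu0 fmu [f' [M [M0 h1 h2 h3 h4]]].
have f0 z : D z -> f z != 0.
  by move=> Dz; rewrite -cmod_gt0 (lt_le_trans mu0)// fmu.
have fV z : D z -> cmod (f z)^-1 <= mu^-1.
  by move=> Dz; rewrite cmodV lef_pV2 ?posrE ?cmod_gt0 ?f0// fmu.
have imu : 0 < mu^-1 by rewrite invr_gt0.
set r := mu^-1 in fV imu *.
(* The constant adds up what the clauses need: [r] for the value, [M * r * r] for the derivative and
   the Lipschitz bound, the rest for the remainder. *)
exists (fun z => - f' z * ((f z)^-1 * (f z)^-1)), (r + M * r * r + (M + M * M * r) * r * r).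
have Mr : 0 <= M * r by rewrite mulr_ge0// ltW.
have Mrr : 0 <= M * r * r by rewrite mulr_ge0// ltW.
have MMrr : 0 <= M * M * r * r * r by rewrite !mulr_ge0// ltW.
have VV z w : D z -> D w -> cmod (f z)^-1 * cmod (f w)^-1 <= r * r.
  by move=> Dz Dw; rewrite ler_pM ?cmod_ge0 ?fV.
split=> //; first by nra.
- by move=> z Dz; apply: (le_trans (fV _ Dz)); nra.
- move=> z Dz; rewrite cmodM cmodN cmodM.
  have : cmod (f' z) * (cmod (f z)^-1 * cmod (f z)^-1) <= M * (r * r).
    by rewrite ler_pM ?mulr_ge0 ?cmod_ge0 ?h2 ?VV.
  nra.
- move=> z w Dz Dw.
  have -> : (f w)^-1 - (f z)^-1 = - (f w - f z) * ((f z)^-1 * (f w)^-1).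
    by field; rewrite !f0.
  rewrite cmodM cmodN cmodM.
  have := cmod_ge0 (w - z); set d := cmod (w - z) => d0.
  have : cmod (f w - f z) * (cmod (f z)^-1 * cmod (f w)^-1) <= (M * d) * (r * r).
    by rewrite ler_pM ?mulr_ge0 ?cmod_ge0 ?h3 ?VV.
  have : 0 <= r * d by rewrite mulr_ge0// ltW.
  have : 0 <= M * M * r * r * r * d by rewrite mulr_ge0.
  have : 0 <= M * r * r * d by rewrite mulr_ge0.
  lra.
- move=> z w Dz Dw.
  have -> : (f w)^-1 - (f z)^-1 - - f' z * ((f z)^-1 * (f z)^-1) * (w - z) =
     - (f w - f z - f' z * (w - z)) * ((f z)^-1 * (f w)^-1)
     + (f' z * (w - z)) * (f w - f z) * ((f z)^-1 * ((f z)^-1 * (f w)^-1)).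
    by field; rewrite !f0.
  apply: le_trans (cmodD _ _) _; rewrite !cmodM !cmodN.
  have := cmod_ge0 (w - z); set d := cmod (w - z) => d0.
  have : cmod (f w - f z - f' z * (w - z)) * (cmod (f z)^-1 * cmod (f w)^-1) <=
     (M * d ^+ 2) * (r * r).
    by rewrite ler_pM ?mulr_ge0 ?cmod_ge0 ?h4 ?VV.
  have : cmod (f' z) * d * cmod (f w - f z) *
      (cmod (f z)^-1 * (cmod (f z)^-1 * cmod (f w)^-1)) <=
     (M * d) * (M * d) * (r * (r * r)).
    rewrite ler_pM ?mulr_ge0 ?cmod_ge0//.
      by rewrite ler_pM ?mulr_ge0 ?cmod_ge0 ?h3// ler_wpM2r ?h2.
    by rewrite ler_pM ?mulr_ge0 ?cmod_ge0 ?fV ?VV.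
  have : 0 <= r * d ^+ 2 by rewrite mulr_ge0 ?exprn_ge0// ltW.
  have : 0 <= M * M * r * r * r * d ^+ 2 by rewrite mulr_ge0 ?exprn_ge0.
  have : 0 <= M * r * r * d ^+ 2 by rewrite mulr_ge0 ?exprn_ge0.
  lra.
Qed.

Lemma has_taylor2_sum D (I : Type) (s : seq I) (P : pred I) (F : I -> C -> C) :
  (forall i, P i -> has_taylor2 D (F i)) ->
  has_taylor2 D (fun z => \sum_(i <- s | P i) F i z).
Proof.
move=> hF; elim: s => [|i s IH].
  apply: has_taylor2_eq (has_taylor2_cst D 0) => z _.
  by rewrite big_nil.
case Pi : (P i).
  apply: has_taylor2_eq (has_taylor2D (hF i Pi) IH) => z _.
  by rewrite big_cons Pi.
by apply: has_taylor2_eq IH => z _; rewrite big_cons Pi.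
Qed.

Lemma has_taylor2_X D f n : has_taylor2 D f -> has_taylor2 D (fun z => f z ^+ n).
Proof.
move=> hf; elim: n => [|n IH]; first exact: has_taylor2_cst.
by apply: has_taylor2_eq (has_taylor2M hf IH) => z _; rewrite exprS.
Qed.

Lemma has_taylor2_poly (D : set C) (r : R) (p : {poly C}) :
  (forall z, D z -> cmod z <= r) -> has_taylor2 D (fun z => p.[z]).
Proof.
move=> Dr; apply: has_taylor2_eq (_ : has_taylor2 D
  (fun z => \sum_(i < size p) p`_i * z ^+ i)).
  by move=> z _; rewrite horner_coef.
apply: has_taylor2_sum => i _; apply: has_taylor2M.
  exact: has_taylor2_cst.
by apply: has_taylor2_X; exact: has_taylor2_id Dr.
Qed.

(** One-point circulations of affine functions vanish. Once the Taylor polynomial at the centre is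
    subtracted, each of the four edge midpoints, at distance [cmod v / 2] from the centre,
    contributes at most a quarter of the bound. *)
Lemma circ1_bound f z v (M : R) (f' : C -> C) : 0 <= M ->
  (forall a w, square z v a -> square z v w ->
     cmod (f w - f a - f' a * (w - a)) <= M * cmod (w - a) ^+ 2) ->
  cmod (circ f z v 1) <= M * cmod v ^+ 3.
Proof.
move=> M0 fM; pose c := z + (2^-1 +i* 2^-1) * v.
pose g w := f w - f c - f' c * (w - c).
have h01 : 0 <= (2^-1 : R) <= 1 by lra.
have ch : (2^-1 : C) = 2^-1%:C by rewrite fmorphV/= rmorph_nat.
have iE (y : R) : 'i%C * y%:C = 0 +i* y :> C.
  by apply/eqP; rewrite eq_complex /=; apply/andP; split; apply/eqP; ring.
have E (x y : R) (w : C) : (x +i* y) * w = (x%:C + 'i%C * y%:C) * w.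
  by rewrite [x +i* y]complexE.
have eqc : circ f z v 1 =
   (g (z + (2^-1 +i* 0) * v) + 'i%C * g (z + (1 +i* 2^-1) * v)
    - g (z + (2^-1 +i* 1) * v) - 'i%C * g (z + (0 +i* 2^-1) * v)) * v.
  rewrite /circ /side !big_ord1 !add0r !divr1 ch.
  have -> : z + 2^-1%:C * v = z + (2^-1 +i* 0) * v by [].
  have -> : z + v + 2^-1%:C * ('i%C * v) = z + (1 +i* 2^-1) * v.
    by rewrite (E 1 2^-1) realc1; ring.
  have -> : z + 'i%C * v + 2^-1%:C * v = z + (2^-1 +i* 1) * v.
    by rewrite (E 2^-1 1) realc1; ring.
  have -> : z + 2^-1%:C * ('i%C * v) = z + (0 +i* 2^-1) * v.
    by rewrite (E 0 2^-1) realc0; ring.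
  rewrite /g /c (E 1 2^-1) (E 0 2^-1) (E 2^-1 0) (E 2^-1 1) (E 2^-1 2^-1) realc1 realc0.
  have -> : 2^-1%:C = 2^-1 :> C by rewrite ch.
  set h : C := 2^-1.
  have h2 : h * 2 = 1 by rewrite /h mulVf// pnatr_eq0.
  have i2 : 'i%C * 'i%C = -1 :> C by rewrite -expr2 sqr_i.
  (* The offsets of the edge midpoints from the centre, weighted by the directions of the edges. *)
  suff : ((- 'i%C * h * v) + 'i%C * (h * v) - ('i%C * h * v) - 'i%C * (- h * v) = 0 :> C).
    move=> e0; apply/eqP; rewrite -subr_eq0; apply/eqP.
    transitivity (f' (z + (h + 'i%C * h) * v) * v *
      ((- 'i%C * h * v) + 'i%C * ((1 - h) * v) - ('i%C * (1 - h) * v) - 'i%C * (- h * v)));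
      first by ring.
    have -> : 1 - h = h by rewrite -h2; ring.
    by rewrite e0 mulr0.
  ring.
have gb (x y : R) : 0 <= x <= 1 -> 0 <= y <= 1 ->
    `|x - 2^-1| + `|y - 2^-1| <= 2^-1 ->
    cmod (g (z + (x +i* y) * v)) <= M * (4^-1 * cmod v ^+ 2).
  move=> x01 y01 xy; apply: le_trans (fM _ _ _ _) _; rewrite /c.
  - exact: in_square.
  - exact: in_square.
  rewrite ler_wpM2l//.
  have -> : z + (x +i* y) * v - (z + (2^-1 +i* 2^-1) * v) =
    ((x +i* y) - (2^-1 +i* 2^-1)) * v by ring.
  rewrite cmodM exprMn ler_wpM2r ?exprn_ge0 ?cmod_ge0//.
  have : cmod ((x +i* y) - (2^-1 +i* 2^-1)) <= 2^-1.
    by apply: le_trans (cmod_ReIm _) _; exact: xy.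
  by have := cmod_ge0 ((x +i* y) - (2^-1 +i* 2^-1)); nra.
rewrite eqc cmodM exprSr mulrA ler_wpM2r ?cmod_ge0//.
have nr : (`|2^-1 - 2^-1| = 0 :> R) /\ (`|0 - 2^-1| = 2^-1 :> R) /\ (`|1 - 2^-1| = 2^-1 :> R).
  rewrite subrr normr0 sub0r normrN; split=> //; split; first by apply: gtr0_norm; lra.
  by rewrite gtr0_norm; lra.
case: nr => n1 [n2 n3].
apply: le_trans (cmodB _ _) _; apply: le_trans (lerD (cmodB _ _) (lexx _)) _.
apply: le_trans (lerD (lerD (cmodD _ _) (lexx _)) (lexx _)) _.
rewrite !cmodM cmod_i !mul1r.
have := gb 2^-1 0; have := gb 1 2^-1; have := gb 2^-1 1; have := gb 0 2^-1.
rewrite n1 n2 n3 ?add0r ?addr0 => k1 k2 k3 k4.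
have := k1 ltac:(clear; lra) ltac:(clear; lra) (lexx _).
have := k2 ltac:(clear; lra) ltac:(clear; lra) (lexx _).
have := k3 ltac:(clear; lra) ltac:(clear; lra) (lexx _).
have := k4 ltac:(clear; lra) ltac:(clear; lra) (lexx _).
lra.
Qed.

(** Each of the [n ^ 2] subsquares of side [cmod v / n] contributes at most
    [M * (cmod v / n) ^ 3]. *)
Lemma circ_taylor2 D f : has_taylor2 D f -> exists2 M : R, 0 <= M &
  forall z v n, (0 < n)%N -> square z v `<=` D ->
    cmod (circ f z v n) <= M * cmod v ^+ 3 / n%:R.
Proof.
move=> [f' [M [M0 _ _ _ h4]]]; exists M => // z v n n0 sD.
have nC : n%:R != 0 :> C by rewrite pnatr_eq0 -lt0n.
have nR : n%:R != 0 :> R by rewrite pnatr_eq0 -lt0n.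
have -> : circ f z v n = circ f z (n%:R * (v / n%:R)) (n * 1).
  by rewrite mulrC divfK// muln1.
rewrite circ_grid; apply: le_trans (cmod_sum _ _ _) _.
apply: (@le_trans _ _ (\sum_(I < n) \sum_(J < n) M * (cmod v / n%:R) ^+ 3)).
  apply: ler_sum => I _; apply: le_trans (cmod_sum _ _ _) _.
  apply: ler_sum => J _.
  rewrite -(cmod_nat R n) -cmodV -cmodM; apply: (circ1_bound (f' := f')) => // a w sa sw.
   apply: h4; apply: sD; first exact: (square_sub (ltn_ord I) (ltn_ord J) sa).
  exact: (square_sub (ltn_ord I) (ltn_ord J) sw).
rewrite !sumr_const !card_ord -mulrnA -[leLHS]mulr_natr natrM le_eqVlt; apply/orP; left; apply/eqP.
by field.
Qed.

End Squares.

(** * Flux of an indicator function through a square *)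

Section StepFunctions.
Variable R : realType.
Local Notation mu := (@lebesgue_measure R).

Lemma integral_sum_indic (I : finType) (A : I -> set (measurableTypeR R)) :
  (forall i, measurable (A i)) ->
  (\int[mu]_r (\sum_i \1_(A i) r)%:E = \sum_i mu (A i))%E.
Proof.
move=> mA.
under eq_integral do rewrite -sumEFin.
rewrite ge0_integral_sum//; first last.
  by move=> i; exact/measurable_EFinP/measurable_indic.
by apply: eq_bigr => i _; rewrite integral_indic// setIT.
Qed.

Lemma le_sum_measure (I J : finType) (A : I -> set (measurableTypeR R))
    (B : J -> set (measurableTypeR R)) :
  (forall i, measurable (A i)) -> (forall j, measurable (B j)) ->
  (forall r, \sum_i \1_(A i) r <= \sum_j \1_(B j) r :> R) ->
  (\sum_i mu (A i) <= \sum_j mu (B j))%E.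
Proof.
move=> mA mB AB; rewrite -!integral_sum_indic//.
apply: ge0_le_integral => //.
- by move=> r _; rewrite lee_fin sumr_ge0.
- by apply/measurable_EFinP/measurable_sum => i; exact: measurable_indic.
- by apply/measurable_EFinP/measurable_sum => i; exact: measurable_indic.
- by move=> r _; rewrite lee_fin.
Qed.

(* The hypothesis counts the signed crossings of the level r by the selected
   intervals [a i, b i]; integrate it over r. *)
Lemma sum_increments_le (I J : finType) (a b : I -> R) (c e : J -> R) (chi : I -> bool) :
  (forall j, c j <= e j) ->
  (forall r : R, \sum_i (chi i)%:R * ((r < b i)%R%:R - (r < a i)%R%:R) <=
             \sum_j (c j <= r <= e j)%R%:R :> R) ->
  \sum_i (chi i)%:R * (b i - a i) <= \sum_j (e j - c j).
Proof.
move=> ce H.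
(* [lo] lies below all endpoints, so [b i - a i] is a difference of measures of intervals starting
   at [lo]. The terms in [a] move to the right-hand side, which keeps all integrands nonnegative. *)
pose lo := - (\sum_i (`|a i| + `|b i|)).
have loab i : lo <= a i /\ lo <= b i.
  have h : `|a i| + `|b i| <= \sum_i (`|a i| + `|b i|).
    by rewrite (bigD1 i)//= lerDl sumr_ge0// => k _; rewrite addr_ge0.
  have := ler_norm (- a i); have := ler_norm (- b i).
  have := normr_ge0 (a i); have := normr_ge0 (b i).
  by rewrite !normrN /lo; lra.
pose A (i : I) : set (measurableTypeR R) := if chi i then `[lo, b i[%classic else set0.
pose B (k : I + J) : set (measurableTypeR R) := match k with
  | inl i => if chi i then `[lo, a i[%classic else set0
  | inr j => `[c j, e j]%classic end.
have mA i : measurable (A i) by rewrite /A; case: ifP.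
have mB k : measurable (B k) by rewrite /B; case: k => [i|j]; [case: ifP|].
have muco (x : R) : lo <= x -> mu `[lo, x[%classic = (x - lo)%:E.
  by move=> lox; rewrite lebesgue_measure_itv/= lte_fin lt_neqAle lox andbT;
    case: eqP => [->|]; rewrite ?subrr//= EFinB.
have := le_sum_measure mA mB.
rewrite big_sumType/=.
have EA (f : I -> R) : (forall i, lo <= f i) ->
    (\sum_i mu (if chi i then `[lo, f i[%classic else set0) =
     \sum_i ((chi i)%:R * (f i - lo))%:E)%E.
  move=> lof; apply: eq_bigr => i _; case: (chi i); rewrite ?measure0 ?mul0r//.
  by rewrite mul1r muco.
rewrite (EA b (fun i => (loab i).2)) (EA a (fun i => (loab i).1)).
rewrite [X in (_ + X)%E](eq_bigr (fun j => (e j - c j)%:E)); last first.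
  move=> j _; rewrite lebesgue_measure_itv/= lte_fin; have := ce j.
  by rewrite le_eqVlt => /orP[/eqP ->|->]; rewrite ?ltxx ?subrr ?EFinB.
rewrite !sumEFin -EFinD lee_fin => HH.
have {}HH : \sum_i (chi i)%:R * (b i - lo) <=
    \sum_i (chi i)%:R * (a i - lo) + \sum_j (e j - c j).
  apply: HH => r; rewrite big_sumType/=.
  have [rlo|rlo] := leP lo r; last first.
    rewrite big1 ?addr_ge0 ?sumr_ge0// => i _; rewrite /A indicE.
    case: (chi i); rewrite ?in_set0// mem_setE in_itv/= leNgt rlo//.
  have ind (f : I -> R) i : \1_(if chi i then `[lo, f i[%classic else set0) r =
      (chi i)%:R * (r < f i)%R%:R :> R.
    rewrite indicE; case: (chi i); rewrite ?in_set0 ?mul0r//.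
    by rewrite mem_setE in_itv/= rlo/= mul1r.
  rewrite /A (eq_bigr _ (fun i _ => ind b i)) (eq_bigr _ (fun i _ => ind a i)).
  have E1 : \sum_i (chi i)%:R * ((r < b i)%R%:R - (r < a i)%R%:R) =
      \sum_i (chi i)%:R * (r < b i)%R%:R - \sum_i (chi i)%:R * (r < a i)%R%:R :> R.
    by rewrite -sumrB; apply: eq_bigr => i _; rewrite mulrBr.
  have -> : \sum_i \1_(`[c i, e i]%classic) r = \sum_j (c j <= r <= e j)%R%:R :> R.
    by apply: eq_bigr => j _; rewrite indicE mem_setE in_itv.
  by have := H r; rewrite E1; lra.
have -> : \sum_i (chi i)%:R * (b i - a i) =
  \sum_i (chi i)%:R * (b i - lo) - \sum_i (chi i)%:R * (a i - lo).
  by rewrite -sumrB; apply: eq_bigr => i _; ring.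
by lra.
Qed.

End StepFunctions.

Section Boundary.
Variable R : realType.
Local Notation C := R[i].
Implicit Types (W : set C) (p q z : C).

(** A positive element for the partial order of [R[i]] is real; this converts the radii of balls,
    which live in [R[i]]. *)
Lemma gt0_realc (e : C) : 0 < e -> exists2 r : R, 0 < r & e = r%:C.
Proof.
case: e => a b; rewrite ltcE/= => /andP[/eqP -> a0].
by exists a.
Qed.

Local Notation K := (R[i] : numFieldType).

Lemma nbhs_cmod (p : K) (B : set K) :
  nbhs p B <-> exists2 e : R, 0 < e & forall y, cmod (p - y) < e -> B y.
Proof.
split=> [/nbhs_ballP[e /= /gt0_realc[r r0 ->] pB]|[e e0 pB]].
  by exists r => // y py; apply: pB; rewrite -ball_normE/= normE ltcR.
apply/nbhs_ballP; exists e%:C; first by rewrite /= ltcR.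
by move=> y; rewrite -ball_normE/= normE ltcR; exact: pB.
Qed.

Lemma closure_cmod W p :
  closure (W : set K) p <-> forall e : R, 0 < e -> exists2 y, W y & cmod (p - y) < e.
Proof.
split=> [Wp e e0|Wp B /nbhs_cmod[e e0 pB]].
  have [y [Wy yp]] : W `&` [set y | cmod (p - y) < e] !=set0.
    by apply: Wp; apply/nbhs_cmod; exists e.
  by exists y.
by have [y Wy yp] := Wp e e0; exists y; split=> //; exact: pB.
Qed.

(** Take the supremum of the parameters whose points lie in [W]. It gives a limit of points of [W];
    were that point interior, [q] would be in [W] or the supremum could be increased. *)
Lemma boundary_crossing W p q : W p -> ~ W q ->
  exists2 s : R, 0 <= s <= 1 & boundary W (p + s%:C * (q - p)).
Proof.
move=> Wp Wq; pose g (s : R) := p + s%:C * (q - p).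
pose T := [set s : R | 0 <= s <= 1 /\ W (g s)].
have T0 : T 0 by split; rewrite ?lexx ?ler01// /g mul0r addr0.
have supT : has_sup T.
  by split; [exists 0|exists 1 => s [/andP[]]].
have s01 : 0 <= sup T <= 1.
  rewrite ub_le_sup//=; last by case: supT.
  by rewrite ge_sup//; [exists 0|move=> s [/andP[]]].
have dg (s s' : R) : cmod (g s - g s') = `|s - s'| * cmod (q - p).
  have -> : g s - g s' = (s - s')%:C * (q - p) by rewrite /g realcD realcN; ring.
  by rewrite cmodM cmodR.
have pq0 : 0 < cmod (q - p).
  by rewrite cmod_gt0 subr_eq0; apply/eqP => qp; apply: Wq; rewrite qp.
exists (sup T) => //; split.
  apply/closure_cmod => e e0.
  have [s [/andP[s0 s1] Ws] sT] := sup_adherent (divr_gt0 e0 pq0) supT.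
  exists (g s) => //; rewrite dg -ltr_pdivlMr// ger0_norm ?subr_ge0.
    by rewrite ltrBlDr addrC -ltrBlDr.
  by apply: ub_le_sup; [case: supT|split; rewrite ?s0].
move=> /nbhs_cmod[e e0 gW].
have [s1|s1] := ltP (sup T) 1; last first.
  apply: Wq; have -> : q = g 1 by rewrite /g mul1r; ring.
  suff <- : sup T = 1 by apply: gW; rewrite subrr cmod0.
  by apply/eqP; rewrite eq_le s1 andbT; case/andP: s01.
pose s := Num.min 1 (sup T + e / (2 * cmod (q - p))).
have es0 : 0 < e / (2 * cmod (q - p)) by rewrite divr_gt0// mulr_gt0.
have sTs : sup T < s by rewrite lt_min s1 ltrDl.
suff : T s by move=> Ts; have := ub_le_sup supT.2 Ts; rewrite leNgt sTs.
split; first by rewrite ge_min lexx/= andbT (le_trans _ (ltW sTs))//; case/andP: s01.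
apply: gW; rewrite dg ler0_norm ?subr_le0 ?(ltW sTs)// opprB.
have : s - sup T <= e / (2 * cmod (q - p)).
  by rewrite lerBlDl ge_min lexx orbT.
rewrite -(ler_pM2r pq0) => /le_lt_trans; apply.
have -> : e / (2 * cmod (q - p)) * cmod (q - p) = e / 2.
  by field; rewrite gt_eqF.
lra.
Qed.

End Boundary.

Section Projection.
Variable R : realType.
Local Notation C := R[i].
Implicit Types (W : set C) (p q z v : C).

Definition outside W (s : C) : C := (`[< ~ W s >])%:R.

Lemma side_rev (f : C -> C) z v n : side f (z + v) (- v) n = - side f z v n.
Proof.
rewrite /side -sumrN; rewrite (reindex_inj rev_ord_inj)/=.
apply: eq_bigr => k _; rewrite -mulrN -mulNr; congr (f _ * _).
have n0 : n%:R != 0 :> C by rewrite pnatr_eq0; case: n k => [[]|].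
rewrite natrB// -natr1.
by field.
Qed.

(** The default value of [nth] is [z], so [corner z v 4] is the first corner again and the loop
    closes. *)
Definition corner z v (j : nat) : C := nth z [:: z; z + v; z + v + 'i%C * v; z + 'i%C * v] j.

Lemma circE (f : C -> C) z v n : circ f z v n =
  \sum_(j < 4) side f (corner z v j) (corner z v j.+1 - corner z v j) n.
Proof.
rewrite !big_ord_recl big_ord0 addr0 /corner/= /circ.
have -> : z + v - z = v by ring.
have -> : z + v + 'i%C * v - (z + v) = 'i%C * v by ring.
have -> : z + 'i%C * v - (z + v + 'i%C * v) = - v by ring.
have -> : z - (z + 'i%C * v) = - ('i%C * v) by ring.
have -> : z + v + 'i%C * v = z + 'i%C * v + v by ring.
by rewrite !side_rev; ring.
Qed.

Variable u : R * R.
Hypothesis u1 : u.1 ^+ 2 + u.2 ^+ 2 = 1.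

Definition proj z : R := u.1 * complex.Re z + u.2 * complex.Im z.

Lemma projD p q : proj (p + q) = proj p + proj q.
Proof. by case: p q => [a b] [c d]; rewrite /proj/=; ring. Qed.

Lemma projN p : proj (- p) = - proj p.
Proof. by case: p => [a b]; rewrite /proj/=; ring. Qed.

Lemma projZ (x : R) p : proj (x%:C * p) = x * proj p.
Proof. by case: p => [a b]; rewrite /proj/=; ring. Qed.

Lemma proj_sum (I : Type) (r : seq I) (P : pred I) (F : I -> C) :
  proj (\sum_(i <- r | P i) F i) = \sum_(i <- r | P i) proj (F i).
Proof.
by apply: (big_morph _ projD); rewrite /proj/= !mulr0 addr0.
Qed.

Lemma proj_le z : `|proj z| <= cmod z.
Proof.
case: z => a b; rewrite /proj /= -[leLHS]sqrtr_sqr ler_wsqrtr//.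
have -> : a ^+ 2 + b ^+ 2 = (u.1 * a + u.2 * b) ^+ 2 + (u.1 * b - u.2 * a) ^+ 2.
  transitivity ((u.1 ^+ 2 + u.2 ^+ 2) * (a ^+ 2 + b ^+ 2)); last by ring.
  by rewrite u1 mul1r.
by rewrite lerDl sqr_ge0.
Qed.

End Projection.

Section Flux.
Variable R : realType.
Local Notation C := R[i].
Implicit Types (W : set C) (p q z v : C).

Lemma corner_square z v j : square z v (corner z v j).
Proof.
have h (x y : R) : 0 <= x <= 1 -> 0 <= y <= 1 ->
    square z v (z + (x%:C + 'i%C * y%:C) * v).
  by move=> x01 y01; rewrite -[_ + 'i%C * _](complexE (x +i* y)); exact: in_square.
have h0 : 0 <= (0 : R) <= 1 by rewrite lexx ler01.
have h1 : 0 <= (1 : R) <= 1 by rewrite lexx ler01.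
have zz : square z v z.
  by have := h 0 0 h0 h0; rewrite realc0 mulr0 addr0 mul0r addr0.
case: j => [|[|[|[|j]]]]; rewrite /corner/= ?nth_nil//.
- by have := h 1 0 h1 h0; rewrite realc0 realc1 mulr0 addr0 mul1r.
- by have := h 1 1 h1 h1; rewrite realc1 mulr1 mulrDl mul1r addrA.
- by have := h 0 1 h0 h1; rewrite realc0 realc1 mulr1 add0r.
Qed.

Lemma cmod_corner z v j : (j < 4)%N ->
  cmod (corner z v j.+1 - corner z v j) = cmod v.
Proof.
case: j => [|[|[|[|j]]]]//= _; rewrite /corner/=.
- by congr cmod; ring.
- have -> : z + v + 'i%C * v - (z + v) = 'i%C * v by ring.
  by rewrite cmodM cmod_i mul1r.
- by rewrite -cmodN; congr cmod; ring.
- rewrite -cmodN; have -> : - (z - (z + 'i%C * v)) = 'i%C * v by ring.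
  by rewrite cmodM cmod_i mul1r.
Qed.

Lemma sum_telescope (f : nat -> R) n : \sum_(k < n) (f k.+1 - f k) = f n - f 0%N.
Proof. by rewrite -(telescope_sumr f (leq0n n)) big_mkord. Qed.

Lemma sum_masked_increments (chi : nat -> bool) (f : nat -> R) n :
  ((forall k, f k <= f k.+1) ->
   \sum_(k < n) (chi k)%:R * (f k.+1 - f k) <= f n - f 0%N) /\
  ((forall k, f k.+1 <= f k) ->
   \sum_(k < n) (chi k)%:R * (f k.+1 - f k) <= 0).
Proof.
split=> mf.
  rewrite -sum_telescope; apply: ler_sum => k _.
  by case: (chi k); rewrite ?mul1r ?mul0r// subr_ge0.
by apply: sumr_le0 => k _; case: (chi k); rewrite ?mul1r ?mul0r// subr_le0.
Qed.

(* Project on the direction of the circulation and count the crossings of a level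
   line by the edges outside W: they number at most 1, with signs, and on a line
   missing the cover they are all in W or all outside W and cancel. *)
Lemma flux_bound W z (d : R) n (I : finType) (U : I -> set C) (l : I -> R) :
  0 < d -> (0 < n)%N ->
  (forall p, square z d%:C p -> boundary W p -> exists k, U k p) ->
  (forall k p q, U k p -> U k q -> cmod (p - q) <= l k) ->
  cmod (circ (outside W) z d%:C n) <=
  \sum_(k | `[< U k `&` square z d%:C !=set0 >]) (l k + 2 * (d / n%:R)).
Proof.
move=> d0 n0 cover diamU; set V := circ _ _ _ _.
pose P k := `[< U k `&` square z d%:C !=set0 >].
have nR : 0 < n%:R :> R by rewrite ltr0n.
have h0 : 0 < d / n%:R by rewrite divr_gt0.
set h := d / n%:R in h0 *.
have l0 k : P k -> 0 <= l k.
  by move=> /asboolP[p [Up _]]; have := diamU _ _ _ Up Up; rewrite subrr cmod0.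
have [V0|V0] := eqVneq V 0.
  rewrite V0 cmod0 sumr_ge0// => k /l0 lk.
  by rewrite addr_ge0// mulr_ge0// ltW.
(* The direction of [V]: along it, [cmod V] is a real sum of signed increments. *)
pose u := (complex.Re V / cmod V, complex.Im V / cmod V).
have cV : cmod V ^+ 2 = complex.Re V ^+ 2 + complex.Im V ^+ 2.
  by case: (V) => a b /=; rewrite sqr_sqrtr// addr_ge0 ?sqr_ge0.
have cV0 : cmod V != 0 by rewrite cmod_eq0.
have u1 : u.1 ^+ 2 + u.2 ^+ 2 = 1.
  by rewrite /u/= !expr_div_n -mulrDl -cV divff// expf_neq0.
have -> : cmod V = proj u V.
  transitivity ((complex.Re V ^+ 2 + complex.Im V ^+ 2) / cmod V).
    by rewrite -cV expr2 mulfK.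
  by rewrite /proj /u/=; ring.
pose c j := corner z d%:C j.
pose w j := proj u (c j.+1 - c j).
pose al (j k : nat) := proj u (c j) + k%:R / n%:R * w j.
pose mid (j k : nat) := c j + (k%:R + 2^-1) / n%:R * (c j.+1 - c j).
pose chi (j k : nat) := `[< ~ W (mid j k) >].
have alS j k : al j k.+1 - al j k = w j / n%:R.
  by rewrite /al -natr1; field; rewrite gt_eqF.
have projV : proj u V = \sum_(i : 'I_4 * 'I_n) (chi i.1 i.2)%:R * (al i.1 i.2.+1 - al i.1 i.2).
  rewrite -(pair_bigA _ (fun (j : 'I_4) (k : 'I_n) => (chi j k)%:R * (al j k.+1 - al j k)))/=.
  rewrite /V circE proj_sum; apply: eq_bigr => j _.
  rewrite /side proj_sum; apply: eq_bigr => k _.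
  transitivity (proj u (((chi j k)%:R / n%:R)%:C * (c j.+1 - c j))).
    by congr proj; rewrite realcM realcV !realc_nat /outside /chi /mid /c; ring.
  by rewrite projZ alS /w mulrAC mulrA.
pose pU k := proj u @` U k.
have pUb k x y : pU k x -> pU k y -> x <= y + l k.
  move=> [p Up <-] [q Uq <-]; rewrite -lerBlDl -projN -projD.
  by apply: le_trans (ler_norm _) _; apply: le_trans (proj_le u1 _) _; exact: diamU.
(* [W] is sampled at midpoints, which may be off the level line by up to [h]. The margin [h] at both
   ends absorbs this and is the origin of the term [2 * (d / n%:R)]. *)
pose lo k := if P k then inf (pU k) - h else 0.
pose hi k := if P k then sup (pU k) + h else 0.
have pUsup k : P k -> has_sup (pU k) /\ has_inf (pU k).
  move=> /asboolP[p [Up _]]; have pp : pU k (proj u p) by exists p.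
  split; split; [by exists (proj u p)| |by exists (proj u p)|].
    by exists (proj u p + l k) => x Ux; apply: pUb.
  by exists (proj u p - l k) => x Ux; rewrite lerBlDr; apply: pUb.
have infsup k : P k -> inf (pU k) <= sup (pU k) <= inf (pU k) + l k.
  move=> Pk; have [ss si] := pUsup k Pk; apply/andP; split.
    by have [x Ux] := ss.1; rewrite (le_trans (ge_inf si.2 Ux))// ub_le_sup//; case: ss.
  apply: ge_sup; first by case: ss.
  move=> x Ux; rewrite -lerBlDr; apply: lb_le_inf; first by case: si.
  by move=> y Uy; rewrite lerBlDr; apply: pUb.
have lohi k : lo k <= hi k.
  rewrite /lo /hi; case: ifP => // Pk; have /andP[] := infsup _ Pk.
  by move: h0; lra.
rewrite projV.
apply: (@le_trans _ _ (\sum_k (hi k - lo k))); last first.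
  rewrite [leRHS]big_mkcond/=; apply: ler_sum => k _; rewrite /lo /hi -/(P k).
  case: ifP => Pk; last by rewrite subrr.
  by have /andP[] := infsup _ Pk; lra.
apply: sum_increments_le => // r.
pose T (x : R) : R := (r < x)%R%:R.
rewrite -(pair_bigA _ (fun (j : 'I_4) (k : 'I_n) => (chi j k)%:R * (T (al j k.+1) - T (al j k))))/=.
have Tmono x y : x <= y -> T x <= T y.
  rewrite /T => xy; case: (ltP r x) => [rx|_]; last by rewrite ler0n.
  by rewrite (lt_le_trans rx xy).
have T01 x : 0 <= T x <= 1.
  by rewrite /T; case: (r < x)%R; rewrite ?lexx ler01.
have al0 j : al j 0%N = proj u (c j) by rewrite /al mul0r mul0r addr0.
have aln j : al j n = proj u (c j.+1).
  by rewrite /al divff ?gt_eqF// mul1r /w projD projN; ring.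
have [|none] := pselect (exists k, P k /\ lo k <= r <= hi k).
  move=> [k [Pk rk]]; apply: (@le_trans _ _ 1); last first.
    by rewrite (bigD1 k)//= rk lerDl sumr_ge0.
  pose S j := \sum_(k < n) (chi j k)%:R * (T (al j k.+1) - T (al j k)).
  (* On a side of increasing projection the selected increments of [T] are at most the full one; on
     a decreasing side they are at most 0. *)
  have Sle j : (0 <= w j -> S j <= T (proj u (c j.+1)) - T (proj u (c j))) /\
               (w j <= 0 -> S j <= 0).
    have [H1 H2] := sum_masked_increments (chi j) (fun k => T (al j k)) n.
    split=> wj.
      rewrite -(al0 j) -(aln j); apply: H1 => m; apply: Tmono.
      by rewrite -subr_ge0 alS divr_ge0// ltW.
    apply: H2 => m; apply: Tmono.
    by rewrite -subr_le0 alS mulr_le0_ge0// invr_ge0 ltW.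
  have E : \sum_(j < 4) S j = S 0%N + S 1%N + S 2%N + S 3%N.
    by rewrite !big_ord_recr big_ord0/= add0r.
  rewrite [leLHS]E.
  (* Opposite sides have opposite projections, so the increasing sides can be taken to be two
     adjacent ones. Their increments telescope to a difference of two values of [T], hence at most
     1. *)
  have w2 : w 2%N = - w 0%N.
    by rewrite /w -projN; congr proj; rewrite /c /corner/=; ring.
  have w3 : w 3%N = - w 1%N.
    by rewrite /w -projN; congr proj; rewrite /c /corner/=; ring.
  have [] := Sle 0%N; have [] := Sle 1%N; have [] := Sle 2%N; have [] := Sle 3%N.
  rewrite w2 w3 !oppr_ge0 !oppr_le0.
  have -> : proj u (c 4) = proj u (c 0%N) by [].
  have := T01 (proj u (c 0%N)); have := T01 (proj u (c 1%N)).
  have := T01 (proj u (c 2%N)); have := T01 (proj u (c 3%N)).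
  move: (T (proj u (c 0%N))) (T (proj u (c 1%N))) (T (proj u (c 2%N)))
    (T (proj u (c 3%N))) => t0 t1 t2 t3 b3 b2 b1 b0.
  move=> H3p H3n H2p H2n H1p H1n H0p H0n.
  case/orP: (le_total 0 (w 0%N)) => p0; case/orP: (le_total 0 (w 1%N)) => p1.
  - have := H3n p1; have := H2n p0; have := H1p p1; have := H0p p0; lra.
  - have := H3p p1; have := H2n p0; have := H1n p1; have := H0p p0; lra.
  - have := H3n p1; have := H2p p0; have := H1p p1; have := H0n p0; lra.
  - have := H3p p1; have := H2p p0; have := H1n p1; have := H0n p0; lra.
pose D i := T (al i.1 i.2.+1) - T (al i.1 i.2).
(* A segment within [h] of the level line cannot leave [W]: a set covering the crossing point would
   have [r] in its enlarged interval, against [none]. *)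
have sameW p q : square z d%:C p -> square z d%:C q ->
    (forall s : R, 0 <= s <= 1 -> `|proj u (p + s%:C * (q - p)) - r| <= h) ->
    W p -> W q.
  move=> Qp Qq pqr Wp; apply: contrapT => /(boundary_crossing Wp)[s s01 bs].
  have Qs := square_convex Qp Qq s01; have [k Uk] := cover _ Qs bs.
  apply: none; exists k; have Pk : P k by apply/asboolP; exists (p + s%:C * (q - p)).
  split=> //; rewrite /lo /hi Pk; have [ss si] := pUsup k Pk.
  have pUs : pU k (proj u (p + s%:C * (q - p))) by exists (p + s%:C * (q - p)).
  have := ge_inf si.2 pUs; have := ub_le_sup ss.2 pUs.
  by have := pqr s s01; rewrite ler_norml; lra.
(* An edge that contributes crosses the level line at a point [y] within one step of its
   midpoint. *)
have hit (j k : nat) : (j < 4)%N -> (k < n)%N -> D (j, k) != 0 ->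
    exists y, [/\ square z d%:C y, proj u y = r, square z d%:C (mid j k) &
                 cmod (mid j k - y) <= h].
  move=> j4 kn; rewrite /D/= => D0.
  have wj0 : w j != 0.
    apply: contra D0 => /eqP wj; have := alS j k.
    by rewrite wj mul0r => /eqP; rewrite subr_eq0 => /eqP ->; rewrite subrr.
  pose tau := (r - proj u (c j)) / w j.
  have tauk : k%:R / n%:R <= tau <= (k%:R + 1) / n%:R.
    have Er : r = proj u (c j) + tau * w j by rewrite /tau divfK// addrC subrK.
    have alE m : (r < al j m) = (tau * w j < m%:R / n%:R * w j).
      by rewrite [in LHS]Er /al ltrD2l.
    have kk : k%:R / n%:R < (k%:R + 1) / n%:R :> R.
      by rewrite ltr_pM2r ?invr_gt0// ltrDl.
    have {}D0 : (r < al j k.+1)%R != (r < al j k)%R.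
      by apply: contra D0 => /eqP Dr; rewrite /T Dr subrr.
    move: D0; rewrite !alE -natr1.
    have [w0|w0|w0] := ltrgtP (w j) 0; last by rewrite w0 eqxx in wj0.
      rewrite !ltr_nM2r// => D0; apply/andP; split; rewrite leNgt; apply/negP => H.
        by move: D0; rewrite !ltNge (ltW H) (ltW (lt_trans H kk)).
      by move: D0; rewrite H (lt_trans kk H).
    rewrite !ltr_pM2r// => D0; apply/andP; split; rewrite leNgt; apply/negP => H.
      by move: D0; rewrite H (lt_trans H kk).
    by move: D0; rewrite !ltNge (ltW H) (ltW (lt_trans kk H)).
  have k0 : 0 <= k%:R / n%:R :> R by rewrite divr_ge0.
  have k1 : (k%:R + 1) / n%:R <= 1 :> R.
    by rewrite ler_pdivrMr// mul1r natr1 ler_nat.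
  have onside (s : R) : 0 <= s <= 1 ->
      square z d%:C (c j + s%:C * (c j.+1 - c j)).
    by apply: square_convex; exact: corner_square.
  have midE : mid j k = c j + ((k%:R + 2^-1) / n%:R)%:C * (c j.+1 - c j).
    by rewrite /mid !realcE.
  have hlf : ((k%:R : R) / n%:R <= (k%:R + 2^-1) / n%:R :> R) /\
      ((k%:R + 2^-1) / n%:R <= (k%:R + 1) / n%:R :> R).
    by rewrite !ler_pM2r ?invr_gt0//; lra.
  exists (c j + tau%:C * (c j.+1 - c j)); split.
  - by apply: onside; lra.
  - by rewrite projD projZ -/(w j) /tau divfK// addrC subrK.
  - by rewrite midE; apply: onside; lra.
  rewrite midE.
  have -> : c j + ((k%:R + 2^-1) / n%:R)%:C * (c j.+1 - c j)
      - (c j + tau%:C * (c j.+1 - c j)) =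
      ((k%:R + 2^-1) / n%:R - tau)%:C * (c j.+1 - c j).
    by rewrite realcD realcN; ring.
  rewrite cmodM cmodR cmod_corner// cmodR (gtr0_norm d0) /h mulrC ler_wpM2l ?(ltW d0)//.
  have : (k%:R + 1) / n%:R = k%:R / n%:R + n%:R^-1 :> R by rewrite mulrDl mul1r.
  by rewrite ler_norml; lra.
have chi_eq (i i' : nat * nat) : (i.1 < 4)%N -> (i.2 < n)%N -> (i'.1 < 4)%N ->
    (i'.2 < n)%N -> D i != 0 -> D i' != 0 -> W (mid i.1 i.2) -> W (mid i'.1 i'.2).
  case: i i' => [j k] [j' k']/= j4 kn j4' kn' /(hit _ _ j4 kn)[y [Qy yr Qm my]].
  move=> /(hit _ _ j4' kn')[y' [Qy' yr' Qm' my']] Wm.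
  have prj p q (s : R) : proj u (p + s%:C * (q - p)) =
      (1 - s) * proj u p + s * proj u q by rewrite projD projZ projD projN; ring.
  have near_ p y0 : proj u y0 = r -> cmod (p - y0) <= h -> `|proj u p - r| <= h.
    by move=> <- py; rewrite -projN -projD (le_trans (proj_le u1 _)).
  (* The two midpoints are joined through the crossing points [y] and [y'] by three segments that
     stay within [h] of the level line. *)
  apply: (sameW y') => //.
    move=> s /andP[s0 s1]; have := near_ _ _ yr' my'.
    rewrite prj yr' !ler_norml; nra.
  apply: (sameW y) => //.
    move=> s _; rewrite prj yr yr' (_ : _ - r = 0) ?normr0 ?ltW//; ring.
  apply: (sameW (mid j k)) => //.
  move=> s /andP[s0 s1]; have := near_ _ _ yr my.
  rewrite prj yr !ler_norml; nra.
(* A closed loop crosses a line with total sign 0. Since [chi] is constant on the crossing edges,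
   the selected sum vanishes as well. *)
have sumD : \sum_(j < 4) \sum_(k < n) D (val j, val k) = 0.
  under eq_bigr do rewrite (sum_telescope (fun k => T (al _ k))) al0 aln.
  by rewrite (sum_telescope (fun j => T (proj u (c j)))) /c /corner/= subrr.
apply: (@le_trans _ _ 0); last by rewrite sumr_ge0.
case: (pselect (exists i : 'I_4 * 'I_n, D (val i.1, val i.2) != 0)) => [[i0 Di0]|noD].
  rewrite le_eqVlt; apply/orP; left; apply/eqP.
  transitivity ((chi i0.1 i0.2)%:R * \sum_(j < 4) \sum_(k < n) D (val j, val k)); last first.
    by rewrite sumD mulr0.
  rewrite mulr_sumr; apply: eq_bigr => j _; rewrite mulr_sumr; apply: eq_bigr => k _.
  have [D0|D0] := eqVneq (D (val j, val k)) 0.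
    by rewrite D0 mulr0; move: D0; rewrite /D/= => ->; rewrite mulr0.
  rewrite /D/=; congr (_%:R * _); congr nat_of_bool.
  apply/asboolP/asboolP; apply: contra_not.
    exact: (@chi_eq (val i0.1, val i0.2) (val j, val k) (ltn_ord _) (ltn_ord _)
      (ltn_ord _) (ltn_ord _) Di0 D0).
  exact: (@chi_eq (val j, val k) (val i0.1, val i0.2) (ltn_ord _) (ltn_ord _)
    (ltn_ord _) (ltn_ord _) D0 Di0).
rewrite big1// => j _; rewrite big1// => k _.
have [D0|D0] := eqVneq (D (val j, val k)) 0.
  by move: D0; rewrite /D/= => ->; rewrite mulr0.
by exfalso; apply: noD; exists (j, k).
Qed.

End Flux.

(** * Covers of the boundary and grids *)

Section FiniteCover.
Variable R : realType.
Local Notation K := (R[i] : numFieldType).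

Lemma continuous_Complex : continuous ((fun xy : R * R => xy.1 +i* xy.2) : R * R -> K).
Proof.
move=> [x y] B /nbhs_cmod[e e0 eB].
have e20 : 0 < e / 2 by rewrite divr_gt0.
exists ([set x' | `|x - x'| < e / 2], [set y' | `|y - y'| < e / 2]).
  by split; apply/nbhs_ballP; exists (e / 2).
move=> [x' y'] [/= xx yy]; apply: eB; apply: le_lt_trans (cmod_ReIm _) _ => /=.
by lra.
Qed.

Lemma bounded_closed_compactC (E : set K) (r : R) : closed E ->
  (forall z, E z -> cmod z <= r) -> compact E.
Proof.
move=> cE Er.
pose g := (fun xy : R * R => xy.1 +i* xy.2) : R * R -> K.
have cg : compact (g @` (`[- r, r] `*` `[- r, r])).
  apply: continuous_compact; last by apply: compact_setX; exact: segment_compact.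
  by apply: continuous_subspaceT => z; exact: continuous_Complex.
apply: (subclosed_compact cE cg) => z /Er zr.
exists (complex.Re z, complex.Im z); last by rewrite /g/=; case: (z).
split; rewrite /= in_itv/= -ler_norml.
  exact: le_trans (cmod_Re _) zr.
exact: le_trans (cmod_Im _) zr.
Qed.

Lemma closed_boundary (W : set K) : closed (boundary W).
Proof. by apply: closedI; [exact: closed_closure|exact/open_closedC/open_interior]. Qed.

Lemma diam_ge (S : set R[i]) p q : S p -> S q -> ((cmod (p - q))%:E <= diam S)%E.
Proof.
move=> Sp Sq; rewrite /diam le_max; apply/orP; right.
by apply: ereal_sup_ubound; exists (p, q).
Qed.

Lemma diam_ge0 (S : set R[i]) : (0 <= diam S)%E.
Proof. by rewrite /diam le_max lexx. Qed.

Lemma sum_geometric_half m : \sum_(k < m) (2^-1 : R) ^+ k.+1 <= 1.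
Proof.
suff -> : \sum_(k < m) (2^-1 : R) ^+ k.+1 = 1 - 2^-1 ^+ m.
  by rewrite gerBl exprn_ge0// invr_ge0.
elim: m => [|m IH]; first by rewrite big_ord0 expr0 subrr.
by rewrite big_ord_recr/= IH exprS; field.
Qed.

(** The covers in [arc_length_at] are countable and by arbitrary sets. Enlarging each set to an open
    one by a summable amount lets compactness apply, and makes every [l k] positive. *)
Lemma finite_cover (E : set K) (L : R) : compact E ->
  (arc_length E <= L%:E)%E ->
  forall eta e : R, 0 < eta -> 0 < e ->
  exists (m : nat) (U : 'I_m -> set R[i]) (l : 'I_m -> R),
    [/\ forall k, 0 < l k <= eta,
        forall k p q, U k p -> U k q -> cmod (p - q) <= l k,
        \sum_k l k <= L + e & forall p, E p -> exists k, U k p].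
Proof.
move=> cE EL eta e eta0 e0.
have eta2 : 0 < eta / 2 by rewrite divr_gt0.
have : (arc_length_at E (eta / 2) < (L + e / 2)%:E)%E.
  apply: (@le_lt_trans _ _ L%:E); last by rewrite lte_fin ltrDl divr_gt0.
  apply: le_trans EL; apply: ereal_sup_ubound; exists (eta / 2) => //.
move=> /ereal_inf_lt[_ [U [Ueta EU] <-] sumU].
pose d k := fine (diam (U k)).
have dE k : diam (U k) = (d k)%:E.
  rewrite /d fineK// ge0_fin_numE ?diam_ge0//.
  by apply: le_lt_trans (Ueta k) _; rewrite ltry.
have d0 k : 0 <= d k by rewrite -lee_fin -dE diam_ge0.
have deta k : d k <= eta / 2 by rewrite -lee_fin -dE.
(* [eta / 4] keeps the enlarged diameters at most [eta]; the geometric factors limit the total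
   increase to [e / 2]. *)
pose rho k := Num.min (eta / 4) (e / 4 * 2^-1 ^+ k.+1).
have rho0 k : 0 < rho k.
  by rewrite lt_min !divr_gt0//= mulr_gt0 ?exprn_gt0// ?divr_gt0// invr_gt0.
pose V k : set K := [set z | exists2 y, U k y & cmod (z - y) < rho k].
have oV k : open (V k).
  rewrite openE => z [y Uy zy]; apply/nbhs_cmod; exists (rho k - cmod (z - y)).
    by rewrite subr_gt0.
  move=> w zw; exists y => //; have -> : w - y = (z - y) - (z - w) by ring.
  by apply: le_lt_trans (cmodB _ _) _; lra.
have : cover_compact E by rewrite -compact_cover.
move=> /(_ nat setT V (fun k _ => oV k)).
case=> [z /EU[k _ Uz]|F _ EF].
  by exists k => //; exists z => //; rewrite subrr cmod0.
have [m mF] : exists m, forall k, k \in F -> (k < m)%N.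
  exists (\max_(k <- enum_fset F) k).+1 => k kF.
  by rewrite ltnS; apply: leq_bigmax_seq.
exists m, (fun k => V k), (fun k => d k + 2 * rho k); split.
- move=> k; have := rho0 k; have := d0 k; have := deta k.
  have : rho k <= eta / 4 by rewrite ge_min lexx.
  by lra.
- move=> k p q [y Uy py] [y' Uy' qy'].
  have := diam_ge Uy Uy'; rewrite dE lee_fin => yy'.
  have -> : p - q = (p - y) + (y - y') - (q - y') by ring.
  apply: le_trans (cmodB _ _) _; apply: le_trans (lerD (cmodD _ _) (lexx _)) _.
  by lra.
- rewrite big_split/= -mulr_sumr.
  have s1 : \sum_(i < m) d i <= L + e / 2.
    rewrite -lee_fin; apply: le_trans (ltW sumU).
    have := @nneseries_lim_ge R (fun k => diam (U k)) xpredT 0 m (fun k _ _ => diam_ge0 _).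
    by rewrite big_mkord -sumEFin; under eq_bigr do rewrite dE.
  have s2 : \sum_(i < m) rho i <= e / 4.
    apply: (@le_trans _ _ (\sum_(i < m) e / 4 * 2^-1 ^+ i.+1)).
      by apply: ler_sum => i _; rewrite ge_min lexx orbT.
    rewrite -mulr_sumr -[leRHS]mulr1 ler_wpM2l ?divr_ge0 ?(ltW e0)//.
    exact: sum_geometric_half.
  by lra.
- by move=> p /EF[k kF Vp]; exists (Ordinal (mF _ kF)).
Qed.

End FiniteCover.

Section CircSquare.
Variable R : realType.
Local Notation C := R[i].
Implicit Types (f g : C -> C) (z v : C).

Lemma midpoint01 n k : (k < n)%N -> 0 <= ((k%:R + 2^-1) / n%:R : R) <= 1.
Proof.
move=> kn; have n0 : 0 < n%:R :> R by rewrite ltr0n (leq_trans _ kn).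
rewrite divr_ge0 ?addr_ge0 ?invr_ge0//= ler_pdivrMr// mul1r.
have : (k%:R + 1 : R) <= n%:R by rewrite natr1 ler_nat.
by lra.
Qed.

Lemma midpointE n k : ((k%:R + 2^-1) / n%:R : C) = ((k%:R + 2^-1) / n%:R)%:C.
Proof. by rewrite !realcE. Qed.

(** Only boundary points of the square are compared. This matters on the outer square, whose inside
    may contain [W] and the poles. *)
Lemma eq_circ f g z v n :
  (forall x y : R, 0 <= x <= 1 -> 0 <= y <= 1 ->
     [|| x == 0, x == 1, y == 0 | y == 1] ->
     f (z + (x +i* y) * v) = g (z + (x +i* y) * v)) ->
  circ f z v n = circ g z v n.
Proof.
move=> fg; have h0 : 0 <= (0 : R) <= 1 by rewrite lexx ler01.
have h1 : 0 <= (1 : R) <= 1 by rewrite lexx ler01.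
have E (x y : R) (w : C) : (x%:C + 'i%C * y%:C) * w = (x +i* y) * w.
  by rewrite [x +i* y]complexE.
rewrite /circ; congr (_ + _ - _ - _); apply: eq_side => k kn;
  rewrite midpointE; have m01 := midpoint01 kn; set s := _ / _ in m01 *.
- have -> : z + s%:C * v = z + (s +i* 0) * v by [].
  by apply: fg => //; rewrite eqxx !orbT.
- have -> : z + v + s%:C * ('i%C * v) = z + (1 +i* s) * v.
    by rewrite -(E 1 s) realc1; ring.
  by apply: fg => //; rewrite eqxx !orbT.
- have -> : z + 'i%C * v + s%:C * v = z + (s +i* 1) * v.
    by rewrite -(E s 1) realc1; ring.
  by apply: fg => //; rewrite eqxx !orbT.
- have -> : z + s%:C * ('i%C * v) = z + (0 +i* s) * v.
    by rewrite -(E 0 s) realc0; ring.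
  by apply: fg => //; rewrite eqxx.
Qed.

Lemma eq_circ_square f g z v n : (forall p, square z v p -> f p = g p) ->
  circ f z v n = circ g z v n.
Proof. by move=> fg; apply: eq_circ => x y x01 y01 _; apply/fg/in_square. Qed.

Lemma circ_bound f z v n (M : R) : 0 <= M ->
  (forall x y : R, 0 <= x <= 1 -> 0 <= y <= 1 ->
     [|| x == 0, x == 1, y == 0 | y == 1] -> cmod (f (z + (x +i* y) * v)) <= M) ->
  cmod (circ f z v n) <= 4 * M * cmod v.
Proof.
move=> M0 fM.
(* The truncation is bounded everywhere, so [side_bound] applies without locating the nodes of each
   side again. *)
pose g p := if cmod (f p) <= M then f p else 0.
have gM p : cmod (g p) <= M by rewrite /g; case: ifP => // _; rewrite cmod0.
have -> : circ f z v n = circ g z v n.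
  by apply: eq_circ => x y x01 y01 xy; rewrite /g fM.
have iv : cmod ('i%C * v) = cmod v by rewrite cmodM cmod_i mul1r.
have S w (v' : C) : cmod (side g w v' n) <= M * cmod v' by apply: side_bound.
rewrite /circ; apply: le_trans (cmodB _ _) _.
apply: le_trans (lerD (cmodB _ _) (lexx _)) _.
apply: le_trans (lerD (lerD (cmodD _ _) (lexx _)) (lexx _)) _.
have := S z v; have := S (z + v) ('i%C * v); have := S (z + 'i%C * v) v.
have := S z ('i%C * v); rewrite iv; lra.
Qed.

Lemma circZ f (a : C) z v n : circ (fun s => a * f s) z v n = a * circ f z v n.
Proof.
have := circ_linear a 0 f f z v n; rewrite mul0r addr0 => <-.
by apply: eq_circ_square => p _; rewrite mul0r addr0.
Qed.

Lemma circD f g z v n :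
  circ (fun s => f s + g s) z v n = circ f z v n + circ g z v n.
Proof.
have := circ_linear 1 1 f g z v n; rewrite !mul1r => <-.
by apply: eq_circ_square => p _; rewrite !mul1r.
Qed.

End CircSquare.

(** * Counting the cells of shifted grids met by small sets *)

Section GridCounting.
Variable R : realType.
Local Notation C := R[i].

Lemma card_spread K (A : {set 'I_K}) (x : R) : 0 <= x ->
  (forall i j, i \in A -> j \in A -> (j%:R - i%:R : R) <= x) -> #|A|%:R <= x + 1.
Proof.
move=> x0 Ax; have [->|[i1 Ai1]] := set_0Vmem A.
  by rewrite cards0 addr_ge0.
pose i0 := [arg min_(i < i1 in A) i]%N.
have [Ai0 i0min] : i0 \in A /\ forall i, i \in A -> (i0 <= i)%N.
  by rewrite /i0; case: arg_minnP.
pose N := Num.truncn x.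
have sub : {subset [seq val i | i <- enum A] <= iota i0 N.+1}.
  move=> _ /mapP[i Ai ->]; rewrite mem_enum in Ai; rewrite mem_iota i0min//=.
  rewrite addnS ltnS -leq_subLR; have := Ax _ _ Ai0 Ai.
  by rewrite -natrB ?i0min// -truncn_ge_nat.
have := uniq_leq_size _ sub; rewrite map_inj_uniq ?enum_uniq; last exact: val_inj.
rewrite size_map size_iota -cardE => /(_ isT); rewrite -(ler_nat R) => /le_trans; apply.
by rewrite -natr1 lerD2r truncn_le.
Qed.

Lemma sum_asbool (I : finType) (Q : I -> Prop) :
  \sum_i (`[< Q i >]%:R : R) = #|[set i | `[< Q i >]]%SET|%:R.
Proof.
rewrite -natr_sum -sum1_card; congr _%:R; rewrite [RHS]big_mkcond/=.
by apply: eq_bigr => i _; rewrite inE; case: `[< Q i >].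
Qed.

Definition meets_cell (T : set R) (o d : R) (i : nat) :=
  exists2 x, T x & o + i%:R * d <= x <= o + i.+1%:R * d.

(** Covering sets may be disconnected, so what counts is having points on both sides of a grid
    line. *)
Definition meets_line (T : set R) (o d : R) := exists (i : nat) (x y : R),
  [/\ T x, T y & x <= o + i%:R * d <= y].

Lemma card_meets_cell (T : set R) (o d l : R) K : 0 < d -> 0 <= l ->
  (forall x y, T x -> T y -> y <= x + l) ->
  #|[set i : 'I_K | `[< meets_cell T o d i >]]%SET|%:R <= l / d + 2.
Proof.
move=> d0 l0 Tl; apply: (@le_trans _ _ (l / d + 1 + 1)); last by lra.
apply: card_spread; first by rewrite addr_ge0// divr_ge0// ltW.
move=> i j; rewrite !inE => /asboolP[x Tx /andP[x1 x2]] /asboolP[y Ty /andP[y1 y2]].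
rewrite -(ler_pM2r d0) mulrBl mulrDl divfK ?gt_eqF//.
by have := Tl x y Tx Ty; rewrite -natr1 in x2; lra.
Qed.

Lemma card_meets_cell_le1 (T : set R) (o d : R) K : 0 < d ->
  ~ meets_line T o d -> #|[set i : 'I_K | `[< meets_cell T o d i >]]%SET|%:R <= (1 : R).
Proof.
move=> d0 noline; rewrite -[leRHS]add0r; apply: card_spread => // i j.
rewrite !inE => /asboolP[x Tx /andP[x1 x2]] /asboolP[y Ty /andP[y1 y2]].
rewrite subr_le0 ler_nat leqNgt; apply/negP => ij; apply: noline.
exists j, x, y; split=> //; rewrite y1 andbT (le_trans x2)// lerD2l ler_pM2r//.
by rewrite ler_nat.
Qed.

(** The lines of the [m] shifted grids are distinct points of one lattice of step [d / m%:R]; a set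
    of smaller spread straddles at most one of them. *)
Lemma card_meets_line_le1 (T : set R) (o d l : R) m : 0 < d ->
  (forall x y, T x -> T y -> y <= x + l) -> l < d / m%:R ->
  #|[set s : 'I_m | `[< meets_line T (o + s%:R * (d / m%:R)) d >]]%SET|%:R <= (1 : R).
Proof.
move=> d0 Tl lm; rewrite -[leRHS]add0r; apply: card_spread => // s s'; rewrite !inE.
have m0 : (0 < m)%N by case: m lm s s' => // _ [].
have mR : 0 < m%:R :> R by rewrite ltr0n.
move=> /asboolP[i [x [y [Tx Ty /andP[xi iy]]]]] /asboolP[j [x' [y' [Tx' Ty' /andP[xj jy]]]]].
rewrite subr_le0 ler_nat leqNgt; apply/negP => ss.
have dm0 : 0 < d / m%:R by rewrite divr_gt0.
have E (k t : nat) : o + t%:R * (d / m%:R) + k%:R * d = o + (k * m + t)%:R * (d / m%:R).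
  by rewrite natrD natrM; field; rewrite gt_eqF.
rewrite !E in xi iy xj jy.
have Txy := Tl _ _ Tx Ty'; have Tyx := Tl _ _ Tx' Ty.
have [lt|lt|eq] := ltngtP (i * m + s) (j * m + s').
- have : ((i * m + s)%:R + 1) * (d / m%:R) <= (j * m + s')%:R * (d / m%:R).
    by rewrite ler_pM2r// natr1 ler_nat.
  by rewrite mulrDl mul1r; lra.
- have : ((j * m + s')%:R + 1) * (d / m%:R) <= (i * m + s)%:R * (d / m%:R).
    by rewrite ler_pM2r// natr1 ler_nat.
  by rewrite mulrDl mul1r; lra.
have := congr1 (modn^~ m) eq; rewrite !modnMDl !modn_small// => ss'.
by rewrite ss' ltnn in ss.
Qed.

Definition grid_corner (o d : R) (i j : nat) : C :=
  (o +i* o) + i%:R * d%:C + 'i%C * (j%:R * d%:C).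

Lemma in_grid_square (o d : R) i j p : 0 < d -> square (grid_corner o d i j) d%:C p ->
  (o + i%:R * d <= complex.Re p <= o + i%:R * d + d) /\
  (o + j%:R * d <= complex.Im p <= o + j%:R * d + d).
Proof.
move=> d0 [[x y]] /= /andP[/andP[x0 x1] /andP[y0 y1]] <-.
have -> : complex.Re (grid_corner o d i j + (x +i* y) * d%:C) = o + i%:R * d + x * d.
  by rewrite /grid_corner !natrC /=; ring.
have -> : complex.Im (grid_corner o d i j + (x +i* y) * d%:C) = o + j%:R * d + y * d.
  by rewrite /grid_corner !natrC /=; ring.
have := mulr_ge0 x0 (ltW d0); have := mulr_ge0 y0 (ltW d0).
have : x * d <= 1 * d by rewrite ler_pM2r.
have : y * d <= 1 * d by rewrite ler_pM2r.
by lra.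
Qed.

Definition touches (U : set C) z (d : R) := `[< U `&` square z d%:C !=set0 >].

Lemma sum_touches_le (U : set C) (o d : R) K : 0 < d ->
  \sum_(i < K) \sum_(j < K) (touches U (grid_corner o d i j) d)%:R <=
  #|[set i : 'I_K | `[< meets_cell (@complex.Re R @` U) o d i >]]%SET|%:R *
  #|[set i : 'I_K | `[< meets_cell (@complex.Im R @` U) o d i >]]%SET|%:R :> R.
Proof.
move=> d0; rewrite -!sum_asbool mulr_suml; apply: ler_sum => i _.
rewrite mulr_sumr; apply: ler_sum => j _; rewrite -natrM ler_nat mulnb.
case touch: (touches _ _ _) => //; rewrite lt0b.
move: touch => /asboolP[p [Up /(in_grid_square d0)[pi pj]]]; apply/andP; split; apply/asboolP.
  by exists (complex.Re p); [exists p|rewrite -natr1; lra].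
by exists (complex.Im p); [exists p|rewrite -natr1; lra].
Qed.

Lemma proj_spread (U : set C) (l : R) (pi : C -> R) :
  (forall p q, pi q <= pi p + cmod (p - q)) ->
  (forall p q, U p -> U q -> cmod (p - q) <= l) ->
  forall x y, (pi @` U) x -> (pi @` U) y -> y <= x + l.
Proof.
move=> hpi Ul _ _ [p Up <-] [q Uq <-].
by apply: le_trans (hpi p q) _; rewrite lerD2l Ul.
Qed.

Lemma Re_spread (p q : C) : complex.Re q <= complex.Re p + cmod (p - q).
Proof.
have E : complex.Re (p - q) = complex.Re p - complex.Re q.
  by case: p q => [a b] [a' b'].
by have := cmod_Re (p - q); rewrite E ler_norml; lra.
Qed.

Lemma Im_spread (p q : C) : complex.Im q <= complex.Im p + cmod (p - q).
Proof.
have E : complex.Im (p - q) = complex.Im p - complex.Im q.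
  by case: p q => [a b] [a' b'].
by have := cmod_Im (p - q); rewrite E ler_norml; lra.
Qed.

Lemma sum_touches_bound (U : set C) (o d l : R) K : 0 < d -> 0 <= l ->
  (forall p q, U p -> U q -> cmod (p - q) <= l) ->
  \sum_(i < K) \sum_(j < K) (touches U (grid_corner o d i j) d)%:R <=
  (l / d + 2) ^+ 2 :> R.
Proof.
move=> d0 l0 Ul; apply: le_trans (sum_touches_le _ _ _ d0) _.
rewrite expr2 ler_pM//; apply: card_meets_cell => //.
  exact: proj_spread Re_spread Ul.
exact: proj_spread Im_spread Ul.
Qed.

(* A set of diameter less than d / m straddles a grid line for at most one of the
   m offsets in each coordinate; average over the offsets. *)
Lemma good_offset (o d : R) (K m : nat) (I : finType) (U : I -> set C) (l : I -> R) :
  0 < d -> (0 < m)%N -> (forall k, 0 < l k) -> (forall k, l k < d / m%:R) ->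
  (forall k p q, U k p -> U k q -> cmod (p - q) <= l k) ->
  exists2 s : nat, (s < m)%N &
  \sum_(i < K) \sum_(j < K) \sum_k
    (touches (U k) (grid_corner (o + s%:R * (d / m%:R)) d i j) d)%:R * l k <=
  (1 + 8 / m%:R) * \sum_k l k.
Proof.
move=> d0 m0 l0 lm Ul.
have mR : 0 < m%:R :> R by rewrite ltr0n.
have ld k : l k <= d.
  rewrite (le_trans (ltW (lm k)))// ler_pdivrMr// ler_peMr ?(ltW d0)//.
  by rewrite -[1%R]/(1%:R) ler_nat.
pose os (s : nat) := o + s%:R * (d / m%:R).
pose hx k (s : nat) : R := `[< meets_line (@complex.Re R @` U k) (os s) d >]%:R.
pose hy k (s : nat) : R := `[< meets_line (@complex.Im R @` U k) (os s) d >]%:R.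
have Ux k := proj_spread Re_spread (Ul k).
have Uy k := proj_spread Im_spread (Ul k).
have touch_le s k : \sum_(i < K) \sum_(j < K)
    (touches (U k) (grid_corner (os s) d i j) d)%:R <= 1 + 4 * hx k s + 4 * hy k s.
  apply: le_trans (sum_touches_le _ _ _ d0) _.
  (* A set no wider than a cell meets at most 3 columns, and at most 1 unless it straddles a grid
     line. *)
  have b3 (T : set R) : (forall x y, T x -> T y -> y <= x + l k) ->
      #|[set i : 'I_K | `[< meets_cell T (os s) d i >]]%SET|%:R <=
      1 + 2 * `[< meets_line T (os s) d >]%:R :> R.
    move=> Tl; case: asboolP => [_|noline].
      rewrite mulr1; apply: le_trans (card_meets_cell _ _ d0 (ltW (l0 k)) Tl) _.
      have : l k / d <= 1 by rewrite ler_pdivrMr// mul1r.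
      by lra.
    by rewrite mulr0 addr0; apply: card_meets_cell_le1.
  apply: (@le_trans _ _ ((1 + 2 * hx k s) * (1 + 2 * hy k s))).
    by rewrite ler_pM ?ler0n//; [exact: b3 (Ux k)|exact: b3 (Uy k)].
  by rewrite /hx /hy; do 2 case: asboolP => _; rewrite /=; lra.
apply: contrapT => nos.
(* If every offset were bad, the sum over all offsets would exceed 8 times the sum of the [l k],
   whereas each set is charged at most 4 times [l k] per coordinate. *)
have big s : (s < m)%N -> 8 / m%:R * \sum_k l k < \sum_k (4 * hx k s + 4 * hy k s) * l k.
  move=> sm; rewrite ltNge; apply/negP => le; apply: nos; exists s => //.
  apply: (@le_trans _ _ (\sum_k (1 + 4 * hx k s + 4 * hy k s) * l k)).
    under eq_bigr do rewrite exchange_big/=.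
    rewrite exchange_big/=; apply: ler_sum => k _.
    under eq_bigr do rewrite -mulr_suml.
    by rewrite -mulr_suml ler_pM2r ?touch_le.
  rewrite mulrDl mul1r; under eq_bigr do rewrite -addrA mulrDl mul1r.
  by rewrite big_split/= lerD2l.
have : \sum_(s < m) (8 / m%:R * \sum_k l k) <
       \sum_(s < m) \sum_k (4 * hx k s + 4 * hy k s) * l k.
  rewrite (bigD1 (Ordinal m0))//= [ltRHS](bigD1 (Ordinal m0))//=.
  rewrite ltr_leD ?big//; apply: ler_sum => s _; exact/ltW/big.
apply/negP; rewrite -leNgt sumr_const card_ord -[leRHS]mulr_natr.
have -> : 8 / m%:R * (\sum_k l k) * m%:R = \sum_k 8 * l k.
  by rewrite -mulr_sumr; field; rewrite gt_eqF.
rewrite exchange_big/=; apply: ler_sum => k _; rewrite -mulr_suml ler_pM2r//.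
rewrite big_split/= -!mulr_sumr.
have := card_meets_line_le1 o d0 (Ux k) (lm k).
have := card_meets_line_le1 o d0 (Uy k) (lm k).
by rewrite -!sum_asbool /hx /hy /os; lra.
Qed.

End GridCounting.

(** * Summing the flux estimates over the cells *)

Section ContourBound.
Variable R : realType.
Local Notation C := R[i].
Variables (Q : nat) (nrm : 'cV[C]_Q -> R).
Hypothesis nrmD : forall x y, nrm (x + y) <= nrm x + nrm y.
Hypothesis nrmZ : forall a x, nrm (a *: x) <= cmod a * nrm x.
Hypothesis nrm_ge0 : forall x, 0 <= nrm x.
Hypothesis nrm_sum : forall x, nrm x <= \sum_i cmod (x i 0).

Implicit Types (F : 'I_Q -> C -> C) (W D : set C).

Definition vcirc F z v n : 'cV[C]_Q := \col_i circ (F i) z v n.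

Lemma nrm_bigsum (I : finType) (f : I -> 'cV[C]_Q) :
  nrm (\sum_i f i) <= \sum_i nrm (f i).
Proof.
elim/big_ind2: _ => [|x a y b xa yb|//].
  by apply: le_trans (nrm_sum _) _; rewrite big1// => i _; rewrite mxE cmod0.
by apply: le_trans (nrmD _ _) _; rewrite lerD.
Qed.

Lemma sum_le_const (f : 'I_Q -> R) (g : 'I_Q -> C) (x : R) : 0 <= x ->
  (forall i, cmod (g i) <= f i * x) -> nrm (\col_i g i) <= (\sum_i f i) * x.
Proof.
move=> x0 gf; apply: le_trans (nrm_sum _) _; rewrite mulr_suml.
by apply: ler_sum => i _; rewrite mxE.
Qed.

(* The three terms come from the circulation of the indicator of the complement
   of W, from the variation of F in a cell meeting the boundary of W, and from
   the circulation of F in a cell disjoint from W. *)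
Lemma square_estimate W D F M : 0 <= M -> (forall i, has_taylor2 D (F i)) ->
  exists2 T : R, 0 <= T &
  forall z (d : R) n (I : finType) (U : I -> set C) (l : I -> R),
    0 < d -> (0 < n)%N ->
    (forall p, square z d%:C p -> ~ W p -> square z d%:C `<=` D) ->
    (forall p w, square z d%:C p -> ~ W p -> square z d%:C w -> W w ->
       nrm (\col_i F i p) <= M) ->
    (forall p, boundary W p -> exists k, U k p) ->
    (forall k, 0 <= l k) ->
    (forall k p q, U k p -> U k q -> cmod (p - q) <= l k) ->
    nrm (vcirc (fun i s => outside W s * F i s) z d%:C n) <=
      M * (\sum_k (touches (U k) z d)%:R * (l k + 2 * (d / n%:R))) +
      ((touches (boundary W) z d)%:R * (T * d ^+ 2) + T * d ^+ 3 / n%:R).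
Proof.
move=> M0 hF.
have /choice[c hc] : forall i, exists c : R, [/\ 0 <= c,
    forall z v n, (0 < n)%N -> square z v `<=` D ->
      cmod (circ (F i) z v n) <= c * cmod v ^+ 3 / n%:R &
    forall p q, D p -> D q -> cmod (F i q - F i p) <= c * cmod (q - p)].
  move=> i; have [c1 c10 h1] := circ_taylor2 (hF i).
  have [f' [c2 [c20 _ _ h2 _]]] := hF i.
  exists (c1 + c2); split; first exact: addr_ge0.
    move=> z v n n0 zD; apply: le_trans (h1 _ _ _ n0 zD) _.
    by rewrite ler_wpM2r ?invr_ge0// ler_wpM2r ?exprn_ge0 ?cmod_ge0// lerDl.
  move=> p q Dp Dq; apply: le_trans (h2 _ _ Dp Dq) _.
  by rewrite ler_wpM2r ?cmod_ge0// lerDr.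
pose S := \sum_i c i; have S0 : 0 <= S by apply: sumr_ge0 => i _; case: (hc i).
(* Four sides times the diameter bound [2 * d] of [square_diam]. *)
exists (8 * S); first exact: mulr_ge0.
move=> z d n I U l d0 n0 hD hM cover l0 diamU.
have nR : 0 < n%:R :> R by rewrite ltr0n.
have cd : cmod d%:C = d by rewrite cmodR gtr0_norm.
have d2 : 0 <= d ^+ 2 by rewrite exprn_ge0// ltW.
have d3 : 0 <= d ^+ 3 by rewrite exprn_ge0// ltW.
have S8 : 0 <= 8 * S by rewrite mulr_ge0.
have T1 : 0 <= (touches (boundary W) z d)%:R * (8 * S * d ^+ 2).
  exact: mulr_ge0 (ler0n _ _) (mulr_ge0 S8 d2).
have T2 : 0 <= 8 * S * d ^+ 3 / n%:R.
  by apply: mulr_ge0; [exact: mulr_ge0 S8 d3|rewrite invr_ge0 ltW].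
have T3 : 0 <= M * (\sum_k (touches (U k) z d)%:R * (l k + 2 * (d / n%:R))).
  rewrite mulr_ge0// sumr_ge0// => k _; rewrite mulr_ge0// addr_ge0//.
  by rewrite mulr_ge0// divr_ge0// ltW.
have [[p [Qp Wp]]|noout] := pselect (exists p, square z d%:C p /\ ~ W p); last first.
  apply: le_trans (_ : 0 <= _); last by rewrite !addr_ge0.
  have -> : vcirc (fun i s => outside W s * F i s) z d%:C n = \col_i 0.
    apply/colP => i; rewrite !mxE.
    rewrite -[RHS](mul0r (circ (F i) z d%:C n)) -circZ.
    apply: eq_circ_square => p Qp; congr (_ * _); rewrite /outside.
    by case: asboolP => // Wp; exfalso; apply: noout; exists p.
  by apply: le_trans (nrm_sum _) _; rewrite big1// => i _; rewrite mxE cmod0.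
have QD := hD _ Qp Wp.
have [[w [Qw Ww]]|noin] := pselect (exists w, square z d%:C w /\ W w); last first.
  have -> : vcirc (fun i s => outside W s * F i s) z d%:C n =
      \col_i circ (F i) z d%:C n.
    apply/colP => i; rewrite !mxE; apply: eq_circ_square => q Qq.
    by rewrite /outside asboolT ?mul1r// => Wq; apply: noin; exists q.
  apply: le_trans (sum_le_const (f := c) (x := d ^+ 3 / n%:R) _ _) _.
  - by rewrite divr_ge0// ltW.
  - by move=> i; have [_ h _] := hc i; rewrite mulrA -[X in X ^+ 3]cd h.
  have : 0 <= S * (d ^+ 3 / n%:R).
    by apply: mulr_ge0 => //; rewrite divr_ge0// ltW.
  rewrite -/S; lra.
(* In a cell meeting both [W] and its complement, [F] is frozen at the point [p] outside [W]; the
   error is of order [d] on a contour of length [4 * d]. *)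
pose E i s := outside W s * (F i s - F i p).
have -> : vcirc (fun i s => outside W s * F i s) z d%:C n =
    circ (outside W) z d%:C n *: (\col_i F i p) + \col_i circ (E i) z d%:C n.
  apply/colP => i; rewrite !mxE mulrC -circZ -circD.
  by apply: eq_circ_square => q _; rewrite /E; ring.
have bd : touches (boundary W) z d.
  have [s s01 bs] := boundary_crossing Ww Wp.
  by apply/asboolP; exists (w + s%:C * (p - w)); split=> //; exact: square_convex.
apply: le_trans (nrmD _ _) _; apply: lerD.
  apply: le_trans (nrmZ _ _) _; rewrite mulrC ler_pM ?cmod_ge0 ?nrm_ge0//.
  - exact: hM Qp Wp Qw Ww.
  apply: le_trans (flux_bound d0 n0 _ diamU) _.
    by move=> q _; exact: cover.
  rewrite big_mkcond/=; apply: ler_sum => k _; rewrite /touches.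
  by case: ifP; rewrite ?mul1r ?mul0r.
rewrite bd mul1r.
apply: le_trans (sum_le_const (f := c) (x := 8 * d ^+ 2) _ _) _.
- exact: mulr_ge0.
- move=> i; have [ci _ h] := hc i.
  apply: le_trans (@circ_bound _ (E i) z d%:C n (c i * (2 * d)) _ _) _.
  + by rewrite !mulr_ge0// ltW.
  + move=> x y x01 y01 _; set q := z + _; have Qq : square z d%:C q by exact: in_square.
    rewrite /E cmodM; apply: (@le_trans _ _ (1 * (c i * cmod (q - p)))).
      rewrite ler_pM ?cmod_ge0//; last by apply: h; apply: QD.
      by rewrite /outside cmod_nat; case: asboolP.
    rewrite mul1r ler_wpM2l//; apply: le_trans (square_diam Qq Qp) _.
    by rewrite cd.
  by rewrite cd; nra.
by rewrite -/S; lra.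
Qed.

(** The bound [M] is asked only outside [W] and close to it, because only mixed cells are charged
    the flux. Regularity is asked in a neighbourhood of the complement, since mixed cells overlap
    [W]. The shift [c] of the outer square is the offset of the grid. *)
Lemma contour_bound W D F (M L r rho H : R) : 0 <= M -> 0 < rho -> 0 <= r -> r + 1 <= H ->
  (forall i, has_taylor2 D (F i)) ->
  (forall w, W w -> `|complex.Re w| <= r /\ `|complex.Im w| <= r) ->
  (forall s z, ~ W s -> `|complex.Re s| <= H + 1 -> `|complex.Im s| <= H + 1 ->
     cmod (z - s) <= rho -> D z) ->
  (forall s w, ~ W s -> W w -> cmod (w - s) <= rho -> nrm (\col_i F i s) <= M) ->
  0 <= L -> (arc_length (boundary W) <= L%:E)%E ->
  forall e : R, 0 < e -> exists2 c : C, cmod c <= e &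
    forall n0, exists2 n, (n0 <= n)%N &
      nrm (vcirc F (c - (H +i* H)) (2 * H)%:C n) <= M * L + e.
Proof.
move=> M0 rho0 r0 rH hF hW hD hM L0 WL e e0.
have [T T0 squareT] := square_estimate W M0 hF.
have cW : compact (boundary W : set (R[i] : numFieldType)).
  apply: (@bounded_closed_compactC _ _ (2 * r + 1)); first exact: closed_boundary.
  move=> z [/closure_cmod/(_ _ ltr01)[w Ww zw] _].
  have -> : z = w + (z - w) by ring.
  apply: le_trans (cmodD _ _) _; have [wr wi] := hW _ Ww.
  have := cmod_ReIm w; lra.
(* Five errors of at most [e1] will occur: the excess of the fine cover, the straddling sets, two
   from the area of the boundary cells, and the terms of order [1 / n]. *)
pose e1 := e / 8; have e10 : 0 < e1 by rewrite divr_gt0.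
have L10 : 0 < L + 1 by lra.
(* The cells touched by the coarse cover have total area at most the sum of [(l1 k + 2 * d) ^ 2]. A
   small [eta1] controls the squares of [l1 k]; then, [m1] being fixed, a small [d] controls the
   rest. *)
pose eta1 := e1 / (2 * (T + 1) * (L + 1)).
have eta10 : 0 < eta1 by rewrite divr_gt0// !mulr_gt0//; lra.
have [m1 [U1 [l1 [l1b l1d l1s U1c]]]] := finite_cover cW WL eta10 ltr01.
pose q1 := e1 / (8 * T * m1%:R + 1).
have q10 : 0 < q1.
  by rewrite divr_gt0// ltr_wpDl// !mulr_ge0.
(* [rho / 2] keeps any two points of a cell within [rho], [e / 2] bounds the shift by [e], and [q1]
   serves the area of the boundary cells. *)
pose dm := Num.min (Num.min (rho / 2) (e / 2)) (Num.min 1 q1).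
have dm0 : 0 < dm by rewrite !lt_min ltr01 q10 !andbT; apply/andP; split; lra.
have H0 : 0 < H by lra.
pose K := (Num.truncn (2 * H / dm)).+1.
have KR : 0 < K%:R :> R by rewrite ltr0n.
pose d := 2 * H / K%:R.
have d0 : 0 < d by rewrite divr_gt0// mulr_gt0.
have ddm : d <= dm.
  rewrite ler_pdivrMr// [dm * _]mulrC -ler_pdivrMr//; exact: ltW (truncnS_gt _).
have [drho de d1 dq] : [/\ 2 * d <= rho, 2 * d <= e, d <= 1 & d <= q1].
  move: ddm; rewrite !le_min => /andP[/andP[a b] /andP[c' f]]; split=> //; lra.
have KdH : K%:R * d = 2 * H by rewrite /d mulrC divfK ?gt_eqF.
(* The number of offsets to average over, large enough for the loss [8 / m'%:R] of [good_offset]. *)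
pose m' := (Num.truncn (8 * M * (L + 1) / e1)).+1.
have mR : 0 < m'%:R :> R by rewrite ltr0n.
have m'b : 8 / m'%:R * (M * (L + 1)) <= e1.
  have := ltW (truncnS_gt (8 * M * (L + 1) / e1)); rewrite -/m' ler_pdivrMr//.
  have -> : 8 / m'%:R * (M * (L + 1)) = 8 * M * (L + 1) / m'%:R by ring.
  by rewrite [m'%:R * _]mulrC -ler_pdivrMr//.
pose eta2 := d / m'%:R / 2.
have eta20 : 0 < eta2 by apply: divr_gt0 => //; exact: divr_gt0.
pose e2 := Num.min 1 (e1 / (M + 1)).
have e20 : 0 < e2 by rewrite lt_min ltr01 divr_gt0//; lra.
have [m2 [U2 [l2 [l2b l2d l2s U2c]]]] := finite_cover cW WL eta20 e20.
have l2lt k : l2 k < d / m'%:R by have := l2b k; move: eta20; rewrite /eta2; lra.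
have l20 k : 0 < l2 k by case/andP: (l2b k).
have [s sm' good] := good_offset (- H) K d0 (ltn0Sn _ : 0 < m')%N l20 l2lt l2d.
pose sh := s%:R * (d / m'%:R); pose os := - H + sh.
have sh0 : 0 <= sh by rewrite mulr_ge0// divr_ge0// ltW.
have shd : sh < d.
  by rewrite /sh mulrA ltr_pdivrMr// mulrC ltr_pM2l// ltr_nat.
exists (sh +i* sh).
  apply: le_trans (cmod_ReIm _) _ => /=; rewrite ger0_norm//; clear - shd de d0; lra.
move=> n0.
(* All terms of order [1 / n], over all cells: the margins of the flux bound and the circulations of
   [F]. *)
pose A := M * (K%:R * K%:R * m2%:R * (2 * d)) + K%:R * K%:R * (T * d ^+ 3).
have A0 : 0 <= A.
  by rewrite addr_ge0// !mulr_ge0// ?exprn_ge0// ltW.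
pose n := (n0 + (Num.truncn (A / e1)).+1)%N.
have n_gt0 : (0 < n)%N by rewrite /n addnS.
have nR : 0 < n%:R :> R by rewrite ltr0n.
have An : A / n%:R <= e1.
  rewrite ler_pdivrMr// mulrC -ler_pdivrMr//; apply: le_trans (ltW (truncnS_gt _)) _.
  by rewrite ler_nat /n leq_addl.
exists (K * n)%N; first by rewrite mulSn -addnA leq_addr.
have zE : (sh +i* sh) - (H +i* H) = os +i* os.
  by apply/eqP; rewrite eq_complex /= /os addrC eqxx.
pose G i s := outside W s * F i s.
(* The outer boundary avoids [W], so [outside W] can be inserted there before cutting; the poles
   inside are thereby masked. *)
have -> : vcirc F (sh +i* sh - (H +i* H)) (2 * H)%:C (K * n) =
    \sum_(i < K) \sum_(j < K) vcirc G (grid_corner os d i j) d%:C n.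
  apply/colP => i; rewrite mxE zE summxE.
  under eq_bigr do rewrite summxE; under eq_bigr do under eq_bigr do rewrite mxE.
  rewrite /grid_corner -circ_grid natrC -realcM KdH.
  apply: eq_circ => x y x01 y01 xy; rewrite /G /outside asboolT ?mul1r//.
  move=> /hW.
  have -> : complex.Re ((os +i* os) + (x +i* y) * (2 * H)%:C) = os + x * (2 * H).
    by rewrite /=; ring.
  have -> : complex.Im ((os +i* os) + (x +i* y) * (2 * H)%:C) = os + y * (2 * H).
    by rewrite /=; ring.
  rewrite !ler_norml.
  by case/or4P: xy => /eqP ->; rewrite /os; clear - sh0 shd d1 rH x01 y01; lra.
apply: le_trans (nrm_bigsum _) _.
apply: (@le_trans _ _ (\sum_(i < K) \sum_(j < K)
  (M * (\sum_k (touches (U2 k) (grid_corner os d i j) d)%:R * l2 k) +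
   (\sum_k (touches (U1 k) (grid_corner os d i j) d)%:R) * (T * d ^+ 2) + A / n%:R / (K%:R * K%:R)))).
  apply: ler_sum => i _; apply: le_trans (nrm_bigsum _) _; apply: ler_sum => j _.
  have cell p : square (grid_corner os d i j) d%:C p ->
      `|complex.Re p| <= H + 1 /\ `|complex.Im p| <= H + 1.
    move=> /(in_grid_square d0)[pr pim].
    have bnd (k : 'I_K) : 0 <= k%:R * d /\ k%:R * d + d <= 2 * H.
      split; first by rewrite mulr_ge0// ltW.
      by rewrite -KdH -[X in _ + X]mul1r -mulrDl natr1 ler_pM2r// ler_nat.
    have [bi1 bi2] := bnd i; have [bj1 bj2] := bnd j.
    rewrite !ler_norml; move: pr pim; rewrite /os.
    by clear - bi1 bi2 bj1 bj2 sh0 shd d1; lra.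
  have near2 p p' : square (grid_corner os d i j) d%:C p ->
      square (grid_corner os d i j) d%:C p' -> cmod (p - p') <= rho.
    move=> Qp Qp'; apply: le_trans (square_diam Qp Qp') _.
    by rewrite cmodR gtr0_norm.
  apply: le_trans (squareT _ d n _ U2 l2 d0 n_gt0 _ _ _ _ l2d) _.
  - move=> p Qp Wp q Qq; have [pr pim] := cell _ Qp.
    exact: (hD p q Wp pr pim (near2 _ _ Qq Qp)).
  - by move=> p w Qp Wp Qw Ww; apply: hM Wp Ww _; exact: near2.
  - by move=> p /U2c.
  - by move=> k; rewrite ltW.
  have tb : (touches (boundary W) (grid_corner os d i j) d)%:R <=
      \sum_k (touches (U1 k) (grid_corner os d i j) d)%:R :> R.
    case: (boolP (touches (boundary W) _ _)) => [/asboolP[p [Wp Qp]]|_]; last first.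
      by rewrite sumr_ge0.
    have [k Uk] := U1c _ Wp; rewrite (bigD1 k)//=.
    have -> : touches (U1 k) (grid_corner os d i j) d by apply/asboolP; exists p.
    by rewrite lerDl sumr_ge0.
  have Td2 : 0 <= T * d ^+ 2 by apply: mulr_ge0 => //; rewrite exprn_ge0// ltW.
  have := ler_wpM2r Td2 tb => tb'.
  have : \sum_k (touches (U2 k) (grid_corner os d i j) d)%:R * (l2 k + 2 * (d / n%:R)) <=
      \sum_k (touches (U2 k) (grid_corner os d i j) d)%:R * l2 k + m2%:R * (2 * (d / n%:R)).
    have -> : m2%:R * (2 * (d / n%:R)) = \sum_(k < m2) 2 * (d / n%:R).
      by rewrite sumr_const card_ord mulr_natl.
    rewrite -big_split/=.
    apply: ler_sum => k _; rewrite mulrDr lerD2l ler_piMl//.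
      by rewrite mulr_ge0// divr_ge0// ltW.
    by rewrite -[leRHS]/(1%:R) ler_nat leq_b1.
  move=> /(ler_wpM2l M0) h2.
  have -> : A / n%:R / (K%:R * K%:R) = M * (m2%:R * (2 * (d / n%:R))) + T * d ^+ 3 / n%:R.
    by rewrite /A; field; rewrite !gt_eqF.
  by rewrite mulrDr in h2; lra.
under eq_bigr do rewrite !big_split/= -mulr_suml -mulr_sumr.
rewrite !big_split/= -mulr_suml -mulr_sumr.
have t1 : \sum_(i < K) \sum_(j < K) \sum_k (touches (U2 k) (grid_corner os d i j) d)%:R * l2 k
   <= (1 + 8 / m'%:R) * (L + e2).
  apply: le_trans good _; rewrite ler_wpM2l// addr_ge0// divr_ge0// ltW//.
have t2 : (\sum_(i < K) \sum_(j < K) \sum_k (touches (U1 k) (grid_corner os d i j) d)%:R) * d ^+ 2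
   <= 2 * eta1 * (L + 1) + 8 * m1%:R * d.
  have -> : \sum_(i < K) \sum_(j < K) \sum_k (touches (U1 k) (grid_corner os d i j) d)%:R =
     \sum_k \sum_(i < K) \sum_(j < K) (touches (U1 k) (grid_corner os d i j) d)%:R :> R.
    by under eq_bigr do rewrite exchange_big/=; rewrite exchange_big.
  rewrite mulr_suml; apply: (@le_trans _ _ (\sum_k (2 * eta1 * l1 k + 8 * d))).
    apply: ler_sum => k _; have /andP[l10 l1e] := l1b k.
    have := sum_touches_bound os K d0 (ltW l10) (l1d k).
    have d20 : 0 <= d ^+ 2 by rewrite exprn_ge0// ltW.
    move=> /(ler_wpM2r d20) /le_trans; apply.
    have -> : (l1 k / d + 2) ^+ 2 * d ^+ 2 = (l1 k + 2 * d) ^+ 2.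
      by field; rewrite gt_eqF.
    have : l1 k * l1 k <= eta1 * l1 k by rewrite ler_wpM2r// ltW.
    have : d * d <= 1 * d by rewrite ler_wpM2r// ltW.
    have := sqr_ge0 (l1 k - 2 * d).
    by rewrite !expr2; lra.
  rewrite big_split/= -mulr_sumr sumr_const card_ord.
  apply: lerD; first by apply: ler_wpM2l => //; rewrite mulr_ge0// ltW.
  by rewrite -[_ *+ m1]mulr_natr mulrAC.
have t3 : \sum_(i < K) \sum_(j < K) A / n%:R / (K%:R * K%:R) <= e1.
  rewrite !sumr_const !card_ord -mulrnA -[leLHS]mulr_natr natrM divfK//.
  by rewrite mulf_neq0// gt_eqF.
have t1' := ler_wpM2l M0 t1.
have t2' := ler_wpM2l T0 t2.
have e21 : e2 <= 1 by rewrite ge_min lexx.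
have Me2 : M * e2 <= e1.
  have : e2 <= e1 / (M + 1) by rewrite ge_min lexx orbT.
  rewrite ler_pdivlMr ?ltr_wpDl//; have := ltW e20; lra.
have m'b' : 8 / m'%:R * (M * (L + e2)) <= e1.
  apply: le_trans m'b; rewrite ler_wpM2l ?divr_ge0 ?(ltW mR)// ler_wpM2l//.
  by rewrite lerD2l.
have Teta : T * (2 * eta1 * (L + 1)) <= e1.
  have T1 : 0 < T + 1 by rewrite ltr_wpDl.
  have -> : T * (2 * eta1 * (L + 1)) = e1 * (T / (T + 1)).
    by rewrite /eta1; field; rewrite !gt_eqF.
  by rewrite -[leRHS]mulr1 ler_wpM2l ?(ltW e10)// ler_pdivrMr// mul1r lerDl ler01.
have Td : T * (8 * m1%:R * d) <= e1.
  have Tm : 0 <= 8 * T * m1%:R by rewrite !mulr_ge0.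
  move: dq; rewrite ler_pdivlMr ?ltr_wpDl//; have := ltW d0; lra.
have e8 : e = 8 * e1 by rewrite /e1; field.
rewrite -/os in t1'; move: t1' t2' t3.
rewrite [X in _ + X + _]mulrCA e8; lra.
Qed.

End ContourBound.

(** * The Cauchy formula for the resolvent *)

Section CauchyKernel.
Variable R : realType.
Local Notation C := R[i].

(** By the mean value theorem, since [1 / (1 + x ^ 2)] is 2-Lipschitz on [[-1, 1]]. *)
Lemma atan_increment (a b x : R) : -1 <= a -> a < b -> b <= 1 -> a <= x <= b ->
  `|atan b - atan a - (b - a) / (1 + x ^+ 2)| <= 2 * (b - a) ^+ 2.
Proof.
move=> a1 ab b1 /andP[ax xb].
have [xi] : exists2 xi : R, xi \in `]a, b[%R &
    atan b - atan a = (1 + xi ^+ 2)^-1 * (b - a).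
  apply: MVT => //.
  by apply: continuous_subspaceT => y; exact: continuous_atan.
rewrite in_itv/= => /andP[axi xib] ->.
have pos (y : R) : 0 < 1 + y ^+ 2 by have := sqr_ge0 y; lra.
have -> : (1 + xi ^+ 2)^-1 * (b - a) - (b - a) / (1 + x ^+ 2) =
  (b - a) * ((x - xi) * (x + xi)) * ((1 + xi ^+ 2)^-1 * (1 + x ^+ 2)^-1).
  by field; rewrite !gt_eqF ?pos.
have inv1 (y : R) : 0 <= (1 + y ^+ 2)^-1 <= 1.
  rewrite invr_ge0 (ltW (pos y))/= invf_le1 ?pos//; have := sqr_ge0 y; lra.
have prod1 : `|(1 + xi ^+ 2)^-1 * (1 + x ^+ 2)^-1| <= 1.
  have /andP[p0 p1] := inv1 xi; have /andP[q0 q1] := inv1 x.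
  by rewrite ger0_norm ?mulr_ge0// mulr_ile1.
rewrite normrM -[leRHS]mulr1 ler_pM//.
rewrite !normrM ger0_norm ?subr_ge0 ?(ltW ab)//.
have d0 : 0 <= b - a by lra.
have h1 : `|x - xi| <= b - a by rewrite ler_norml; lra.
have h2 : `|x + xi| <= 2 by rewrite ler_norml; lra.
have := ler_pM (normr_ge0 _) (normr_ge0 _) h1 h2.
move=> /(ler_wpM2l d0); rewrite expr2; lra.
Qed.

Lemma sum_arctan_riemann n : (0 < n)%N ->
  `|\sum_(k < n) (2 / n%:R) / (1 + (-1 + 2 * ((k%:R + 2^-1) / n%:R)) ^+ 2) - pi / 2|
    <= 8 / n%:R :> R.
Proof.
move=> n0; have nR : 0 < n%:R :> R by rewrite ltr0n.
pose a (k : nat) : R := -1 + 2 * (k%:R / n%:R).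
have -> : pi / 2 = \sum_(k < n) (atan (a k.+1) - atan (a k)).
  rewrite -(big_mkord xpredT (fun k => atan (a k.+1) - atan (a k))).
  rewrite (telescope_sumr (fun k => atan (a k)))// /a mul0r mulr0 addr0 divff ?gt_eqF//.
  have -> : -1 + 2 * 1 = 1 :> R by ring.
  by rewrite atanN atan1; field.
rewrite -sumrB; apply: le_trans (ler_norm_sum _ _ _) _.
apply: (@le_trans _ _ (\sum_(k < n) 2 * (2 / n%:R) ^+ 2)); last first.
  rewrite sumr_const card_ord -[leLHS]mulr_natr le_eqVlt; apply/orP; left; apply/eqP.
  by field; rewrite gt_eqF.
apply: ler_sum => k _.
have ab : a k.+1 - a k = 2 / n%:R by rewrite /a -[k.+1%:R]natr1; ring.
have k0 : 0 <= k%:R / n%:R :> R by rewrite divr_ge0.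
have k1 : k.+1%:R / n%:R <= 1 :> R by rewrite ler_pdivrMr// mul1r ler_nat.
have nV : 0 < n%:R^-1 :> R by rewrite invr_gt0.
rewrite distrC -ab; apply: atan_increment; rewrite /a.
- by lra.
- by rewrite -[k.+1%:R]natr1 mulrDl; lra.
- by lra.
- by rewrite -[k.+1%:R]natr1 !mulrDl; lra.
Qed.

(** In a coordinate [x] in [[-1, 1]] along the sides, the four sides together contribute
    [4 i / (1 + x ^ 2)], whatever [H]. This leaves a Riemann sum of the integral [pi / 2]. *)
Lemma circ_inv H (c : C) n : 0 < H -> (0 < n)%N ->
  cmod (circ (fun s => (s - c)^-1) (c - (H +i* H)) (2 * H)%:C n
        - 2 * pi%:C * 'i%C) <= 32 / n%:R.
Proof.
move=> H0 n0; have nR : 0 < n%:R :> R by rewrite ltr0n.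
pose x (k : nat) : R := -1 + 2 * ((k%:R + 2^-1) / n%:R).
have nC : n%:R != 0 :> C by rewrite pnatr_eq0 -lt0n.
have HC : H%:C != 0 :> C by rewrite (inj_eq (@complexI R)) gt_eqF.
have x2 k : (1 + (x k)%:C ^+ 2 : C) != 0.
  have -> : 1 + (x k)%:C ^+ 2 = (1 + x k ^+ 2)%:C :> C.
    by rewrite expr2 !realcE realc1 -expr2.
  by rewrite (inj_eq (@complexI R)) gt_eqF//; have := sqr_ge0 (x k); lra.
have i2 : 'i%C ^+ 2 = -1 :> C by exact: sqr_i.
have xi k : ((x k)%:C - 'i%C != 0 :> C) /\ ((x k)%:C + 'i%C != 0 :> C).
  have E : ((x k)%:C - 'i%C) * ((x k)%:C + 'i%C) = 1 + (x k)%:C ^+ 2 :> C.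
    rewrite -[1 in RHS]opprK -i2; ring.
  by apply/andP; rewrite -negb_or -mulf_eq0 E.
have xi' k : (1 + 'i%C * (x k)%:C != 0 :> C) /\ (- 1 + 'i%C * (x k)%:C != 0 :> C).
  split.
    have -> : 1 + 'i%C * (x k)%:C = 'i%C * ((x k)%:C - 'i%C) :> C.
      rewrite mulrBr -expr2 i2; ring.
    by rewrite mulf_neq0 ?(xi k).1// -cmod_eq0 cmod_i oner_eq0.
  have -> : -1 + 'i%C * (x k)%:C = 'i%C * ((x k)%:C + 'i%C) :> C.
    rewrite mulrDr -expr2 i2; ring.
  by rewrite mulf_neq0 ?(xi k).2// -cmod_eq0 cmod_i oner_eq0.
have -> : circ (fun s => (s - c)^-1) (c - (H +i* H)) (2 * H)%:C n =
    4 * 'i%C * (\sum_(k < n) (2 / n%:R) / (1 + (x k) ^+ 2))%:C.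
  have HH : (H +i* H) = H%:C * (1 + 'i%C) :> C by rewrite [LHS]complexE /=; ring.
  have E2H : (2 * H)%:C = 2 * H%:C :> C by rewrite realcM realc_nat.
  have xE k : (x k)%:C = -1 + 2 * ((k%:R + 2^-1) / n%:R) :> C.
    by rewrite /x !realcE.
  rewrite /circ /side HH E2H.
  rewrite -sumrN -sumrN -!big_split/= rmorph_sum mulr_sumr; apply: eq_bigr => k _.
  set m : C := (k%:R + 2^-1) / n%:R.
  have mE : m = ((x k)%:C + 1) / 2.
    by rewrite xE -/m; field.
  rewrite mE.
  have -> : c - H%:C * (1 + 'i%C) + ((x k)%:C + 1) / 2 * (2 * H%:C) - c =
    H%:C * ((x k)%:C - 'i%C) by field.
  have -> : c - H%:C * (1 + 'i%C) + 2 * H%:C +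
      ((x k)%:C + 1) / 2 * ('i%C * (2 * H%:C)) - c =
    H%:C * (1 + 'i%C * (x k)%:C) by field.
  have -> : c - H%:C * (1 + 'i%C) + 'i%C * (2 * H%:C) +
      ((x k)%:C + 1) / 2 * (2 * H%:C) - c =
    H%:C * ((x k)%:C + 'i%C) by field.
  have -> : c - H%:C * (1 + 'i%C) + ((x k)%:C + 1) / 2 * ('i%C * (2 * H%:C)) - c =
    H%:C * (- 1 + 'i%C * (x k)%:C) by field.
  rewrite [X in _ = _ * X](_ : _ = 2 / n%:R / (1 + (x k)%:C ^+ 2)); last first.
    transitivity ((2 / n%:R / (1 + x k ^+ 2))%:C) => //.
    by rewrite expr2 !realcE realc1 -expr2.
  have -> : 1 + 'i%C * (x k)%:C = 'i%C * ((x k)%:C - 'i%C) :> C.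
    rewrite mulrBr -expr2 i2; ring.
  have -> : -1 + 'i%C * (x k)%:C = 'i%C * ((x k)%:C + 'i%C) :> C.
    rewrite mulrDr -expr2 i2; ring.
  have E : 1 + (x k)%:C ^+ 2 = ((x k)%:C - 'i%C) * ((x k)%:C + 'i%C) :> C.
    rewrite -[1 in LHS]opprK -i2; ring.
  rewrite E; have i0 : 'i%C != 0 :> C by rewrite -cmod_eq0 cmod_i oner_eq0.
  by field; rewrite nC HC i0 (xi k).1 (xi k).2.
have -> : 2 * pi%:C * 'i%C = 4 * 'i%C * (pi / 2)%:C :> C.
  by rewrite realcM realcV realc_nat; field.
rewrite -mulrBr cmodM cmodM cmod_i cmod_nat mulr1 -realcN -realcD cmodR.
have := sum_arctan_riemann n0; rewrite -/(x _) => h.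
have -> : 32 / n%:R = 4 * (8 / n%:R) :> R by ring.
by rewrite ler_pM2l.
Qed.

End CauchyKernel.

Section Resolvent.
Variable R : realType.
Local Notation C := R[i].

(** A submultiplicative norm that dominates the entries, for qualitative estimates that do not
    affect the final constant. *)
Definition l1norm m n (M : 'M[C]_(m, n)) : R := \sum_i \sum_j cmod (M i j).

Lemma l1norm_ge0 m n (M : 'M[C]_(m, n)) : 0 <= l1norm M.
Proof. by apply: sumr_ge0 => i _; apply: sumr_ge0 => j _; exact: cmod_ge0. Qed.

Lemma l1normD m n (A B : 'M[C]_(m, n)) : l1norm (A + B) <= l1norm A + l1norm B.
Proof.
rewrite /l1norm -big_split; apply: ler_sum => i _ /=.
by rewrite -big_split; apply: ler_sum => j _ /=; rewrite mxE cmodD.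
Qed.

Lemma l1normZ m n (a : C) (A : 'M[C]_(m, n)) : l1norm (a *: A) = cmod a * l1norm A.
Proof.
rewrite /l1norm mulr_sumr; apply: eq_bigr => i _; rewrite mulr_sumr.
by apply: eq_bigr => j _; rewrite mxE cmodM.
Qed.

Lemma entry_le_l1norm m n (A : 'M[C]_(m, n)) i j : cmod (A i j) <= l1norm A.
Proof.
rewrite /l1norm (bigD1 i)//= (bigD1 j)//= -addrA lerDl.
by rewrite addr_ge0// sumr_ge0// => k _; rewrite ?sumr_ge0// => *; exact: cmod_ge0.
Qed.

Lemma l1norm_mulmx m n p (A : 'M[C]_(m, n)) (B : 'M[C]_(n, p)) :
  l1norm (A *m B) <= l1norm A * l1norm B.
Proof.
rewrite /l1norm mulr_suml; apply: ler_sum => i _.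
apply: (@le_trans _ _ (\sum_j \sum_k cmod (A i k) * cmod (B k j))).
  apply: ler_sum => j _; rewrite mxE; apply: le_trans (cmod_sum _ _ _) _.
  by apply: ler_sum => k _; rewrite cmodM.
rewrite exchange_big mulr_suml; apply: ler_sum => k _ /=.
rewrite -mulr_sumr ler_wpM2l ?cmod_ge0//.
rewrite [leRHS](bigD1 k)//= lerDl sumr_ge0// => l _.
by rewrite sumr_ge0// => *; exact: cmod_ge0.
Qed.

Lemma l1norm_eq0 m n (A : 'M[C]_(m, n)) : l1norm A = 0 -> A = 0.
Proof.
move=> A0; apply/matrixP => i j; rewrite mxE; apply/eqP.
by rewrite -cmod_eq0 eq_le cmod_ge0 andbT -A0 entry_le_l1norm.
Qed.

Variables (N : nat) (A : 'M[C]_N).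

Lemma resolvent_unit (s : C) : l1norm A < cmod s -> s%:M - A \in unitmx.
Proof.
move=> As; rewrite unitmxE unitfE; apply/det0P => -[v v0].
rewrite mulmxBr mul_mx_scalar => /subr0_eq svA.
have : cmod s * l1norm v <= l1norm A * l1norm v.
  by rewrite -l1normZ svA mulrC; exact: l1norm_mulmx.
rewrite ler_pM2r; first by rewrite leNgt As.
rewrite lt_def l1norm_ge0 andbT; apply: contra v0 => /eqP/l1norm_eq0 ->.
by rewrite eqxx.
Qed.

Lemma resolvent_bound (s : C) k (v : 'M[C]_(N, k)) : l1norm A < cmod s ->
  l1norm (invmx (s%:M - A) *m v) <= l1norm v / (cmod s - l1norm A).
Proof.
move=> As; set y := _ *m v; rewrite ler_pdivlMr ?subr_gt0//.
have sy : s *: y = v + A *m y.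
  have : (s%:M - A) *m y = v by rewrite /y mulmxA mulmxV ?mul1mx// resolvent_unit.
  by rewrite mulmxBl mul_scalar_mx => <-; rewrite subrK.
have : cmod s * l1norm y <= l1norm v + l1norm A * l1norm y.
  by rewrite -l1normZ sy; apply: le_trans (l1normD _ _) _; rewrite lerD2l l1norm_mulmx.
by lra.
Qed.

(** The quotient of [X ^ m - Y ^ m] by [X - Y], for [X = 1 + tau s] and [Y = 1 + tau A], in Horner
    form; its entries are polynomials in [s]. *)
Fixpoint psi (tau : C) (m : nat) (s : C) : 'M[C]_N :=
  if m is m'.+1 then (1 + tau * s) *: psi tau m' s + (1%:M + tau *: A) ^+ m' else 0.

(* X^m - Y^m = tau (s - A) psi_m(s) for X = 1 + tau s, Y = 1 + tau A. *)
Lemma psiE (tau s : C) (m : nat) (v y : 'cV[C]_N) : s *: y = v + A *m y ->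
  (1 + tau * s) ^+ m *: y =
  (1%:M + tau *: A) ^+ m *m y + tau *: (psi tau m s *m v).
Proof.
move=> sy; set X := 1 + tau * s; set Y := 1%:M + tau *: A.
have Xy : X *: y = Y *m y + tau *: v.
  by rewrite /X /Y scalerDl scale1r mulmxDl mul1mx -scalerA sy scalerDr -scalemxAl
     addrA addrAC.
elim: m => [|m IH] /=.
  by rewrite expr0 scale1r mul0mx scaler0 addr0 mul1mx.
rewrite exprS -scalerA IH scalerDr -/X -/Y [X *: (tau *: _)]scalerA [X * tau]mulrC -scalerA.
have -> : Y ^+ m.+1 = Y ^+ m *m Y by rewrite exprSr.
clearbody X Y.
rewrite scalemxAr Xy mulmxDr -scalemxAr -mulmxA mulmxDl scalerDr -scalemxAl -addrA.
by congr (_ + _); rewrite addrC.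
Qed.

Lemma has_taylor2_psi (D : set C) (r : R) (tau : C) m i j :
  (forall z, D z -> cmod z <= r) -> has_taylor2 D (fun s => psi tau m s i j).
Proof.
move=> Dr; elim: m => [|m IH] /=.
  by apply: has_taylor2_eq (has_taylor2_cst D 0) => z _; rewrite mxE.
have hX : has_taylor2 D (fun s => 1 + tau * s).
  apply: has_taylor2D (has_taylor2_cst _ _) _.
  by apply: has_taylor2M (has_taylor2_cst _ _) (has_taylor2_id Dr).
apply: has_taylor2_eq (has_taylor2D (has_taylor2M hX IH) (has_taylor2_cst D _)) => z _.
by rewrite !mxE.
Qed.

Lemma has_taylor2_mulmx (D : set C) m n p (L : 'M[C]_(m, n)) (G : C -> 'M[C]_(n, p)) i j :
  (forall k, has_taylor2 D (fun s => G s k j)) ->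
  has_taylor2 D (fun s => (L *m G s) i j).
Proof.
move=> hG; apply: has_taylor2_eq (_ : has_taylor2 D (fun s => \sum_k L i k * G s k j)).
  by move=> z _; rewrite mxE.
apply: has_taylor2_sum => k _; exact: has_taylor2M (has_taylor2_cst _ _) (hG k).
Qed.

Lemma outer_boundary_far (H : R) (c : C) (x u : R) : 0 < H ->
  0 <= x <= 1 -> 0 <= u <= 1 -> [|| x == 0, x == 1, u == 0 | u == 1] ->
  H <= cmod (c - (H +i* H) + (x +i* u) * (2 * H)%:C - c).
Proof.
move=> H0 x01 u01 xu; set w := _ - c.
have wE : w = (- H + x * (2 * H)) +i* (- H + u * (2 * H)).
  rewrite /w; case: (c) => c' c''; apply/eqP; rewrite eq_complex/=.
  by apply/andP; split; apply/eqP; ring.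
have := cmod_Re w; have := cmod_Im w; rewrite wE /=.
case/or4P: xu => /eqP ->; rewrite ?mul0r ?mul1r ?addr0.
- by move=> _; apply: le_trans; rewrite normrN gtr0_norm.
- by move=> _; apply: le_trans; rewrite ger0_norm; lra.
- by move=> + _; apply: le_trans; rewrite normrN gtr0_norm.
- by move=> + _; apply: le_trans; rewrite ger0_norm; lra.
Qed.

(* q(s) (sI - A)^-1 = q(A) (sI - A)^-1 + a polynomial in s, and the remaining
   resolvent is compared with 1 / (s - c). *)
Lemma outer_contour Q (L : 'M[C]_(Q, N)) (v : 'cV[C]_N) (tau : C) m i (e : R) : 0 < e ->
  exists H0 : R, forall (H : R) (c : C), H0 <= H -> cmod c <= 1 ->
  exists n0, forall n, (n0 <= n)%N ->
    cmod (circ (fun s => ((1 + tau * s) ^+ m *: (L *m (invmx (s%:M - A) *m v))) i 0)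
            (c - (H +i* H)) (2 * H)%:C n
          - 2 * pi%:C * 'i%C * (L *m ((1%:M + tau *: A) ^+ m *m v)) i 0) <= e.
Proof.
move=> e0; set Y := (1%:M + tau *: A) ^+ m.
pose k0 := cmod ((L *m (Y *m v)) i 0).
pose kap := l1norm (L *m (Y *m A)) + l1norm (L *m Y).
have kap0 : 0 <= kap by rewrite addr_ge0 ?l1norm_ge0.
have v0 := l1norm_ge0 v; have a0 := l1norm_ge0 A.
(* On the outer boundary [g1] is at most [kap * l1norm v / (H * (H - 1 - l1norm A))], on a length
   [8 * H]; the last term brings the product below [e / 3]. *)
exists (l1norm A + 2 + 24 * (kap * l1norm v) / e) => H c HH c1.
have kv0 : 0 <= 24 * (kap * l1norm v) / e.
  by rewrite divr_ge0 ?(ltW e0)// !mulr_ge0.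
have H0 : 0 < H by lra.
pose y s := invmx (s%:M - A) *m v.
(* The identity [y = (s - c)^-1 (v + (A - c) y)] splits off the Cauchy kernel; [g1] is the part of
   order [H ^ -2] and [g2] is polynomial. *)
pose g1 s := (s - c)^-1 * (L *m (Y *m ((A - c%:M) *m y s))) i 0.
pose g2 s := tau * (L *m (psi tau m s *m v)) i 0.
pose D := [set z : C | cmod z <= 1 + 6 * H].
have hg2 : has_taylor2 D g2.
  apply: has_taylor2M; first exact: has_taylor2_cst.
  apply: has_taylor2_mulmx => k.
  apply: has_taylor2_eq (_ : has_taylor2 D (fun s => \sum_j psi tau m s k j * v j 0)).
    by move=> z _; rewrite mxE.
  apply: has_taylor2_sum => j _; apply: has_taylor2M; last exact: has_taylor2_cst.
  by apply: (@has_taylor2_psi D (1 + 6 * H)) => z.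
have [M M0 hM] := circ_taylor2 hg2.
pose B := 32 * k0 + M * (2 * H) ^+ 3.
have k00 : 0 <= k0 := cmod_ge0 _.
have B0 : 0 <= B.
  have h3 : 0 <= (2 * H) ^+ 3 by rewrite exprn_ge0// mulr_ge0// ltW.
  by have := mulr_ge0 M0 h3; rewrite /B; lra.
pose n0 := (Num.truncn (B / (e / 3))).+1.
have e30 : 0 < e / 3 by rewrite divr_gt0.
exists n0 => n n0n; have n_gt0 : (0 < n)%N by rewrite (leq_trans _ n0n).
have nR : 0 < n%:R :> R by rewrite ltr0n.
have Bn : B / n%:R <= e / 3.
  rewrite ler_pdivrMr// mulrC -ler_pdivrMr//; apply: le_trans (ltW (truncnS_gt _)) _.
  by rewrite ler_nat.
set z := c - (H +i* H); set d := (2 * H)%:C.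
have cd : cmod d = 2 * H by rewrite cmodR gtr0_norm// mulr_gt0.
have far x u : _ -> _ -> _ -> _ := @outer_boundary_far H c x u H0.
have far' s : H <= cmod (s - c) -> H - 1 <= cmod s.
  move=> sc; have := cmodB s c; lra.
have -> : circ (fun s => ((1 + tau * s) ^+ m *: (L *m (invmx (s%:M - A) *m v))) i 0) z d n =
  circ (fun s => (L *m (Y *m v)) i 0 * (s - c)^-1 + (g1 s + g2 s)) z d n.
  apply: eq_circ => x u x01 u01 xu; set s := z + _.
  have sc := far x u x01 u01 xu; rewrite -/s in sc.
  have As : l1norm A < cmod s by have := far' _ sc; lra.
  have sc0 : s - c != 0 by rewrite -cmod_gt0; lra.
  have sy : s *: y s = v + A *m y s.
    have : (s%:M - A) *m y s = v by rewrite /y mulmxA mulmxV ?mul1mx// resolvent_unit.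
    by rewrite mulmxBl mul_scalar_mx => <-; rewrite subrK.
  have yE : y s = (s - c)^-1 *: (v + (A - c%:M) *m y s).
    apply: (scalerI sc0); rewrite scalerA divff// scale1r scalerBl sy.
    by rewrite mulmxBl mul_scalar_mx addrA.
  rewrite -/(y s) scalemxAr (psiE _ _ sy) -/Y mulmxDr -scalemxAr.
  transitivity ((L *m (Y *m y s)) i 0 + g2 s).
    by rewrite [LHS]mxE; congr (_ + _); rewrite mxE.
  rewrite addrA; congr (_ + _).
  transitivity (((s - c)^-1 *: (L *m (Y *m v) + L *m (Y *m ((A - c%:M) *m y s)))) i 0).
    by congr (fun_of_matrix _ i 0); rewrite {1}yE -!scalemxAr !mulmxDr.
  by rewrite [LHS]mxE [X in _ * X]mxE mulrDr mulrC.
rewrite !circD circZ.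
have E1 : cmod (circ g1 z d n) <= e / 3.
  pose Z := H^-1 * (kap * (l1norm v / (H - 1 - l1norm A))).
  have Hpos : 0 < H - 1 - l1norm A by lra.
  have Z0 : 0 <= Z.
    by rewrite mulr_ge0 ?invr_ge0 ?(ltW H0)// mulr_ge0// divr_ge0// ltW.
  apply: le_trans (@circ_bound _ g1 z d n Z Z0 _) _.
    move=> x u x01 u01 xu; set s := z + _.
    have sc := far x u x01 u01 xu; rewrite -/s in sc.
    have sH := far' _ sc; have As : l1norm A < cmod s by lra.
    rewrite /g1 cmodM ler_pM ?cmod_ge0//.
      by rewrite cmodV lef_pV2 ?posrE//; lra.
    apply: le_trans (entry_le_l1norm _ _ _) _.
    have -> : L *m (Y *m ((A - c%:M) *m y s)) = (L *m Y *m (A - c%:M)) *m y s.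
      by rewrite !mulmxA.
    apply: le_trans (l1norm_mulmx _ _) _.
    rewrite ler_pM ?l1norm_ge0//.
      rewrite mulmxBr mul_mx_scalar -scaleNr; apply: le_trans (l1normD _ _) _.
      rewrite l1normZ cmodN /kap mulmxA lerD2l ler_piMl ?l1norm_ge0//.
    apply: le_trans (resolvent_bound _ As) _.
    by rewrite ler_wpM2l// lef_pV2 ?posrE ?subr_gt0//; lra.
  rewrite cd /Z.
  have -> : 4 * (H^-1 * (kap * (l1norm v / (H - 1 - l1norm A)))) * (2 * H) =
      8 * (kap * l1norm v) / (H - 1 - l1norm A) by field; rewrite !gt_eqF.
  rewrite ler_pdivrMr//.
  have : 24 * (kap * l1norm v) <= e * (H - 1 - l1norm A).
    by rewrite [e * _]mulrC -ler_pdivrMr//; lra.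
  lra.
have E2 : cmod (circ g2 z d n) <= M * (2 * H) ^+ 3 / n%:R.
  rewrite -cd; apply: hM => // _ [[x u]] /= /andP[x01 u01] <-.
  rewrite /D/=; apply: le_trans (cmodD _ _) _; rewrite cmodM cd.
  have : cmod z <= 1 + 2 * H.
    apply: le_trans (cmodB _ _) _; have := cmod_ReIm (H +i* H).
    rewrite /= gtr0_norm//; lra.
  have : cmod (x +i* u) <= 2.
    apply: le_trans (cmod_ReIm _) _ => /=; rewrite !ger0_norm; lra.
  by move=> /(ler_wpM2r (ltW (mulr_gt0 (ltr0Sn R 1) H0))); lra.
have E0 := circ_inv c H0 n_gt0.
set a := (L *m (Y *m v)) i 0; set I0 := circ _ z d n in E0 *.
have -> : a * I0 + (circ g1 z d n + circ g2 z d n) - 2 * pi%:C * 'i%C * a =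
   a * (I0 - 2 * pi%:C * 'i%C) + circ g1 z d n + circ g2 z d n by ring.
apply: le_trans (cmodD _ _) _; apply: le_trans (lerD (cmodD _ _) (lexx _)) _.
rewrite cmodM -/k0.
have := ler_wpM2l k00 E0; move: Bn; rewrite /B mulrDl; lra.
Qed.

End Resolvent.

(** * Vector norms and the transfer function *)

Section PNorm.
Variable R : realType.
Local Notation C := R[i].

Lemma powRK (r x : R) : 0 < r -> 0 <= x -> (x `^ r) `^ r^-1 = x.
Proof. by move=> r0 x0; rewrite -powRrM divff ?gt_eqF// powRr1. Qed.

Lemma powRVK (r x : R) : 0 < r -> 0 <= x -> (x `^ r^-1) `^ r = x.
Proof. by move=> r0 x0; rewrite -powRrM mulVf ?gt_eqF// powRr1. Qed.

Lemma powR_div (r x y : R) : 0 <= x -> 0 < y -> x `^ r / y `^ r = (x / y) `^ r.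
Proof.
move=> x0 y0; have xy0 : 0 <= x / y by rewrite divr_ge0// ltW.
have -> : x `^ r = (x / y) `^ r * y `^ r.
  by rewrite -powRM ?(ltW y0)// divfK// gt_eqF.
by rewrite mulfK// gt_eqF// powR_gt0.
Qed.

Lemma sum_powR_eq0 n (a : 'I_n -> R) (r : R) : 0 < r ->
  (\sum_k a k `^ r) `^ r^-1 = 0 -> forall k, a k = 0.
Proof.
move=> r0 /powR_eq0_eq0 /eqP; rewrite psumr_eq0; last by move=> k _; exact: powR_ge0.
by move=> /allP h k; have /(_ (mem_index_enum k)) := h k; move=> /eqP /powR_eq0_eq0.
Qed.

(** Convexity of the [r]-th power at the normalised entries [a k / al] and [b k / be], with weights
    proportional to [al] and [be]; a zero norm is treated apart. *)
Lemma minkowski_sum n (a b : 'I_n -> R) (r : R) : 1 <= r ->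
  (forall k, 0 <= a k) -> (forall k, 0 <= b k) ->
  (\sum_k (a k + b k) `^ r) `^ r^-1 <=
  (\sum_k a k `^ r) `^ r^-1 + (\sum_k b k `^ r) `^ r^-1.
Proof.
move=> r1 a0 b0; have r0 : 0 < r by lra.
set al := (\sum_k a k `^ r) `^ r^-1; set be := (\sum_k b k `^ r) `^ r^-1.
have [al0|al0] := eqVneq al 0.
  have a00 := sum_powR_eq0 r0 al0.
  under eq_bigr do rewrite a00 add0r.
  by rewrite al0 add0r.
have [be0|be0] := eqVneq be 0.
  have b00 := sum_powR_eq0 r0 be0.
  under eq_bigr do rewrite b00 addr0.
  by rewrite be0 addr0.
have {}al0 : 0 < al by rewrite lt_def al0 powR_ge0.
have {}be0 : 0 < be by rewrite lt_def be0 powR_ge0.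
have sa : \sum_k a k `^ r = al `^ r.
  by rewrite powRVK// sumr_ge0// => k _; exact: powR_ge0.
have sb : \sum_k b k `^ r = be `^ r.
  by rewrite powRVK// sumr_ge0// => k _; exact: powR_ge0.
clearbody al be.
have ab0 : 0 < al + be by rewrite addr_gt0.
rewrite -[leRHS](powRK r0 (ltW ab0)).
rewrite ge0_ler_powR ?nnegrE ?invr_ge0 ?(ltW r0) ?powR_ge0//.
  by rewrite sumr_ge0// => k _; exact: powR_ge0.
pose la := al / (al + be).
have la0 : 0 <= la by rewrite divr_ge0 ?ltW.
have la1 : la <= 1 by rewrite ler_pdivrMr// mul1r lerDl ltW.
apply: (@le_trans _ _ (\sum_k (al + be) `^ r *
   (la * (a k `^ r / al `^ r) + (1 - la) * (b k `^ r / be `^ r)))).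
  apply: ler_sum => k _.
  have -> : a k + b k = (al + be) * (la * (a k / al) + (1 - la) * (b k / be)).
    by rewrite /la; field; rewrite !gt_eqF.
  have ak0 : 0 <= a k / al by rewrite divr_ge0// ltW.
  have bk0 : 0 <= b k / be by rewrite divr_ge0// ltW.
  have la1' : 0 <= 1 - la by rewrite subr_ge0.
  have X0 : 0 <= la * (a k / al) + (1 - la) * (b k / be).
    by apply: addr_ge0; apply: mulr_ge0.
  rewrite (powRM _ (ltW ab0) X0) ler_wpM2l ?powR_ge0//.
  rewrite !powR_div//.
  by apply: (convex_powR r1 (Itv01 la0 la1)); rewrite mem_setE in_itv/= andbT.
rewrite -mulr_sumr big_split/= -!mulr_sumr -!mulr_suml sa sb.
rewrite !divff ?gt_eqF ?powR_gt0//.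
by rewrite !mulr1 addrC subrK mulr1.
Qed.

Variable (p : \bar R).
Hypothesis p1 : (1 <= p)%E.

Lemma pnorm_cases : (exists2 r : R, 1 <= r & p = r%:E) \/ p = +oo%E.
Proof.
by move: p1; case: p => [r|_|//]; [rewrite lee_fin => r1; left; exists r|right].
Qed.

Lemma bigmax_ge (n : nat) (f : 'I_n -> R) k : f k <= \big[Num.max/0]_k f k.
Proof. by rewrite (bigD1 k)//= le_max lexx. Qed.

Lemma bigmax_ge0 (n : nat) (f : 'I_n -> R) : 0 <= \big[Num.max/0]_k f k.
Proof. by elim/big_rec: _ => // i x _ x0; rewrite le_max x0 orbT. Qed.

Lemma bigmax_le (n : nat) (f : 'I_n -> R) (B : R) : 0 <= B ->
  (forall k, f k <= B) -> \big[Num.max/0]_k f k <= B.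
Proof. by move=> B0 fB; elim/big_ind: _ => // x y xB yB; rewrite ge_max xB. Qed.

Lemma pnorm_ge0 n (x : 'cV[C]_n) : 0 <= pnorm p x.
Proof.
by case: pnorm_cases => [[r r1 ->]|->] /=; [exact: powR_ge0|exact: bigmax_ge0].
Qed.

Lemma pnormZ n (a : C) (x : 'cV[C]_n) : pnorm p (a *: x) = cmod a * pnorm p x.
Proof.
case: pnorm_cases => [[r r1 ->]|->] /=.
  have r0 : 0 < r by lra.
  under eq_bigr do rewrite mxE cmodM powRM ?cmod_ge0//.
  rewrite -mulr_sumr powRM ?powR_ge0 ?powRK ?cmod_ge0//.
  by rewrite sumr_ge0// => k _; exact: powR_ge0.
apply/eqP; rewrite eq_le; apply/andP; split.
  apply: bigmax_le => [|k]; first by rewrite mulr_ge0 ?cmod_ge0 ?bigmax_ge0.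
  by rewrite mxE cmodM ler_wpM2l ?cmod_ge0 ?bigmax_ge.
have [a0|a0] := eqVneq (cmod a) 0; first by rewrite a0 mul0r bigmax_ge0.
have {}a0 : 0 < cmod a by rewrite lt_def a0 cmod_ge0.
rewrite mulrC -ler_pdivlMr//; apply: bigmax_le => [|k].
  by rewrite divr_ge0 ?bigmax_ge0 ?cmod_ge0.
rewrite ler_pdivlMr// mulrC -cmodM; have := bigmax_ge (fun k => cmod ((a *: x) k 0)) k.
by rewrite mxE.
Qed.

Lemma pnormD n (x y : 'cV[C]_n) : pnorm p (x + y) <= pnorm p x + pnorm p y.
Proof.
case: pnorm_cases => [[r r1 ->]|->] /=.
  apply: le_trans (minkowski_sum r1 (fun k => cmod_ge0 _) (fun k => cmod_ge0 _)).
  have r0 : 0 < r by lra.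
  rewrite ge0_ler_powR ?nnegrE ?invr_ge0 ?(ltW r0)//.
  - by rewrite sumr_ge0// => k _; exact: powR_ge0.
  - by rewrite sumr_ge0// => k _; exact: powR_ge0.
  apply: ler_sum => k _; rewrite ge0_ler_powR ?nnegrE ?cmod_ge0 ?(ltW r0) ?addr_ge0 ?cmod_ge0//.
  by rewrite mxE cmodD.
apply: bigmax_le => [|k]; first by rewrite addr_ge0 ?bigmax_ge0.
rewrite mxE; apply: le_trans (cmodD _ _) _; apply: lerD.
  exact: (bigmax_ge (fun k => cmod (x k 0))).
exact: (bigmax_ge (fun k => cmod (y k 0))).
Qed.

Lemma pnorm0 n : pnorm p (0 : 'cV[C]_n) = 0.
Proof. by rewrite -(scale0r (0 : 'cV[C]_n)) pnormZ cmod0 mul0r. Qed.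

Lemma pnorm_entry n (x : 'cV[C]_n) k : cmod (x k 0) <= pnorm p x.
Proof.
case: pnorm_cases => [[r r1 ->]|->] /=; last exact: (bigmax_ge (fun k => cmod (x k 0))).
have r0 : 0 < r by lra.
rewrite -[leLHS](powRK r0 (cmod_ge0 _)) ge0_ler_powR ?nnegrE ?invr_ge0 ?(ltW r0) ?powR_ge0//.
  by rewrite sumr_ge0// => j _; exact: powR_ge0.
by rewrite (bigD1 k)//= lerDl sumr_ge0// => j _; exact: powR_ge0.
Qed.

Lemma cmod_delta n (k j : 'I_n) :
  cmod ((delta_mx k 0 : 'cV[C]_n) j 0) = (j == k)%:R.
Proof. by rewrite mxE andbT cmod_nat. Qed.

Lemma pnorm_delta n k : pnorm p (delta_mx k 0 : 'cV[C]_n) = 1.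
Proof.
case: pnorm_cases => [[r r1 ->]|->] /=.
  have r0 : 0 < r by lra.
  rewrite (bigD1 k)//= big1 => [|j jk].
    by rewrite cmod_delta eqxx powR1 addr0 powR1.
  by rewrite cmod_delta (negbTE jk) powR0 ?gt_eqF.
apply/eqP; rewrite eq_le; apply/andP; split.
  by apply: bigmax_le => // j; rewrite cmod_delta -[1%R]/(1%:R) ler_nat leq_b1.
apply: le_trans (bigmax_ge _ k).
by rewrite cmod_delta eqxx.
Qed.

Lemma pnorm_sum (I : Type) n (r : seq I) (P : pred I) (f : I -> 'cV[C]_n) :
  pnorm p (\sum_(i <- r | P i) f i) <= \sum_(i <- r | P i) pnorm p (f i).
Proof.
elim/big_ind2: _ => [|x a y b xa yb|//]; first by rewrite pnorm0.
by apply: le_trans (pnormD _ _) _; rewrite lerD.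
Qed.

Lemma pnorm_le_sum n (x : 'cV[C]_n) : pnorm p x <= \sum_i cmod (x i 0).
Proof.
have {1}-> : x = \sum_i x i 0 *: delta_mx i 0.
  rewrite [LHS]matrix_sum_delta; apply: eq_bigr => i _.
  by rewrite big_ord_recl big_ord0 addr0.
apply: le_trans (pnorm_sum _ _ _) _; apply: ler_sum => i _.
by rewrite pnormZ pnorm_delta mulr1.
Qed.

Lemma opnorm_has_ub m n (M : 'M[C]_(m, n)) :
  has_ubound [set pnorm p (M *m x) | x in [set x : 'cV[C]_n | pnorm p x = 1]].
Proof.
exists (\sum_i \sum_j cmod (M i j)) => _ [x /= x1 <-].
apply: le_trans (pnorm_le_sum _) _; apply: ler_sum => i _.
rewrite mxE; apply: le_trans (cmod_sum _ _ _) _; apply: ler_sum => j _.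
rewrite cmodM ler_piMr ?cmod_ge0// -x1; exact: pnorm_entry.
Qed.

Lemma opnorm_le m n (M : 'M[C]_(m, n)) (B : R) : 0 <= B ->
  (forall x, pnorm p x = 1 -> pnorm p (M *m x) <= B) -> opnorm p M <= B.
Proof.
move=> B0 MB; rewrite /opnorm; set S := [set _ | _ in _].
(* Without columns there is no vector of norm 1 and the supremum is 0, which is below [B] since [B]
   is nonnegative. *)
have [->|S0] := eqVneq S set0; first by rewrite sup0.
apply: ge_sup; first exact/set0P.
by move=> _ [x /= x1 <-]; exact: MB.
Qed.

Lemma opnorm_ge m n (M : 'M[C]_(m, n)) x : pnorm p x = 1 ->
  pnorm p (M *m x) <= opnorm p M.
Proof. by move=> x1; apply: ub_le_sup; [exact: opnorm_has_ub|exists x]. Qed.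

Lemma opnorm_entry m n (M : 'M[C]_(m, n)) i j : cmod (M i j) <= opnorm p M.
Proof.
apply: le_trans (opnorm_ge M (pnorm_delta j)).
apply: le_trans (pnorm_entry _ i); rewrite mxE (bigD1 j)//= big1 => [|k kj].
  by rewrite mxE !eqxx mulr1 addr0.
by rewrite mxE (negbTE kj) mulr0.
Qed.

End PNorm.

(** [g] generates the ideal [J] of [w] and all [p i], and is built from successive gcds. The
    quotients are jointly coprime, which will separate poles of the matrix from removable
    singularities. *)
Lemma common_divisor (F : fieldType) (I : finType) (p : I -> {poly F}) (w : {poly F}) :
  w != 0 -> exists (g w' b : {poly F}) (p' a : I -> {poly F}),
    [/\ g != 0, w = g * w', forall i, p i = g * p' i &
        b * w' + \sum_i a i * p' i = 1].
Proof.
move=> w0.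
pose J q := exists (b : {poly F}) (a : I -> {poly F}), q = b * w + \sum_i a i * p i.
have JM u q : J q -> J (u * q).
  move=> [b [a ->]]; exists (u * b), (fun i => u * a i).
  rewrite mulrDr mulrA mulr_sumr; congr (_ + _).
  by apply: eq_bigr => i _; rewrite mulrA.
have JD q q' : J q -> J q' -> J (q + q').
  move=> [b [a ->]] [b' [a' ->]]; exists (b + b'), (fun i => a i + a' i).
  rewrite mulrDl addrACA -big_split; congr (_ + _).
  by apply: eq_bigr => i _; rewrite mulrDl.
have Jp i : J (p i).
  exists 0, (fun j => (j == i)%:R); rewrite mul0r add0r (bigD1 i)//= eqxx mul1r.
  by rewrite big1 ?addr0// => j /negbTE ->; rewrite mul0r.
have Jw : J w.
  by exists 1, (fun=> 0); rewrite mul1r big1 ?addr0// => i _; rewrite mul0r.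
have [g [Jg g0 gw gp]] : exists g, [/\ J g, g != 0, g %| w &
    forall i, i \in enum I -> g %| p i].
  elim: (enum I) => [|i0 s [g [Jg g0 gw gp]]]; first by exists w.
  have [[u v] /= uv] := Bezoutp g (p i0).
  have d0 : gcdp g (p i0) != 0 by rewrite gcdp_eq0 negb_and g0.
  exists (u * g + v * p i0); split.
  - by apply: JD; apply: JM.
  - by apply: contraNneq d0 => E0; move: uv; rewrite E0 eqp_sym eqp0.
  - by rewrite (eqp_dvdl _ uv) (dvdp_trans (dvdp_gcdl _ _)).
  - move=> i; rewrite inE => /orP[/eqP ->|/gp].
      by rewrite (eqp_dvdl _ uv) dvdp_gcdr.
    by rewrite (eqp_dvdl _ uv); apply: dvdp_trans; exact: dvdp_gcdl.
have [b [a gE]] := Jg.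
exists g, (w %/ g), b, (fun i => p i %/ g), a; split=> //.
- by rewrite mulrC divpK.
- by move=> i; rewrite mulrC divpK// gp// mem_enum.
apply: (mulfI g0); rewrite mulr1 [RHS]gE mulrDr mulrCA [g * _]mulrC divpK//.
congr (_ + _); rewrite mulr_sumr; apply: eq_bigr => i _.
by rewrite mulrCA [g * _]mulrC divpK// gp// mem_enum.
Qed.

(** * The transfer function over a reduced common denominator *)

Section RationalValues.
Variable R : realType.
Local Notation C := R[i].

Lemma tofrac_div_eq (u w u' w' : {poly C}) : w != 0 -> w' != 0 ->
  tofrac u / tofrac w = tofrac u' / tofrac w' -> u * w' = u' * w.
Proof.
move=> w0 w0' /eqP; rewrite eqr_div ?tofrac_eq0// -!tofracM tofrac_eq.
by move/eqP.
Qed.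

Lemma horner_neq0 (w : {poly C}) s : w.[s] != 0 -> w != 0.
Proof. by apply: contra_neq => ->; rewrite horner0. Qed.

Lemma ratval_uniq (u w : {poly C}) s v : w.[s] != 0 ->
  ratval (tofrac u / tofrac w) s v <-> v = u.[s] / w.[s].
Proof.
move=> ws; split=> [[u' [w' [ws' E ->]]]|->]; last by exists u, w.
have := tofrac_div_eq (horner_neq0 ws) (horner_neq0 ws') E.
move=> /(congr1 (horner^~ s)); rewrite !hornerM => h.
by apply/eqP; rewrite eqr_div// -h mulrC.
Qed.

Lemma ratval_pole (u w : {poly C}) s v : w != 0 -> w.[s] = 0 -> u.[s] != 0 ->
  ~ ratval (tofrac u / tofrac w) s v.
Proof.
move=> w0 ws us [u' [w' [ws' E _]]].
have := tofrac_div_eq w0 (horner_neq0 ws') E.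
move=> /(congr1 (horner^~ s)); rewrite !hornerM ws mulr0 => /eqP.
by rewrite mulf_eq0 (negbTE us) (negbTE ws').
Qed.

Variables (p : \bar R) (eps : R) (N P Q : nat).
Hypothesis p1 : (1 <= p)%E.
Hypothesis eps0 : 0 < eps.
Variables (A : 'M[C]_N) (B : 'M[C]_(N, P)) (L : 'M[C]_(Q, N)).

Definition adjugate_transfer : 'M[{poly C}]_(Q, P) :=
  map_mx polyC L *m \adj (char_poly_mx A) *m map_mx polyC B.

Lemma char_poly_neq0 : char_poly A != 0.
Proof. exact: monic_neq0 (char_poly_monic A). Qed.

(** Cramer's rule over the field of rational functions. *)
Lemma transferE i j : transfer A B L i j =
  tofrac (adjugate_transfer i j) / tofrac (char_poly A).
Proof.
have E : (tofrac 'X)%:M - ratmx A = map_mx (@tofrac _) (char_poly_mx A).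
  by rewrite /char_poly_mx map_mxB map_scalar_mx /ratmx map_mx_comp.
have detE : \det (map_mx (@tofrac _) (char_poly_mx A)) = tofrac (char_poly A).
  by rewrite det_map_mx.
have w0 : tofrac (char_poly A) != 0 by rewrite tofrac_eq0; exact: char_poly_neq0.
rewrite /transfer E /ratmx [map_mx (_ \o _) L]map_mx_comp [map_mx (_ \o _) B]map_mx_comp.
have -> : invmx (map_mx (@tofrac _) (char_poly_mx A)) =
    (tofrac (char_poly A))^-1 *: map_mx (@tofrac _) (\adj (char_poly_mx A)).
  by rewrite /invmx unitmxE unitfE detE w0 map_mx_adj.
by rewrite -scalemxAr -scalemxAl mxE -!map_mxM mulrC [X in X * _]mxE.
Qed.

Lemma horner_char_poly_mx s : map_mx (horner_eval s) (char_poly_mx A) = s%:M - A.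
Proof.
apply/matrixP => i j; rewrite !mxE /= horner_evalE hornerD hornerN hornerC.
by rewrite hornerMn hornerX.
Qed.

Lemma horner_char_poly s : (char_poly A).[s] = \det (s%:M - A).
Proof. by rewrite -horner_char_poly_mx det_map_mx. Qed.

Lemma horner_adjugate_transfer s i j : s%:M - A \in unitmx ->
  (adjugate_transfer i j).[s] / (char_poly A).[s] =
  (L *m invmx (s%:M - A) *m B) i j.
Proof.
move=> us.
have CK m n (M : 'M[C]_(m, n)) : map_mx (horner_eval s) (map_mx polyC M) = M.
  by apply/matrixP => k l; rewrite !mxE /= horner_evalE hornerC.
have -> : (adjugate_transfer i j).[s] = (L *m \adj (s%:M - A) *m B) i j.
  rewrite -[LHS]/(horner_eval s _); transitivity (map_mx (horner_eval s) adjugate_transfer i j).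
    by rewrite [RHS]mxE.
  by rewrite /adjugate_transfer !map_mxM !CK map_mx_adj horner_char_poly_mx.
by rewrite /invmx us -scalemxAr -scalemxAl [RHS]mxE horner_char_poly mulrC.
Qed.

(** One denominator for all entries, coprime to the numerators taken together though not to each of
    them. *)
Lemma reduced_transfer : exists (w : {poly C}) (u : 'M[{poly C}]_(Q, P))
    (b : {poly C}) (a : 'I_Q * 'I_P -> {poly C}),
  [/\ w != 0, forall i j, transfer A B L i j = tofrac (u i j) / tofrac w,
      b * w + \sum_k a k * u k.1 k.2 = 1,
      forall s, s%:M - A \in unitmx -> w.[s] != 0 &
      forall s i j, s%:M - A \in unitmx ->
        (u i j).[s] / w.[s] = (L *m invmx (s%:M - A) *m B) i j].
Proof.
have w0 := char_poly_neq0.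
have [g [w [b [u [a [g0 wE uE bez]]]]]] :=
  common_divisor (fun k : 'I_Q * 'I_P => adjugate_transfer k.1 k.2) w0.
have uE' i j : adjugate_transfer i j = g * u (i, j) := uE (i, j).
have gw s : s%:M - A \in unitmx -> g.[s] * w.[s] != 0.
  by move=> us; rewrite -hornerM -wE horner_char_poly -unitfE -unitmxE.
exists w, (\matrix_(i, j) u (i, j)), b, a; split.
- by apply: contraNneq w0 => w00; rewrite wE w00 mulr0.
- move=> i j; rewrite transferE (uE' i j) [in RHS]mxE wE !tofracM -mulf_div divff ?mul1r//.
  by rewrite tofrac_eq0.
- by rewrite -[RHS]bez; congr (_ + _); apply: eq_bigr => -[i j] _; rewrite mxE.
- by move=> s /gw; rewrite mulf_eq0 negb_or => /andP[].
move=> s i j us; rewrite -horner_adjugate_transfer// (uE' i j) mxE wE !hornerM.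
have := gw s us; rewrite mulf_eq0 negb_or => /andP[gs _].
by rewrite -mulf_div divff// mul1r.
Qed.

Section Reduced.
Variables (w : {poly C}) (u : 'M[{poly C}]_(Q, P)) (b : {poly C})
  (a : 'I_Q * 'I_P -> {poly C}).
Hypothesis w0 : w != 0.
Hypothesis transfer_uw : forall i j, transfer A B L i j = tofrac (u i j) / tofrac w.
Hypothesis bezout : b * w + \sum_k a k * u k.1 k.2 = 1.

Lemma horner_bezout s : b.[s] * w.[s] + \sum_k (a k).[s] * (u k.1 k.2).[s] = 1.
Proof.
have := congr1 (horner^~ s) bezout; rewrite hornerD hornerM horner_sum hornerC => <-.
congr (_ + _).
by apply: eq_bigr => k _; rewrite hornerM.
Qed.

Lemma transfer_norm_regular s : w.[s] != 0 ->
  transfer_norm p A B L s = (opnorm p (\matrix_(i, j) ((u i j).[s] / w.[s])))%:E.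
Proof.
move=> ws; rewrite /transfer_norm asboolT; last first.
  by move=> i j; exists ((u i j).[s] / w.[s]); rewrite transfer_uw ratval_uniq.
congr (opnorm p _)%:E; apply/matrixP => i j; rewrite [LHS]mxE [RHS]mxE.
rewrite transfer_uw; apply: xget_unique => [|v /=]; first exact/ratval_uniq.
by move/ratval_uniq => ->.
Qed.

(** If all entries were regular at a zero of [w], all numerators would vanish there, against the
    Bezout identity. *)
Lemma transfer_norm_pole s : w.[s] = 0 -> transfer_norm p A B L s = +oo%E.
Proof.
move=> ws; rewrite /transfer_norm asboolF// => reg.
have := horner_bezout s; rewrite ws mulr0 add0r.
apply/eqP; rewrite big1 ?(eq_sym 0) ?oner_eq0// => k _.
have [->|uk] := eqVneq (u k.1 k.2).[s] 0; first by rewrite mulr0.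
have [v] := reg k.1 k.2; rewrite transfer_uw => /ratval_pole; case=> //.
Qed.

Lemma outside_pseudospectrum s : ~ io_pseudospectrum p eps A B L s ->
  w.[s] != 0 /\ opnorm p (\matrix_(i, j) ((u i j).[s] / w.[s])) <= eps^-1.
Proof.
rewrite /io_pseudospectrum/= => /negP; rewrite -leNgt.
have [ws|ws] := eqVneq w.[s] 0; first by rewrite transfer_norm_pole.
by rewrite transfer_norm_regular// lee_fin.
Qed.

(* Off the pseudospectrum the numerators are at most eps^-1 |w|, so the Bezout
   identity forces w to be large. *)
Lemma denominator_bound (r : R) : exists2 mu : R, 0 < mu &
  forall s, cmod s <= r -> ~ io_pseudospectrum p eps A B L s -> mu <= cmod w.[s].
Proof.
have bnd (q : {poly C}) : exists2 M : R, 0 <= M & forall s, cmod s <= r -> cmod q.[s] <= M.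
  have [f' [M [M0 h _ _ _]]] := @has_taylor2_poly R [set z | cmod z <= r] r q (fun z h => h).
  by exists M.
have [Mb Mb0 hb] := bnd b.
have /choice[Ma hMa] : forall k, exists M : R,
    0 <= M /\ forall s, cmod s <= r -> cmod (a k).[s] <= M.
  by move=> k; have [M M0 h] := bnd (a k); exists M.
have e0 : 0 <= eps^-1 by rewrite invr_ge0 ltW.
pose S := Mb + \sum_k Ma k * eps^-1.
have S0 : 0 <= S.
  by rewrite addr_ge0// sumr_ge0// => k _; rewrite mulr_ge0//; case: (hMa k).
exists (S + 1)^-1; first by rewrite invr_gt0; lra.
move=> s sr /outside_pseudospectrum[ws Gs].
have uk k : cmod (u k.1 k.2).[s] <= eps^-1 * cmod w.[s].
  have := le_trans (opnorm_entry p1 (\matrix_(i, j) ((u i j).[s] / w.[s])) k.1 k.2) Gs.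
  by rewrite mxE cmodM cmodV ler_pdivrMr// cmod_gt0.
have : 1 <= S * cmod w.[s].
  have <- : cmod (1 : C) = 1 by exact: ComplexField.Normc.normc1.
  rewrite -(horner_bezout s); apply: le_trans (cmodD _ _) _.
  rewrite /S mulrDl mulr_suml cmodM lerD//.
    by rewrite ler_wpM2r ?cmod_ge0 ?hb.
  apply: le_trans (cmod_sum _ _ _) _; apply: ler_sum => k _.
  by rewrite cmodM -mulrA ler_pM ?cmod_ge0//; case: (hMa k) => _; apply.
have ws0 : 0 < cmod w.[s] by rewrite cmod_gt0.
rewrite -[_^-1]mul1r ler_pdivrMr; lra.
Qed.

End Reduced.

Lemma opnorm_le_l1norm m n (M : 'M[C]_(m, n)) : opnorm p M <= l1norm M.
Proof.
apply: opnorm_le; first exact: l1norm_ge0.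
move=> x x1; apply: le_trans (pnorm_le_sum p1 _) _; apply: ler_sum => i _.
rewrite mxE; apply: le_trans (cmod_sum _ _ _) _; apply: ler_sum => j _.
rewrite cmodM ler_piMr ?cmod_ge0// -x1; exact: pnorm_entry.
Qed.

(** Far out the transfer norm is at most [k / (cmod s - l1norm A)], which is below [eps^-1] beyond
    [l1norm A + k * eps]. *)
Lemma pseudospectrum_bounded : exists2 r : R, 0 <= r &
  forall s, io_pseudospectrum p eps A B L s -> cmod s <= r.
Proof.
have [w [u [b [a [w0 tE bez wreg uE]]]]] := reduced_transfer.
pose k := l1norm L * l1norm B.
have k0 : 0 <= k by rewrite mulr_ge0 ?l1norm_ge0.
have a0 := l1norm_ge0 A.
exists (l1norm A + k * eps + 1).
  by have := mulr_ge0 k0 (ltW eps0); lra.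
move=> s; rewrite /io_pseudospectrum/=; apply: contraPT; rewrite -ltNge => sr.
have ke : 0 <= k * eps := mulr_ge0 k0 (ltW eps0).
have As : l1norm A < cmod s by lra.
have us := resolvent_unit As.
rewrite (transfer_norm_regular tE) ?wreg// lte_fin; apply/negP; rewrite -leNgt.
have -> : \matrix_(i, j) ((u i j).[s] / w.[s]) = L *m (invmx (s%:M - A) *m B).
  by apply/matrixP => i j; rewrite mxE uE// mulmxA.
apply: le_trans (opnorm_le_l1norm _) _; apply: le_trans (l1norm_mulmx _ _) _.
apply: le_trans (ler_wpM2l (l1norm_ge0 _) (resolvent_bound _ As)) _.
rewrite mulrA ler_pdivrMr ?subr_gt0// -[leLHS]/k.
rewrite -ler_pdivrMl ?invr_gt0// invrK; lra.
Qed.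

End RationalValues.

(** * Approximation of the matrix exponential *)

Section CompoundReal.
Variable R : realType.

Lemma ffact_le_exp m k : (m ^_ k <= m ^ k)%N.
Proof.
elim: k m => [|k IH] [|m]; rewrite ?ffactn0 ?expn0 ?ffact0n//.
rewrite ffactSS expnS leq_mul2l/=; apply: leq_trans (IH m) _.
by case: k {IH} => // k; rewrite leq_exp2r.
Qed.

Lemma partial_exp_le (x : R) n : 0 <= x -> \sum_(k < n) x ^+ k / k`!%:R <= expR x.
Proof.
move=> x0; rewrite /expR -(big_mkord xpredT (fun k => x ^+ k / k`!%:R)).
apply: (nondecreasing_cvgn_le (u_ := series (exp_coeff x))).
  by apply: nondecreasing_series => *; exact: exp_coeff_ge0.
exact: is_cvg_series_exp_coeff.
Qed.

(* From exp (-u) >= 1 - u at u = y / (1 + y) one gets 1 + y >= exp (y / (1 + y)). *)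
Lemma compound_ge (x : R) m : 0 <= x -> (0 < m)%N ->
  expR x - (1 + x / m%:R) ^+ m <= expR x * x ^+ 2 / m%:R.
Proof.
move=> x0 m0; have mR : 0 < m%:R :> R by rewrite ltr0n.
set y := x / m%:R; have y0 : 0 <= y by rewrite divr_ge0// ltW.
have y1 : 0 < 1 + y by lra.
pose u := y / (1 + y).
have h1 : expR u <= 1 + y.
  have := expR_ge1Dx (- u); rewrite expRN.
  have -> : 1 + - u = (1 + y)^-1 by rewrite /u; field; rewrite gt_eqF.
  by rewrite lef_pV2 ?posrE ?expR_gt0.
have h2 : expR (m%:R * u) <= (1 + y) ^+ m.
  by rewrite expRM_natl lerXn2r ?nnegrE ?expR_ge0// ltW.
pose z := x - m%:R * u.
have zE : z = x ^+ 2 / m%:R / (1 + y).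
  have ym : m%:R * y = x by rewrite /y mulrC divfK// gt_eqF.
  rewrite /z /u -{1}ym; have -> : x ^+ 2 / m%:R = x * y by rewrite expr2 mulrA.
  by rewrite -ym; field; rewrite gt_eqF.
have xm0 : 0 <= x ^+ 2 / m%:R by rewrite divr_ge0 ?sqr_ge0// ltW.
have zle : z <= x ^+ 2 / m%:R.
  by rewrite zE ler_pdivrMr// ler_peMr//; lra.
have h3 : expR (m%:R * u) = expR x * expR (- z).
  by rewrite -expRD /z; congr expR; ring.
have h4 : 1 - z <= expR (- z) by exact: expR_ge1Dx.
have := ler_wpM2l (expR_ge0 x) h4; rewrite -h3.
have := ler_wpM2l (expR_ge0 x) zle.
by rewrite -mulrA; lra.
Qed.

End CompoundReal.

Section CompoundMatrix.
Variable R : realType.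
Local Notation C := R[i].
Local Notation K := (R[i] : numFieldType).
Variables (N : nat) (X : 'M[C]_N).

Let x := l1norm X.
(** The entry-sum norm of the identity is not 1 in general, so the zeroth power costs this
    factor. *)
Let N1 : R := l1norm (1%:M : 'M[C]_N).

Lemma l1norm_exp k : l1norm (X ^+ k) <= N1 * x ^+ k.
Proof.
elim: k => [|k IH]; first by rewrite !expr0 mulr1.
rewrite exprS; apply: le_trans (l1norm_mulmx _ _) _.
rewrite exprS mulrCA; apply: ler_wpM2l IH; exact: l1norm_ge0.
Qed.

Lemma l1norm_sum (I : Type) m n (r : seq I) (Q : pred I) (F : I -> 'M[C]_(m, n)) :
  l1norm (\sum_(i <- r | Q i) F i) <= \sum_(i <- r | Q i) l1norm (F i).
Proof.
elim/big_ind2: _ => [|a b c d ab cd|//].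
  by rewrite /l1norm big1// => i _; rewrite big1// => j _; rewrite mxE cmod0.
by apply: le_trans (l1normD _ _) _; rewrite lerD.
Qed.

Lemma scalemx_exp (a : C) k : (a *: X) ^+ k = a ^+ k *: X ^+ k.
Proof.
elim: k => [|k IH]; first by rewrite !expr0 scale1r.
rewrite !exprS IH -[LHS]/((a *: X) *m (a ^+ k *: X ^+ k)) -scalemxAl -scalemxAr.
by rewrite scalerA.
Qed.

(** The coefficients [1 / k! - c k] are nonnegative, so the matrix difference is dominated by the
    same difference at the scalar [x], to which [compound_ge] applies. *)
Lemma compound_sub_partial m : (0 < m)%N ->
  l1norm ((1%:M + m%:R^-1 *: X) ^+ m - \sum_(k < m.+1) (k`!%:R)^-1 *: X ^+ k) <=
  N1 * (expR x * x ^+ 2 / m%:R).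
Proof.
move=> m0; have mR : 0 < m%:R :> R by rewrite ltr0n.
have mC : m%:R != 0 :> C by rewrite pnatr_eq0 -lt0n.
pose c k : R := 'C(m, k)%:R / m%:R ^+ k.
have bin : (1%:M + m%:R^-1 *: X) ^+ m = \sum_(k < m.+1) (c k)%:C *: X ^+ k.
  rewrite (@exprDn_comm _ (1%:M : 'M[C]_N)); last exact: commr_sym (commr1 _).
  apply: eq_bigr => k _; rewrite -[1%:M]/(1 : 'M[C]_N) expr1n mul1r.
  rewrite scalemx_exp -scaler_nat scalerA /c realcM realcV realc_nat; congr (_ *: _).
  have -> : (m%:R ^+ k)%:C = m%:R ^+ k :> C.
    by rewrite -[LHS]/(real_complex R _) rmorphXn/= rmorph_nat.
  by rewrite exprVn.
have x0 : 0 <= x by exact: l1norm_ge0.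
have cle k : 0 <= (k`!%:R)^-1 - c k.
  rewrite subr_ge0 /c ler_pdivrMr ?exprn_gt0// mulrC.
  rewrite ler_pdivlMr ?ltr0n ?fact_gt0// -natrM bin_ffact -natrX ler_nat.
  exact: ffact_le_exp.
rewrite bin -sumrB; apply: le_trans (l1norm_sum _ _ _) _.
apply: (@le_trans _ _ (\sum_(k < m.+1) N1 * (x ^+ k / k`!%:R - c k * x ^+ k))).
  apply: ler_sum => k _.
  have -> : (c k)%:C *: X ^+ k - (k`!%:R)^-1 *: X ^+ k =
     (- ((k`!%:R)^-1 - c k))%:C *: X ^+ k.
    by rewrite -scalerBl !realcE; congr (_ *: _); ring.
  rewrite l1normZ cmodR normrN ger0_norm//.
  have -> : N1 * (x ^+ k / k`!%:R - c k * x ^+ k) = (k`!%:R^-1 - c k) * (N1 * x ^+ k).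
    by ring.
  by apply: ler_wpM2l => //; exact: l1norm_exp.
rewrite -mulr_sumr; apply: ler_wpM2l; first exact: l1norm_ge0.
rewrite sumrB; have -> : \sum_(k < m.+1) c k * x ^+ k = (1 + x / m%:R) ^+ m.
  rewrite exprDn; apply: eq_bigr => k _.
  by rewrite expr1n mul1r expr_div_n -mulr_natl /c; ring.
apply: le_trans (compound_ge x0 m0).
by rewrite lerD2r partial_exp_le.
Qed.

Definition expmx_partial n : 'M[C]_N := \sum_(k < n) (k`!%:R)^-1 *: X ^+ k.

(** [pi] will be the real or the imaginary part, which reduces convergence to absolutely convergent
    real series. *)
Lemma cvg_entry_series (pi : C -> R) i j :
  (forall a b : C, pi (a + b) = pi a + pi b) -> pi 0 = 0 ->
  (forall a : C, `|pi a| <= cmod a) ->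
  exists l : R, forall e : R, 0 < e ->
    \forall n \near \oo, `|l - pi (expmx_partial n i j)| < e.
Proof.
move=> piD pi0 pile.
pose u k := pi (((k`!%:R)^-1 *: X ^+ k) i j).
have uE n : pi (expmx_partial n i j) = series u n.
  rewrite /series/= big_mkord /expmx_partial summxE.
  by elim/big_ind2: _ => // a b c d <- <-.
have cu : cvgn (series u).
  apply: normed_cvg; apply: (@series_le_cvg _ _ (N1 *: exp_coeff x)).
  - by move=> k; exact: normr_ge0.
  - move=> k; apply: mulr_ge0; first exact: l1norm_ge0.
    by apply: exp_coeff_ge0; exact: l1norm_ge0.
  - move=> k; apply: le_trans (pile _) _; rewrite mxE cmodM cmodV cmod_nat mulrC.
    rewrite -[leRHS]/(N1 * (x ^+ k / k`!%:R)) mulrA ler_wpM2r ?invr_ge0//.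
    by apply: le_trans (entry_le_l1norm _ _ _) (l1norm_exp k).
  by apply: is_cvg_seriesZ; exact: is_cvg_series_exp_coeff.
exists (limn (series u)) => e e0.
have /cvgrPdist_lt/(_ e e0) := cu.
by apply: filterS => n; rewrite uE.
Qed.

Lemma cvg_expmx_partial : exists E : 'M[C]_N, forall e : R, 0 < e ->
  \forall n \near \oo, forall i j, cmod (E i j - expmx_partial n i j) < e.
Proof.
have ReD (a b : C) : complex.Re (a + b) = complex.Re a + complex.Re b.
  by case: a b => [a a'] [b b'].
have ImD (a b : C) : complex.Im (a + b) = complex.Im a + complex.Im b.
  by case: a b => [a a'] [b b'].
have /choice[l hl] : forall ij : 'I_N * 'I_N, exists l : C, forall e : R, 0 < e ->
    \forall n \near \oo, cmod (l - expmx_partial n ij.1 ij.2) < e.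
  move=> [i j] /=.
  have [lr hr] := cvg_entry_series i j ReD erefl (@cmod_Re R).
  have [li hi] := cvg_entry_series i j ImD erefl (@cmod_Im R).
  exists (lr +i* li) => e e0; have e2 : 0 < e / 2 by rewrite divr_gt0.
  near=> n; apply: le_lt_trans (cmod_ReIm _) _.
  have h1 : `|lr - complex.Re (expmx_partial n i j)| < e / 2 by near: n; exact: hr.
  have h2 : `|li - complex.Im (expmx_partial n i j)| < e / 2 by near: n; exact: hi.
  by case: (expmx_partial n i j) h1 h2 => a b /=; lra.
exists (\matrix_(i, j) l (i, j)) => e e0.
apply: filter_forall => i; apply: filter_forall => j.
by apply: filterS (hl (i, j) e e0) => n; rewrite mxE.
Unshelve. all: by end_near. Qed.

(** [expmx] is a [lim], so a limit must be exhibited in the topology of matrices over [R[i]] before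
    the value can be approximated. *)
Lemma expmx_partial_cvg (e : R) : 0 < e ->
  \forall n \near \oo, forall i j, cmod (expmx X i j - expmx_partial n i j) < e.
Proof.
move=> e0; have [E hE] := cvg_expmx_partial.
pose F : nat -> 'M[K]_N := series (fun k => (k`!%:R)^-1 *: X ^+ k).
have FE n : F n = expmx_partial n by rewrite /F /series/= big_mkord.
have cF : cvg (F @ \oo).
  apply/cvg_ex; exists E => B /nbhs_ballP[r /= /gt0_realc[r' r0 ->] EB].
  apply: filterS (hE r' r0) => n h; apply: EB; split; first by rewrite ltcR.
  by move=> i j; rewrite -ball_normE/= normE ltcR FE.
have : nbhs (lim (F @ \oo)) (ball (lim (F @ \oo)) e%:C).
  by apply: nbhsx_ballx; rewrite ltcR.
move=> /cF hB; apply: (@filterS _ \oo _ (F @^-1` ball (lim (F @ \oo)) e%:C) _ _ hB).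
move=> n -[_ h] i j.
by have := h i j; rewrite -ball_normE/= normE ltcR FE.
Qed.

Lemma expmx_compound (e : R) : 0 < e -> exists m0, forall m, (m0 <= m)%N ->
  l1norm ((1%:M + m%:R^-1 *: X) ^+ m - expmx X) <= e.
Proof.
move=> e0.
pose k := N1 * (expR x * x ^+ 2).
have e1 : 0 < e / 2 / (N%:R * N%:R + 1) :> R.
  by rewrite !divr_gt0// ltr_wpDl// mulr_ge0.
have [n0 _ hn0] := expmx_partial_cvg e1.
have k0 : 0 <= k by rewrite !mulr_ge0 ?l1norm_ge0 ?expR_ge0.
exists (n0 + (Num.truncn (k / (e / 2))).+1)%N => m mge.
have m0 : (0 < m)%N by apply: leq_trans mge; rewrite addnS.
have mR : 0 < m%:R :> R by rewrite ltr0n.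
have -> : (1%:M + m%:R^-1 *: X) ^+ m - expmx X =
   ((1%:M + m%:R^-1 *: X) ^+ m - expmx_partial m.+1) + (expmx_partial m.+1 - expmx X).
  by rewrite addrA subrK.
apply: le_trans (l1normD _ _) _; rewrite [leRHS](splitr e); apply: lerD.
  apply: le_trans (compound_sub_partial m0) _.
  rewrite mulrA -/k ler_pdivrMr// mulrC -ler_pdivrMr ?divr_gt0//.
  apply: le_trans (ltW (truncnS_gt _)) _; rewrite ler_nat.
  by apply: leq_trans mge; rewrite leq_addl.
apply: (@le_trans _ _ (\sum_(i < N) \sum_(j < N) e / 2 / (N%:R * N%:R + 1))).
  apply: ler_sum => i _; apply: ler_sum => j _; rewrite !mxE -opprB cmodN.
  apply/ltW/hn0 => /=; apply: leq_trans (leq_addr _ _) (leq_trans mge _).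
  exact: leqnSn.
rewrite !sumr_const !card_ord -mulrnA -[leLHS]mulr_natr natrM mulrAC ler_pdivrMr.
  by rewrite ler_wpM2l ?divr_ge0 ?(ltW e0)// lerDl.
by rewrite ltr_wpDl// mulr_ge0.
Qed.

End CompoundMatrix.

(** * The bound *)

Section PseudospectralBound.
Variable R : realType.
Local Notation C := R[i].

(** The square of [|1 + h s|] is [1 + 2 h Re s + h^2 |s|^2], and [1 + x] is at most [expR x]. *)
Lemma power_modulus_bound (s : C) (t : R) m : (0 < m)%N ->
  cmod ((1 + t%:C / m%:R * s) ^+ m) <=
  expR (t * complex.Re s + t ^+ 2 * cmod s ^+ 2 / (2 * m%:R)).
Proof.
move=> m0; have mR : 0 < m%:R :> R by rewrite ltr0n.
pose h := t / m%:R.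
have -> : t%:C / m%:R = h%:C :> C by rewrite /h !realcE.
have sq (z : C) : cmod z ^+ 2 = complex.Re z ^+ 2 + complex.Im z ^+ 2.
  by case: z => x y /=; rewrite sqr_sqrtr// addr_ge0 ?sqr_ge0.
pose y := h * complex.Re s + h ^+ 2 * cmod s ^+ 2 / 2.
have le1 : cmod (1 + h%:C * s) <= expR y.
  rewrite -(@ler_pXn2r _ 2) ?nnegrE ?cmod_ge0 ?expR_ge0// -expRM_natl.
  apply: le_trans (expR_ge1Dx _); rewrite /y !sq.
  by case: (s) => a b /=; lra.
rewrite cmodX; have -> : t * complex.Re s + t ^+ 2 * cmod s ^+ 2 / (2 * m%:R) = m%:R * y.
  by rewrite /y /h; field; rewrite gt_eqF.
by rewrite expRM_natl lerXn2r ?nnegrE ?cmod_ge0 ?expR_ge0.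
Qed.

Variables (p : \bar R) (eps : R) (N P Q : nat).
Hypothesis p1 : (1 <= p)%E.
Hypothesis eps0 : 0 < eps.
Variables (A : 'M[C]_N) (B : 'M[C]_(N, P)) (L : 'M[C]_(Q, N)).
Local Notation sigma := (io_pseudospectrum p eps A B L).

(** The bound of [power_modulus_bound] at points within [m%:R^-1] of [W], where
    [Re s <= a + m%:R^-1] and [cmod s <= 2 * r + 1]. It tends to [expR (t * a)] as [m] grows. *)
Definition growth (r a t : R) m : R :=
  expR (t * (a + m%:R^-1) + t ^+ 2 * (2 * r + 1) ^+ 2 / (2 * m%:R)).

Lemma contour_estimate (W : set C) (r a l t : R) m (x : 'cV[C]_P) :
  sigma `<=` W -> 0 <= r ->
  (forall w, W w -> `|complex.Re w| <= r /\ `|complex.Im w| <= r) ->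
  (forall w, W w -> complex.Re w <= a) ->
  0 <= l -> (arc_length (boundary W) <= l%:E)%E -> 0 <= t ->
  (0 < m)%N -> pnorm p x = 1 ->
  2 * pi * pnorm p (L *m ((1%:M + (t%:C / m%:R) *: A) ^+ m *m (B *m x))) <=
  growth r a t m * eps^-1 * l.
Proof.
move=> sigmaW r0 Wr Wa l0 Wl t0 m0 x1; have mR : 0 < m%:R :> R by rewrite ltr0n.
set tau := t%:C / m%:R; set M := growth r a t m * eps^-1.
have M0 : 0 <= M by rewrite mulr_ge0 ?expR_ge0// invr_ge0 ltW.
apply/ler_addgt0Pr => e e0.
have [w [u [b [c [w0 tE bez wreg uE]]]]] := reduced_transfer A B L.
pose e1 := e / (Q%:R + 1); have e10 : 0 < e1 by rewrite divr_gt0// ltr_wpDl.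
have /choice[H0 hH0] := fun i => outer_contour A L (B *m x) tau m i e10.
have [aA aA0 aAE] : exists2 aA : R, 0 <= aA & l1norm A = aA.
  by exists (l1norm A) => //; exact: l1norm_ge0.
have [h1 h10 hh1] : exists2 h1 : R, 0 <= h1 & forall i, H0 i <= h1.
  exists (\sum_i `|H0 i|) => [|i]; first by rewrite sumr_ge0.
  by rewrite (bigD1 i)//= ler_wpDr ?ler_norm// sumr_ge0.
have [H [h1H Hr HA]] : exists H : R, [/\ h1 <= H, r + 1 <= H & aA + 1 < H].
  by exists (h1 + r + aA + 2); split; lra.
have HH i : H0 i <= H := le_trans (hh1 i) h1H.
have H_gt0 : 0 < H by lra.
have [mu mu0 hmu] := denominator_bound p1 eps0 w0 tE bez (2 * (H + 1)).
pose rD := 2 * (H + 1) + 1.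
have [f' [Mw [Mw0 _ _ hMw _]]] :=
  @has_taylor2_poly R [set z | cmod z <= rD] rD w (fun z h => h).
(* Mixed cells may enter the pseudospectrum, where [w] can vanish; [D] retains half of the lower
   bound [mu] valid outside. *)
pose D := [set z : C | cmod z <= rD /\ mu / 2 <= cmod w.[z]].
(* The first term serves [growth]; the second limits the variation of [w] to [mu / 2]. *)
pose rho := Num.min m%:R^-1 (mu / 2 / (Mw + 1)).
have rho0 : 0 < rho.
  by rewrite lt_min invr_gt0 mR/= !divr_gt0// ltr_wpDl.
have rho_m : rho <= m%:R^-1 by rewrite ge_min lexx.
have rho_1 : rho <= 1.
  by apply: le_trans rho_m _; rewrite invf_le1// -[1%R]/(1%:R) ler_nat.
have rho_mu : Mw * rho <= mu / 2.
  have : rho <= mu / 2 / (Mw + 1) by rewrite ge_min lexx orbT.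
  by rewrite ler_pdivlMr ?ltr_wpDl//; lra.
(* The reduced form of the integrand remains regular at eigenvalues of [A] that are removable
   singularities and may lie outside the pseudospectrum. *)
pose F (i : 'I_Q) (s : C) := (1 + tau * s) ^+ m * ((\sum_j (u i j).[s] * x j 0) * w.[s]^-1).
have DrD z : D z -> cmod z <= rD by case.
have hF i : has_taylor2 D (F i).
  apply: has_taylor2M.
    apply: has_taylor2_X; apply: has_taylor2D (has_taylor2_cst _ _) _.
    by apply: has_taylor2M (has_taylor2_cst _ _) (has_taylor2_id DrD).
  apply: has_taylor2M.
    apply: has_taylor2_sum => j _; apply: has_taylor2M (has_taylor2_cst _ _).
    exact: has_taylor2_poly DrD.
  apply: (@has_taylor2V _ D _ (mu / 2)); first by rewrite divr_gt0.
    by move=> z [].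
  exact: has_taylor2_poly DrD.
have hD s z : ~ W s -> `|complex.Re s| <= H + 1 -> `|complex.Im s| <= H + 1 ->
    cmod (z - s) <= rho -> D z.
  move=> Ws sr si zs; have sH : cmod s <= 2 * (H + 1).
    by apply: le_trans (cmod_ReIm _) _; lra.
  have zrD : cmod z <= rD.
    have -> : z = s + (z - s) by ring.
    by apply: le_trans (cmodD _ _) _; rewrite /rD; lra.
  have srD : cmod s <= rD by rewrite /rD; lra.
  split=> //; have ws : mu <= cmod w.[s] by apply: hmu => // /sigmaW.
  have := hMw s z srD zrD; have := ler_wpM2l Mw0 zs.
  have := cmodB w.[z] (w.[z] - w.[s]).
  have -> : w.[z] - (w.[z] - w.[s]) = w.[s] by ring.
  by lra.
have hM s z : ~ W s -> W z -> cmod (z - s) <= rho -> pnorm p (\col_i F i s) <= M.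
  move=> Ws Wz zs; have nsig : ~ sigma s by move=> /sigmaW.
  have [ws Gs] := outside_pseudospectrum w0 tE bez nsig.
  have -> : \col_i F i s =
      (1 + tau * s) ^+ m *: ((\matrix_(i, j) ((u i j).[s] / w.[s])) *m x).
    apply/colP => i; rewrite !mxE /F; congr (_ * _); rewrite mulr_suml.
    by apply: eq_bigr => j _; rewrite mxE; ring.
  rewrite pnormZ//; apply: ler_pM; rewrite ?cmod_ge0 ?pnorm_ge0//; last first.
    exact: le_trans (opnorm_ge p1 _ x1) Gs.
  apply: le_trans (power_modulus_bound s t m0) _; rewrite ler_expR.
  have [zr zi] := Wr z Wz.
  have sz : complex.Re s <= a + m%:R^-1.
    have := cmod_Re (z - s); have : complex.Re (z - s) = complex.Re z - complex.Re s.
      by case: (z) (s) => [z1 z2] [s1 s2].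
    by move=> ->; rewrite ler_norml; have := Wa z Wz; lra.
  have s2 : cmod s <= 2 * r + 1.
    have -> : s = z - (z - s) by ring.
    apply: le_trans (cmodB _ _) _; have := cmod_ReIm z; lra.
  apply: lerD; first exact: ler_wpM2l.
  rewrite ler_wpM2r ?invr_ge0 ?mulr_ge0 ?(ltW mR)//.
  by rewrite ler_wpM2l ?sqr_ge0// lerXn2r ?nnegrE ?cmod_ge0//; lra.
have e110 : 0 < Num.min e1 1 by rewrite lt_min e10 ltr01.
have nZ (k : C) (y : 'cV[C]_Q) : pnorm p (k *: y) <= cmod k * pnorm p y.
  by rewrite pnormZ.
have [cc ccle hn] := @contour_bound R Q (@pnorm R p Q) (@pnormD R p p1 Q) nZ
  (@pnorm_ge0 R p p1 Q) (@pnorm_le_sum R p p1 Q) W D F M l r rho H M0 rho0 r0 Hr hF Wr hD hM l0 Wl _ e110.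
have [cce1 cc1] : cmod cc <= e1 /\ cmod cc <= 1.
  by move: ccle; rewrite le_min => /andP[].
have /choice[n0 hn0] := fun i => hH0 i H cc (HH i) cc1.
have [n nge hvc] := hn (\sum_i n0 i)%N.
have n0n i : (n0 i <= n)%N.
  by apply: leq_trans nge; rewrite (bigD1 i)//= leq_addr.
set y := L *m (_ *m (B *m x)).
have -> : 2 * pi * pnorm p y = pnorm p ((2 * pi%:C * 'i%C) *: y).
  rewrite pnormZ// !cmodM cmod_i mulr1 cmod_nat cmodR gtr0_norm ?pi_gt0//.
set V := vcirc F _ _ n in hvc.
have -> : (2 * pi%:C * 'i%C) *: y = V + ((2 * pi%:C * 'i%C) *: y - V).
  by rewrite addrC subrK.
apply: le_trans (pnormD p1 _ _) _.
have : pnorm p ((2 * pi%:C * 'i%C) *: y - V) <= Q%:R * e1.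
  apply: le_trans (pnorm_le_sum p1 _) _.
  have -> : Q%:R * e1 = \sum_(i < Q) e1 by rewrite sumr_const card_ord mulr_natl.
  apply: ler_sum => i _.
  rewrite !mxE cmodC.
  apply: le_trans (hn0 i n (n0n i)); rewrite le_eqVlt; apply/orP; left; apply/eqP.
  congr cmod; congr (_ - _); last by rewrite mxE.
  (* The outer boundary lies beyond the spectrum of [A], where the reduced form is the resolvent
     expression. *)
  apply: eq_circ => s1 s2 s101 s201 ss; set s := _ + _.
  have := outer_boundary_far cc H_gt0 s101 s201 ss; rewrite -/s => sc.
  have As : l1norm A < cmod s by rewrite aAE; have := cmodB s cc; lra.
  have us := resolvent_unit As.
  rewrite /F [RHS]mxE; congr (_ * _).
  rewrite !mulmxA -[L *m _ *m B *m x]/((L *m _ *m B) *m x) [RHS]mxE mulr_suml.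
  by apply: eq_bigr => j _; rewrite -uE//; ring.
have : e = Q%:R * e1 + e1.
  by rewrite /e1; field; rewrite gt_eqF// ltr_wpDl.
have : Num.min e1 1 <= e1 by rewrite ge_min lexx.
by move: hvc; rewrite /M; lra.
Qed.

Lemma opnorm_bound (W : set C) (r a l t : R) :
  sigma `<=` W -> 0 <= r ->
  (forall w, W w -> `|complex.Re w| <= r /\ `|complex.Im w| <= r) ->
  (forall w, W w -> complex.Re w <= a) ->
  0 <= l -> (arc_length (boundary W) <= l%:E)%E -> 0 <= t ->
  opnorm p (L *m expmx (t%:C *: A) *m B) <= l * expR (t * a) / (2 * pi * eps).
Proof.
move=> sigmaW r0 Wr Wa l0 Wl t0; have pi0 : 0 < 2 * pi :> R by rewrite mulr_gt0// pi_gt0.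
set G := _ / _.
have G0 : 0 <= G.
  by apply: divr_ge0; apply: mulr_ge0; rewrite ?expR_ge0 ?(ltW pi0) ?(ltW eps0).
apply: opnorm_le => // x x1; apply/ler_addgt0Pr => e e0.
pose kap := l1norm L * l1norm (B *m x).
have kap0 : 0 <= kap by rewrite mulr_ge0 ?l1norm_ge0.
have e20 : 0 < e / 2 / (kap + 1) by rewrite !divr_gt0// ltr_wpDl.
have [m0 hm0] := expmx_compound (t%:C *: A) e20.
pose k := t + t ^+ 2 * (2 * r + 1) ^+ 2 / 2.
have k0 : 0 <= k.
  by rewrite addr_ge0// divr_ge0// mulr_ge0 ?sqr_ge0.
(* [2 * k <= m] gives [expR (k / m) <= 1 + 2 * k / m], and [4 * k * G / e <= m] makes the excess at
   most [e / 2]. The other half of [e] pays for [expmx_compound]. *)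
pose m := (m0 + (Num.truncn (2 * k + 4 * k * G / e)).+1)%N.
have m_gt0 : (0 < m)%N by rewrite /m addnS.
have mR : 0 < m%:R :> R by rewrite ltr0n.
have kG0 : 0 <= 4 * k * G / e.
  by apply: divr_ge0 (ltW e0); apply: mulr_ge0 G0; exact: mulr_ge0.
have mk : 2 * k + 4 * k * G / e <= m%:R.
  by apply: le_trans (ltW (truncnS_gt _)) _; rewrite ler_nat leq_addl.
have exp_k : expR (k / m%:R) <= 1 + 2 * k / m%:R.
  set z := k / m%:R; have z0 : 0 <= z by rewrite divr_ge0// ltW.
  have z1 : z <= 1 / 2 by rewrite /z ler_pdivrMr//; lra.
  have := expR_ge1Dx (- z); rewrite expRN => h.
  have E0 := expR_gt0 z.
  have zE : (1 - z) * expR z <= 1 by rewrite -ler_pdivlMr// div1r.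
  have -> : 2 * k / m%:R = 2 * z by rewrite /z; ring.
  rewrite -(@ler_pM2l _ (1 - z)); last lra.
  by apply: le_trans zE _; nra.
have gE : growth r a t m = expR (t * a) * expR (k / m%:R).
  by rewrite /growth -expRD; congr expR; rewrite /k; field; rewrite gt_eqF.
have est := contour_estimate sigmaW r0 Wr Wa l0 Wl t0 m_gt0 x1.
set Y := (1%:M + _ *: A) ^+ m in est.
have hY : l1norm (Y - expmx (t%:C *: A)) <= e / 2 / (kap + 1).
  apply: le_trans (hm0 m _); last exact: leq_addr.
  by rewrite /Y scalerA [m%:R^-1 * _]mulrC.
have -> : L *m expmx (t%:C *: A) *m B *m x =
   L *m (Y *m (B *m x)) - L *m ((Y - expmx (t%:C *: A)) *m (B *m x)).
  by rewrite mulmxBl mulmxBr opprB addrC subrK !mulmxA.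
have -> (y z : 'cV[C]_Q) : y - z = y + (-1) *: z by rewrite scaleN1r.
apply: le_trans (pnormD p1 _ _) _; rewrite pnormZ// cmodN ComplexField.Normc.normc1 mul1r.
have d1 : pnorm p (L *m ((Y - expmx (t%:C *: A)) *m (B *m x))) <= e / 2.
  apply: le_trans (pnorm_le_sum p1 _) _.
  apply: (@le_trans _ _ (l1norm (L *m ((Y - expmx (t%:C *: A)) *m (B *m x))))).
    by apply: ler_sum => i _; rewrite big_ord_recl big_ord0 addr0.
  apply: le_trans (l1norm_mulmx _ _) _.
  apply: le_trans (ler_wpM2l (l1norm_ge0 _) (l1norm_mulmx _ _)) _.
  rewrite mulrCA; apply: le_trans (ler_wpM2r _ hY) _; first exact: kap0.
  rewrite -/kap -(mulrA (e / 2)); apply: ler_piMr; first by apply: divr_ge0 (ltW e0) _.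
  by rewrite mulrC ler_pdivrMr ?ltr_wpDl// mul1r lerDl.
have d2 : pnorm p (L *m (Y *m (B *m x))) <= G * (1 + 2 * k / m%:R).
  have : pnorm p (L *m (Y *m (B *m x))) <= growth r a t m * eps^-1 * l / (2 * pi).
    by rewrite ler_pdivlMr// mulrC.
  move=> /le_trans; apply; rewrite gE.
  have -> : expR (t * a) * expR (k / m%:R) / eps * l / (2 * pi) = G * expR (k / m%:R).
    by rewrite /G !invfM; ring.
  exact: ler_wpM2l.
have d3 : G * (2 * k / m%:R) <= e / 2.
  rewrite mulrA ler_pdivrMr//.
  have : 4 * k * G / e <= m%:R by lra.
  by rewrite ler_pdivrMr//; lra.
by rewrite mulrDr mulr1 in d2; lra.
Qed.

End PseudospectralBound.

Section HullAndLength.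
Variable R : realType.
Implicit Types S : set R[i].

Lemma sub_convex_hull S : S `<=` convex_hull S.
Proof. by move=> s Ss K [_ SK]; exact: SK. Qed.

(** A closed half-plane is convex. Four of them bound the hull, and a fifth controls its
    abscissa. *)
Lemma convex_hull_halfplane S (x y c : R) :
  (forall s, S s -> x * complex.Re s + y * complex.Im s <= c) ->
  forall s, convex_hull S s -> x * complex.Re s + y * complex.Im s <= c.
Proof.
move=> Sc s hs.
apply: (hs [set z : R[i] | x * complex.Re z + y * complex.Im z <= c]).
split=> // a b k; rewrite !in_setE /= => ha hb.
have ReE : complex.Re (conv k a b : R[i]) =
    k%:num * complex.Re (a : R[i]) + (1 - k%:num) * complex.Re (b : R[i]).
  by case: a b {ha hb} => [a1 a2] [b1 b2].
have ImE : complex.Im (conv k a b : R[i]) =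
    k%:num * complex.Im (a : R[i]) + (1 - k%:num) * complex.Im (b : R[i]).
  by case: a b {ha hb ReE} => [a1 a2] [b1 b2].
have k0 : 0 <= k%:num by [].
have k1 : 0 <= 1 - k%:num by rewrite subr_ge0.
have := ler_wpM2l k0 ha; have := ler_wpM2l k1 hb; rewrite ReE ImE; lra.
Qed.

Lemma arc_length_ge0 S : (0 <= arc_length S)%E.
Proof.
apply: (@le_trans _ _ (arc_length_at S 1)).
  by apply: le_ereal_inf_tmp => _ [U _ <-]; apply: nneseries_ge0 => k _ _; exact: diam_ge0.
by apply: ereal_sup_ubound; exists 1 => //=.
Qed.

Lemma arc_length_set0 : arc_length (set0 : set R[i]) = 0%E.
Proof.
have diam0 : diam (set0 : set R[i]) = 0%E.
  rewrite /diam set0X image_set0 ereal_sup0.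
  by apply/max_idPl; exact: leNye.
apply/eqP; rewrite eq_le arc_length_ge0 andbT.
apply: ge_ereal_sup => _ [d /= d0 <-]; apply: ereal_inf_lbound.
exists (fun=> set0); first by split=> // k; rewrite diam0 lee_fin ltW.
by apply: eseries0 => k _ _; exact: diam0.
Qed.

End HullAndLength.

Theorem theorem4 (R : realType) (N P Q : nat)
    (A : 'M[R[i]]_N) (B : 'M[R[i]]_(N, P)) (C : 'M[R[i]]_(Q, N))
    (p : \bar R) (p_ge1 : (1 <= p)%E) (eps : R) (eps_gt0 : 0 < eps)
    (L : \bar R)
    (L_def : L = arc_length (boundary (io_pseudospectrum p eps A B C)) \/
             L = arc_length
                   (boundary (convex_hull (io_pseudospectrum p eps A B C))))
    (t : R) (t_ge0 : 0 <= t) :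
  ((opnorm p (C *m expmx (t%:C *: A) *m B))%:E <=
   L * expeR (t%:E * io_abscissa p eps A B C) * ((2 * pi * eps)^-1)%:E)%E.
Proof.
set sigma := io_pseudospectrum p eps A B C.
have [r r0 sigma_r] := pseudospectrum_bounded p_ge1 eps_gt0 A B C.
have pie : 0 < (2 * pi * eps)^-1.
  by rewrite invr_gt0 !mulr_gt0// pi_gt0.
(* The properties shared by the pseudospectrum and its hull; the rest of the proof treats both at
   once. *)
have [W [sigmaW W0 Whalf LE]] : exists W : set R[i], [/\ sigma `<=` W,
    sigma = set0 -> W = set0,
    forall x y c : R, (forall s, sigma s -> x * complex.Re s + y * complex.Im s <= c) ->
      forall s, W s -> x * complex.Re s + y * complex.Im s <= c &
    L = arc_length (boundary W)].
  case: L_def => LE; [exists sigma|exists (convex_hull sigma)]; split => //.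
  - exact: sub_convex_hull.
  - move=> s0; apply/seteqP; split=> // s hs; apply: (hs set0); split; last by rewrite s0.
    by move=> a b k; rewrite in_setE.
  - exact: convex_hull_halfplane.
have Wr w : W w -> `|complex.Re w| <= r /\ `|complex.Im w| <= r.
  have box s : sigma s -> `|complex.Re s| <= r /\ `|complex.Im s| <= r.
    move=> /sigma_r sr.
    by split; [apply: le_trans (cmod_Re _) _|apply: le_trans (cmod_Im _) _].
  move=> Ww; have := Whalf 1 0 r _ w Ww; have := Whalf (-1) 0 r _ w Ww.
  have := Whalf 0 1 r _ w Ww; have := Whalf 0 (-1) r _ w Ww.
  move=> h1 h2 h3 h4; rewrite !ler_norml; split; apply/andP; split.
  - suff : -1 * complex.Re w + 0 * complex.Im w <= r by lra.
    by apply: h3 => s /box[]; rewrite !ler_norml => /andP[? _] _; lra.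
  - suff : 1 * complex.Re w + 0 * complex.Im w <= r by lra.
    by apply: h4 => s /box[]; rewrite !ler_norml => /andP[_ ?] _; lra.
  - suff : 0 * complex.Re w + -1 * complex.Im w <= r by lra.
    by apply: h1 => s /box[_]; rewrite !ler_norml => /andP[? _]; lra.
  - suff : 0 * complex.Re w + 1 * complex.Im w <= r by lra.
    by apply: h2 => s /box[_]; rewrite !ler_norml => /andP[_ ?]; lra.
have bound a l : (forall w, W w -> complex.Re w <= a) -> 0 <= l ->
    (arc_length (boundary W) <= l%:E)%E ->
    opnorm p (C *m expmx (t%:C *: A) *m B) <= l * expR (t * a) / (2 * pi * eps).
  by move=> Wa l0 Wl; exact: (opnorm_bound p_ge1 eps_gt0 sigmaW r0 Wr Wa l0 Wl t_ge0).
(* An empty pseudospectrum has abscissa [-oo], so no real [a] represents it. The bound with [l = 0]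
   then shows that the norm is at most 0. *)
have [s0|/set0P[s1 sigma1]] := eqVneq sigma set0.
  apply: (@le_trans _ _ 0%E).
    rewrite lee_fin; have := bound 0 0; rewrite !mul0r; apply => //; first by rewrite W0.
    by rewrite W0// /boundary closure0 set0D arc_length_set0.
  rewrite LE !mule_ge0 ?arc_length_ge0 ?expeR_ge0//.
  by rewrite lee_fin ltW.
have [a aE] : exists a : R, io_abscissa p eps A B C = a%:E.
  have : (io_abscissa p eps A B C <= r%:E)%E.
    apply: ge_ereal_sup => _ [s /sigma_r sr <-]; rewrite lee_fin.
    exact: le_trans (ler_norm _) (le_trans (cmod_Re _) sr).
  have : ((complex.Re s1)%:E <= io_abscissa p eps A B C)%E.
    by apply: ereal_sup_ubound; exists s1.
  by case: (io_abscissa _ _ _ _ _) => // a _ _; exists a.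
have Wa w : W w -> complex.Re w <= a.
  move=> Ww; suff : 1 * complex.Re w + 0 * complex.Im w <= a by lra.
  apply: Whalf Ww => s sigma_s; rewrite mul1r mul0r addr0 -lee_fin -aE.
  by apply: ereal_sup_ubound; exists s.
have := arc_length_ge0 (boundary W); rewrite aE -EFinM /= -LE.
(* For infinite arc length the right-hand side is [+oo], because the exponential is positive. *)
case: L LE {L_def} => [l LE l0|_ _|//].
  by rewrite -!EFinM lee_fin; apply: bound => //; rewrite -LE.
by rewrite gt0_mulye ?lte_fin ?expR_gt0// gt0_mulye ?lte_fin// leey.
Qed.
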